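(* Assume that $U$ is closed-valued with Borel graph, that $f,g$ satisfy the regularity conditions stated in the context, and that $u^0\in\mathfrak U$ is $\tau$-optimal, with trajectory $x^0=x^{u^0}$. Let one of the following two conditions hold: (a) the limit $I_*:=\lim_{n\to\infty,\,\xi\to0}I_\xi(\tau_n)$ exists in $\mathbb X$; (b) the limit $\iota_*:=\lim_{n\to\infty,\,\xi\to0}\dfrac{I_\xi(\tau_n)}{\|I_\xi(\tau_n)\|}$ exists in $\mathbb X$ and $\lim_{n\to\infty,\,\xi\to0}\|I_\xi(\tau_n)\|=\infty$. Then there exists a $\tau$-vanishing multiplier $(\lambda^0,\psi^0)\in\Lambda$. Moreover, this multiplier satisfies, for all $T\in\mathbb T$, the corresponding formula: in case (a), $$\lambda^0=1,\qquad \psi^0(T)=\Big(I_*-\int_0^T\frac{\partial g}{\partial x}(t,x^0(t),u^0(t))A_0(t)\,dt\Big)A_0^{-1}(T);$$ in case (b), $$\lambda^0=0,\qquad\psi^0(T)=\iota_*A_0^{-1}(T).$$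
   Context: Setting. $\mathbb T=[0,\infty)$, $\mathbb X=\mathbb R^m$, $\mathbb L$ is the space of real $m\times m$ matrices, $\mathbb U$ is a finite-dimensional Euclidean space. $U$ assigns to each $t\in\mathbb T$ a subset $U(t)\subset\mathbb U$; $\mathfrak U$ is the set of Borel measurable locally bounded $u:\mathbb T\to\mathbb U$ with $u(t)\in U(t)$. Let $f:\mathbb T\times\mathbb X\times\mathbb U\to\mathbb X$, $g:\mathbb T\times\mathbb X\times\mathbb U\to\mathbb R$, $x_{**}\in\mathbb X$. For $u\in\mathfrak U$, $x^u$ solves $\dot x=f(t,x,u(t))$, $x(0)=x_{**}$, and $J^u(T)=\int_0^T g(t,x^u(t),u(t))\,dt$. Regularity conditions on $f,g$: each of $a=f,\ g,\ \partial f/\partial x,\ \partial g/\partial x$ is defined on $\mathbb T\times\mathbb X\times\mathbb U$, is Carath\'eodory (Borel in $t$ for all $(x,u)$, continuous in $(x,u)$ for a.e. $t$), and for each compact $K\subset\mathbb X\times\mathbb U$ there are locally integrable $L^a_K,M^a_K:\mathbb T\to\mathbb T$ with $\|a(t,x,u)-a(t,y,u)\|\le L^a_K(t)\|x-y\|$ and $\|a(t,x,u)\|\le M^a_K(t)$ for all $(x,u),(y,u)\in K$, $t\in\mathbb T$. Moreover $f$ has sublinear growth in $x$: for each compact $C\subset\mathbb U$ there is a locally integrable $l_C$ with $\|f(t,x,u)\|\le l_C(t)(1+\|x\|)$ for $u\in C$. $\tau=(\tau_n)_{n\in\mathbb N}$ is a sequence of times with $\tau_n\uparrow\infty$; $u^0\in\mathfrak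 U$ is $\tau$-optimal if $\limsup_{n\to\infty}\sup_{u\in\mathfrak U}(J^u(\tau_n)-J^{u^0}(\tau_n))=0$. Multipliers. Shadow prices $\psi$ and $\partial g/\partial x$ are row vectors. $\mathcal H(x,t,u,\lambda,\psi)=\psi f(t,x,u)+\lambda g(t,x,u)$ for $\lambda\ge0$. A Lagrange multiplier associated with $(x^0,u^0)$ is a nontrivial pair $(\lambda,\psi)\in[0,1]\times C(\mathbb T,\mathbb X)$ with, for a.e. $t$, $\dot\psi(t)=-\frac{\partial\mathcal H}{\partial x}(x^0(t),t,u^0(t),\lambda,\psi(t))$ and $\sup_{p\in U(t)}\mathcal H(x^0(t),t,p,\lambda,\psi(t))=\mathcal H(x^0(t),t,u^0(t),\lambda,\psi(t))$. $\Lambda$ is the set of such multipliers with either $\lambda=1$, or $\lambda=0$ and $\|\psi(0)\|=1$. Consider the system (S) for $(\psi,x,\lambda)$, $\lambda\ge0$: $\dot\psi=-\frac{\partial\mathcal H}{\partial x}(x(t),t,u^0(t),\lambda,\psi(t))$, $\dot x=f(t,x(t),u^0(t))$, $\dot\lambda=0$. A Lagrange multiplier $(\lambda^0,\psi^0)$ associated with $(x^0,u^0)$ is $\tau$-vanishing if there are a subsequence $\tau'$ of $\tau$ and solutions $(\psi_n,x_n,\lambda_n)$ of (S) converging pointwise to $(\psi^0,x^0,\lambda^0)$ with $\psi_n(\tau'_n)=0$ for every $n$. For $\xi\in\mathbb X$: $\dot x_\xi=f(t,x_\xi,u^0(t))$, $x_\xi(0)=x_{**}+\xi$; $\dot A_\xi=\frac{\partial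 f}{\partial x}(t,x_\xi(t),u^0(t))A_\xi$, $A_\xi(0)=1_{\mathbb L}$ (identity); $I_\xi(T)=\int_0^T\frac{\partial g}{\partial x}(t,x_\xi(t),u^0(t))A_\xi(t)\,dt$. $A_0,I_0$ correspond to $\xi=0$. Limits ''$n\to\infty,\ \xi\to0$'' are joint limits. *)

(* Defs.v *)
From HB Require Import structures.
From mathcomp Require Import all_boot all_order all_algebra.
From mathcomp Require Import all_classical all_reals all_analysis.

Set Implicit Arguments.
Unset Strict Implicit.
Unset Printing Implicit Defensive.

Import Order.TTheory GRing.Theory Num.Theory.
Import numFieldNormedType.Exports.

Local Open Scope classical_set_scope.
Local Open Scope ring_scope.

(* States and controls are column vectors, shadow prices
   and gradients in the state are row vectors.  Functions of time are total
   functions on R; only their values on [0, +oo[ are ever constrained. *)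

Notation halfline R := (`[(0 : R), +oo[%classic : set R%type).

Notation borel V := (g_sigma_algebraType (@open V)).

(* The norm `|_| of the normed-module structure on matrices is the sup norm,
   which has the same topology and bounded sets as the Euclidean norm [norm2]
   but normalises vectors differently. *)
Definition norm2 (R : realType) m n (A : 'M[R]_(m, n)) : R :=
  Num.sqrt (\sum_i \sum_j (A i j) ^+ 2).

(* Lebesgue (rather than only Borel) local integrability on [0, +oo[. *)
Definition loc_integrable (R : realType) (h : R -> R) : Prop :=
  exists2 h' : R -> R,
    (forall b : R, (@lebesgue_measure R).-integrable `[0, b] (EFin \o h'))
    & {ae (@lebesgue_measure R), forall t, 0 <= t -> h t = h' t}.

Definition abs_cont (R : realType) (V : normedModType R) (b : R) (h : R -> V)
    : Prop :=
  forall e : R, 0 < e -> exists2 d : R, 0 < d &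
    forall (n : nat) (s t : 'I_n -> R),
      (forall i, 0 <= s i /\ s i <= t i /\ t i <= b) ->
      trivIset setT (fun i => `]s i, t i[%classic) ->
      \sum_i (t i - s i) < d ->
      \sum_i `|h (t i) - h (s i)| < e.

(* Caratheodory solutions on [0, +oo[ of  dx/dt = v(t)  a.e.; the right-hand
   side [v] is to be instantiated with an expression containing [x]. *)
Definition solves (R : realType) (V : normedModType R) (x v : R -> V) : Prop :=
  (forall b : R, 0 <= b -> abs_cont b x) /\
  {ae (@lebesgue_measure R), forall t, 0 <= t ->
    is_derive (t : R^o) (1 : R^o) (x : R^o -> V) (v t)}.

Definition jac (R : realType) m p (h : 'cV[R]_m -> 'cV[R]_p) (x : 'cV[R]_m)
    : 'M[R]_(p, m) :=
  \matrix_(i, j) ('d h x (delta_mx j 0 : 'cV[R]_m)) i 0.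

Definition grad (R : realType) m (h : 'cV[R]_m -> R) (x : 'cV[R]_m)
    : 'rV[R]_m :=
  \row_j 'd (h : 'cV[R]_m -> R^o) x (delta_mx j 0 : 'cV[R]_m).

(* Along a trajectory the integrands below agree a.e. with a Borel function;
   the library integral is defined for all functions and does not see null
   sets, so it is the Lebesgue integral also when they are not Borel. *)
Definition row_integral (R : realType) m (b : R) (h : R -> 'rV[R]_m)
    : 'rV[R]_m :=
  \row_j (\int[@lebesgue_measure R]_(t in `[0, b]) h t 0 j).

Definition caratheodory (R : realType) m k (V : normedModType R)
    (a : R -> 'cV[R]_m -> 'cV[R]_k -> V) : Prop :=
  (forall x u, measurable_fun (halfline R) ((fun t => a t x u) : R -> borel V))
  /\ {ae (@lebesgue_measure R), forall t, 0 <= t ->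
       continuous (fun xu : 'cV[R]_m * 'cV[R]_k => a t xu.1 xu.2)}.

(* Here and in [sublinear_growth], passing to equivalent norms only multiplies
   the bounds L, M, l by constants, so `|_| can be used. *)
Definition regular (R : realType) m k (V : normedModType R)
    (a : R -> 'cV[R]_m -> 'cV[R]_k -> V) : Prop :=
  caratheodory a /\
  forall K : set ('cV[R]_m * 'cV[R]_k), compact K ->
    exists L M : R -> R,
      [/\ (forall t, 0 <= t -> 0 <= L t /\ 0 <= M t),
          loc_integrable L, loc_integrable M,
          (forall t x y u, 0 <= t -> K (x, u) -> K (y, u) ->
             `|a t x u - a t y u| <= L t * `|x - y|)
        & (forall t x u, 0 <= t -> K (x, u) -> `|a t x u| <= M t)].

Definition sublinear_growth (R : realType) m k
    (f : R -> 'cV[R]_m -> 'cV[R]_k -> 'cV[R]_m) : Prop :=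
  forall C : set 'cV[R]_k, compact C ->
    exists l : R -> R,
      [/\ (forall t, 0 <= t -> 0 <= l t), loc_integrable l
        & (forall t x u, 0 <= t -> C u -> `|f t x u| <= l t * (1 + `|x|))].

Definition regularity_conditions (R : realType) m k
    (f : R -> 'cV[R]_m -> 'cV[R]_k -> 'cV[R]_m)
    (g : R -> 'cV[R]_m -> 'cV[R]_k -> R) : Prop :=
  [/\ (forall t x u, 0 <= t ->
         differentiable (fun y => f t y u) x /\
         differentiable ((fun y => g t y u) : 'cV[R]_m -> R^o) x),
      regular f /\ regular (fun t x u => (g t x u : R^o)),
      regular (fun t x u => jac (fun y => f t y u) x),
      regular (fun t x u => grad (fun y => g t y u) x)
    & sublinear_growth f].

Definition closed_valued (R : realType) k (U : R -> set 'cV[R]_k) : Prop :=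
  forall t, 0 <= t -> closed (U t).

Definition borel_graph (R : realType) k (U : R -> set 'cV[R]_k) : Prop :=
  measurable ([set tp | 0 <= tp.1 /\ U tp.1 tp.2]
              : set (borel (R^o * 'cV[R]_k)%type)).

Definition admissible (R : realType) k (U : R -> set 'cV[R]_k)
    (u : R -> 'cV[R]_k) : Prop :=
  [/\ measurable_fun (halfline R) (u : R -> borel 'cV[R]_k),
      [locally [bounded u t | t in halfline R]]
    & forall t, 0 <= t -> U t (u t)].

Definition trajectory (R : realType) m k
    (f : R -> 'cV[R]_m -> 'cV[R]_k -> 'cV[R]_m) (xinit : 'cV[R]_m)
    (u : R -> 'cV[R]_k) (x : R -> 'cV[R]_m) : Prop :=
  solves x (fun t => f t (x t) (u t)) /\ x 0 = xinit.

Definition payoff (R : realType) m k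
    (g : R -> 'cV[R]_m -> 'cV[R]_k -> R)
    (u : R -> 'cV[R]_k) (x : R -> 'cV[R]_m) (b : R) : R :=
  \int[@lebesgue_measure R]_(t in `[0, b]) g t (x t) (u t).

(* The trajectory of each admissible control is unique, so ranging over all
   pairs (control, trajectory) is ranging over all admissible controls. *)
Definition tau_optimal (R : realType) m k
    (f : R -> 'cV[R]_m -> 'cV[R]_k -> 'cV[R]_m)
    (g : R -> 'cV[R]_m -> 'cV[R]_k -> R) (U : R -> set 'cV[R]_k)
    (xinit : 'cV[R]_m) (tau : nat -> R)
    (u0 : R -> 'cV[R]_k) (x0 : R -> 'cV[R]_m) : Prop :=
  limn_esup (fun n => ereal_sup
    [set (payoff g ux.1 ux.2 (tau n) - payoff g u0 x0 (tau n))%:E | ux in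
       [set ux : (R -> 'cV[R]_k) * (R -> 'cV[R]_m) |
          admissible U ux.1 /\ trajectory f xinit ux.1 ux.2]]) = 0%E.

Definition hamiltonian (R : realType) m k
    (f : R -> 'cV[R]_m -> 'cV[R]_k -> 'cV[R]_m)
    (g : R -> 'cV[R]_m -> 'cV[R]_k -> R)
    (x : 'cV[R]_m) (t : R) (u : 'cV[R]_k) (lam : R) (psi : 'rV[R]_m) : R :=
  (psi *m f t x u) 0 0 + lam * g t x u.

Definition hamiltonian_x (R : realType) m k
    (f : R -> 'cV[R]_m -> 'cV[R]_k -> 'cV[R]_m)
    (g : R -> 'cV[R]_m -> 'cV[R]_k -> R)
    (x : 'cV[R]_m) (t : R) (u : 'cV[R]_k) (lam : R) (psi : 'rV[R]_m)
    : 'rV[R]_m :=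
  grad (fun y => hamiltonian f g y t u lam psi) x.

Definition multiplier (R : realType) m k
    (f : R -> 'cV[R]_m -> 'cV[R]_k -> 'cV[R]_m)
    (g : R -> 'cV[R]_m -> 'cV[R]_k -> R) (U : R -> set 'cV[R]_k)
    (u0 : R -> 'cV[R]_k) (x0 : R -> 'cV[R]_m)
    (lam : R) (psi : R -> 'rV[R]_m) : Prop :=
  [/\ 0 <= lam <= 1 /\ ~ (lam = 0 /\ forall t, 0 <= t -> psi t = 0),
      {within halfline R, continuous psi},
      solves psi (fun t => - hamiltonian_x f g (x0 t) t (u0 t) lam (psi t))
    & {ae (@lebesgue_measure R), forall t, 0 <= t ->
        ereal_sup [set (hamiltonian f g (x0 t) t p lam (psi t))%:E | p in U t]
        = (hamiltonian f g (x0 t) t (u0 t) lam (psi t))%:E}].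

Definition Lambda (R : realType) m k
    (f : R -> 'cV[R]_m -> 'cV[R]_k -> 'cV[R]_m)
    (g : R -> 'cV[R]_m -> 'cV[R]_k -> R) (U : R -> set 'cV[R]_k)
    (u0 : R -> 'cV[R]_k) (x0 : R -> 'cV[R]_m)
    (lam : R) (psi : R -> 'rV[R]_m) : Prop :=
  multiplier f g U u0 x0 lam psi /\
  (lam = 1 \/ (lam = 0 /\ norm2 (psi 0) = 1)).

Definition system_solution (R : realType) m k
    (f : R -> 'cV[R]_m -> 'cV[R]_k -> 'cV[R]_m)
    (g : R -> 'cV[R]_m -> 'cV[R]_k -> R) (u0 : R -> 'cV[R]_k)
    (psi : R -> 'rV[R]_m) (x : R -> 'cV[R]_m) (lam : R -> R) : Prop :=
  [/\ (forall t, 0 <= t -> 0 <= lam t),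
      solves psi (fun t => - hamiltonian_x f g (x t) t (u0 t) (lam t) (psi t)),
      solves x (fun t => f t (x t) (u0 t))
    & solves (lam : R -> R^o) (fun=> 0)].

Definition tau_vanishing (R : realType) m k
    (f : R -> 'cV[R]_m -> 'cV[R]_k -> 'cV[R]_m)
    (g : R -> 'cV[R]_m -> 'cV[R]_k -> R) (tau : nat -> R)
    (u0 : R -> 'cV[R]_k) (x0 : R -> 'cV[R]_m)
    (lam0 : R) (psi0 : R -> 'rV[R]_m) : Prop :=
  exists (sub : nat -> nat) (psi : nat -> R -> 'rV[R]_m)
         (x : nat -> R -> 'cV[R]_m) (lam : nat -> R -> R),
    [/\ {homo sub : i j / (i < j)%N},
        (forall n, system_solution f g u0 (psi n) (x n) (lam n)),
        (forall t, 0 <= t ->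
           [/\ psi n t @[n --> \oo] --> psi0 t,
               x n t @[n --> \oo] --> x0 t
             & lam n t @[n --> \oo] --> lam0])
      & (forall n, psi n (tau (sub n)) = 0)].

(* The matrices A_xi of the linearisation along the trajectory x. *)
Definition fundamental_matrix (R : realType) m k
    (f : R -> 'cV[R]_m -> 'cV[R]_k -> 'cV[R]_m) (u0 : R -> 'cV[R]_k)
    (x : R -> 'cV[R]_m) (A : R -> 'M[R]_m) : Prop :=
  solves A (fun t => jac (fun y => f t y (u0 t)) (x t) *m A t) /\ A 0 = 1%:M.

Definition sensitivity (R : realType) m k
    (g : R -> 'cV[R]_m -> 'cV[R]_k -> R) (u0 : R -> 'cV[R]_k)
    (x : R -> 'cV[R]_m) (A : R -> 'M[R]_m) (b : R) : 'rV[R]_m :=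
  row_integral b (fun t => grad (fun y => g t y (u0 t)) (x t) *m A t).

(* Joint limit  n --> oo, xi --> 0  (xi <> 0). *)
Definition joint_filter (R : realType) m : set_system (nat * 'cV[R]_m) :=
  filter_prod \oo (0 : 'cV[R]_m)^'.

(* Main.v *)
(* Every step rests on one comparison.  Insert a needle, of measure eps, into u0 on
   a bounded interval [0, b].  Running the varied trajectory backwards from time b
   with the unvaried control gives an initial state xinit + xi with |xi| = O(eps),
   and after b the varied trajectory is X_xi.  The varied payoff at T >= b is thus
   d + J(X_xi, T) with d independent of T, and the mean value theorem gives
   J(X_xi, T) - J(x0, T) = I_{s xi}(T) xi for some 0 < s < 1.  Hence the joint limit
   of I_xi(tau_n) in cases (a) and (b), together with tau-optimality, bounds
   lambda d + psi(0) xi from above.  Expanding (psi y)(t) along the difference y of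
   the two trajectories identifies lambda d + psi(0) xi, up to O(eps^2), with the
   integral of the Hamiltonian gain over the needle.  So a gain on a set of times
   of positive measure is impossible, provided that it can be realised by a
   measurable control: the set of improving pairs (t, p) is Borel, and Choquet's
   capacity argument puts a compact set, whose projection to the time axis still
   has positive measure, inside it; on a compact set the lexicographic minimum is
   a measurable selection.  Finally c_n (I_0(tau_n) - I_0(T)) A_0(T)^-1, with
   c_n = 1 or c_n = 1 / |I_0(tau_n)|, solves the adjoint equation, vanishes at
   tau_n and converges to the multiplier. *)

(* The obstacle is the unbounded horizon: Gronwall constants grow with time, so no remainder
   estimate is uniform in [tau n]. Quadratic remainders therefore enter the comparison only on a
   fixed [0, b], with constants that do not depend on the needle. Beyond b the payoff difference is
   an exact mean value identity without remainder, but its intermediate point s xi moves with n;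
   this is why the limit has to be joint in n and xi. The order of choices is b and the constants,
   then eps and xi, and n last, so that the optimality defect at [tau n] is small against the gain
   of order eps already fixed. The flow is never differentiated in the initial state: I_xi(T) is
   recognised as the gradient of the payoff because it is psi(0) for the adjoint state with psi(T) =
   0. Data are thus prescribed at either end of an interval, and Gronwall and Picard are proved for
   an arbitrary base time. The times at which some control improves the Hamiltonian form the
   projection of a Borel set, which need not be Borel; hence the detour through Suslin sets and
   outer measure. *)
Require Import Defs.
From HB Require Import structures.
From mathcomp Require Import all_boot all_order all_algebra.
From mathcomp Require Import all_classical all_reals all_analysis.
From mathcomp Require Import measurable_realfun ring lra.

Set Implicit Arguments.
Unset Strict Implicit.
Unset Printing Implicit Defensive.

Import Order.TTheory GRing.Theory Num.Theory.
Import numFieldNormedType.Exports HBNNSimple.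

Local Open Scope classical_set_scope.
Local Open Scope ring_scope.

Local Notation mu := lebesgue_measure.
Local Notation dynamics R m k := (R -> 'cV[R]_m -> 'cV[R]_k -> 'cV[R]_m).
Local Notation running R m k := (R -> 'cV[R]_m -> 'cV[R]_k -> R).
Local Notation df_dx f u x t := (jac (fun y => f t y (u t)) (x t)).
Local Notation dg_dx g u x t := (grad (fun y => g t y (u t)) (x t)).

(** * Absolutely continuous functions *)

(** The two-sided derivative is required at interior times only, so values outside [0, b] are
    irrelevant and functions given by a formula on [0, b] can be used as they are. *)
Definition solves_on (R : realType) (V : normedModType R) (b : R)
    (x v : R -> V) : Prop :=
  abs_cont b x /\
  {ae (@lebesgue_measure R), forall t, 0 < t < b ->
    is_derive (t : R^o) (1 : R^o) (x : R^o -> V) (v t)}.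

(** The step is two-sided: at the supremum of the points where P holds it first carries P from a
    point just below up to the supremum, then past it unless b is reached. It replaces covering
    arguments on [a, b]. *)
Lemma real_induction (R : realType) (P : R -> Prop) (a b : R) :
  a <= b -> P a ->
  (forall c, a <= c <= b -> exists2 r : R, 0 < r &
     forall x y, a <= x -> x <= c -> c <= y -> y <= b ->
       c - r < x -> y < c + r -> P x -> P y) ->
  P b.
Proof.
move=> ab Pa step.
pose S := [set c | a <= c <= b /\ P c].
have Sa : S a by split => //; rewrite lexx.
have hS : has_sup S.
  by split; [exists a | exists b => c [/andP[]]].
have aS : a <= sup S by apply: ub_le_sup => //; case: hS.
have Sb : sup S <= b by apply: ge_sup => [|c [/andP[]]//]; exists a.
have [r r0 hr] := step (sup S) (introT andP (conj aS Sb)).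
have [x [/andP[ax xb] Px] hx] := sup_adherent r0 hS.
have xS : x <= sup S by apply: ub_le_sup; [case: hS | split => //; rewrite ax].
have Psup : P (sup S) by apply: (hr x) => //; rewrite ltrDl.
have := Sb; rewrite le_eqVlt => /predU1P[<-//|Sltb].
pose y := Num.min b (sup S + r / 2).
have Sy : sup S < y by rewrite /y lt_min Sltb ltrDl divr_gt0.
have yb : y <= b by rewrite /y ge_min lexx.
have yr : y < sup S + r.
  by rewrite /y gt_min; apply/orP; right; rewrite ltrD2l; lra.
have Py : P y by apply: (hr x) => //; exact: ltW.
have : y <= sup S.
  apply: ub_le_sup; first by case: hS.
  by split => //; rewrite yb (le_trans aS (ltW Sy)).
by rewrite leNgt Sy.
Qed.

Lemma is_derive_expand (R : realType) (F : R -> R) (c w e : R) :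
  is_derive (c : R^o) (1 : R^o) (F : R^o -> R^o) w -> 0 < e ->
  exists2 r : R, 0 < r & forall h, `|h| < r ->
    `|F (c + h) - F c - h * w| <= e * `|h|.
Proof.
move=> [dF vF] e0; move: (dF) => /cvg_ex[l hl].
have lw : l = w by rewrite -vF; apply/esym/cvg_lim.
subst l; move/cvgrPdist_le : hl => /(_ _ e0).
move=> [r /= r0 hr]; exists r => // h hh.
have [->|h0] := eqVneq h 0.
  by rewrite addr0 subrr mul0r subr0 normr0 mulr0.
have := hr h; rewrite /ball_ /= sub0r normrN => /(_ hh h0).
rewrite -[_ *: _]/(h^-1 * _) -[h%:A]/(h * 1) mulr1 => hw.
rewrite (_ : _ - _ - _ = - (h * (w - h^-1 * (F (h + c) - F c)))); last first.
  rewrite mulrBr mulrA divff// mul1r (addrC c h); ring.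
by rewrite normrN normrM mulrC ler_wpM2r.
Qed.

Lemma ae_negl (R : realType) (P : R -> Prop) :
  {ae (@lebesgue_measure R), forall t, P t} ->
  exists A : set R, [/\ measurable A, mu A = 0%E & forall t, ~ A t -> P t].
Proof.
move=> [A [mA A0 hA]]; exists A; split => // t At.
by apply: contrapT => Pt; apply: At; exact: hA.
Qed.

(* The bad null set N is enclosed in an open set G of measure < d; by [real_induction]
   F increases by at most e (c - s) plus its increments over disjoint intervals
   inside G, and these are small by absolute continuity. *)
Lemma solves_on_nonincr (R : realType) (b : R) (F w : R -> R) (s s' : R) :
  @solves_on R R^o b F w ->
  {ae (@lebesgue_measure R), forall t, s < t < s' -> w t <= 0} ->
  0 <= s -> s <= s' -> s' <= b -> F s' <= F s.
Proof.
move=> [acF dF] w0 s0 ss' s'b.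
have [A [mA A0 hA]] := ae_negl dF.
have [A' [mA' A'0 hA']] := ae_negl w0.
apply/ler_addgt0Pr => e1 e10.
(* Derivative errors will contribute e (s' - s) and the intervals inside G another e, together
   e1. *)
pose e := e1 / (s' - s + 1).
have sp : 0 < s' - s + 1 by lra.
have e0 : 0 < e by rewrite divr_gt0.
have [d d0 hd] := acF e e0.
(* The endpoints join the exceptional set, since the sign of the derivative is known only strictly
   between them. *)
pose N := A `|` A' `|` [set s] `|` [set s'].
have mN : measurable N by do 3?apply: measurableU.
have N0 : mu N = 0%E.
  rewrite /N !measureU0//=; try exact: lebesgue_measure_set1.
  - exact: measurableU.
  - by do 2?apply: measurableU.
have N0' : (mu N < +oo)%E by apply: (@le_lt_trans _ _ 0%E) => //; rewrite N0.
have [G [oG NG muG]] : exists U, [/\ open U, N `<=` U & (mu (U `\` N) < (d / 2)%:E)%E].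
  apply: (@lebesgue_regularity_outer R N (d / 2) mN) => //; exact: divr_gt0.
have mG : measurable G by exact: measurable_realfun.open_measurable.
have muGd : (mu G <= (d / 2)%:E)%E.
  rewrite -(setDUK NG) (le_trans (measureU2 _ _ _))//; first exact: measurableD.
  by move: N0 => /= ->; rewrite add0e; exact: ltW.
pose P c := exists (n : nat) (u v : nat -> R),
  [/\ (forall i, (i < n)%N -> [/\ s <= u i, u i <= v i & v i <= c]),
      (forall i j, (i < j)%N -> (j < n)%N -> v i <= u j),
      (forall i, (i < n)%N -> `]u i, v i[ `<=` G)
    & F c - F s <= e * (c - s) + \sum_(i < n) (F (v i) - F (u i))].
have : P s'.
  apply: (@real_induction _ P s s') => //.
    exists 0%N, (fun=> 0), (fun=> 0); split => //.
    by rewrite !subrr mulr0 big_ord0 addr0.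
  move=> c /andP[sc cs'].
  have [Nc|Nc] := pselect (N c).
    have Gc : G c by exact: NG.
    have /nbhs_ballP[r /= r0 hr] := open_nbhs_nbhs (conj oG Gc).
    exists r => // x y sx xc cy ys' rx yr [n [u [v [h1 h2 h3 h4]]]].
    exists n.+1, (fun i => if (i < n)%N then u i else x),
      (fun i => if (i < n)%N then v i else y).
    have xy : x <= y by exact: le_trans cy.
    split.
    - move=> i; rewrite ltnS leq_eqVlt => /predU1P[->|iin].
        by rewrite ltnn.
      rewrite iin; have [? ? ?] := h1 i iin; split => //.
      exact: le_trans xy.
    - move=> i j ij; rewrite ltnS leq_eqVlt => /predU1P[jn|jn].
        rewrite jn ltnn -jn ij; have [] := h1 i; first by rewrite -jn.
        by [].
      by rewrite jn (ltn_trans ij jn); exact: h2.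
    - move=> i; rewrite ltnS leq_eqVlt => /predU1P[->|iin].
        rewrite ltnn => z /=; rewrite in_itv/= => /andP[xz zy]; apply: hr.
        by rewrite /ball/= ltr_norml; apply/andP; split; lra.
      by rewrite iin; exact: h3.
    - rewrite big_ord_recr/= ltnn.
      rewrite (eq_bigr (fun i : 'I_n => F (v i) - F (u i))); last first.
        by move=> i _; rewrite ltn_ord.
      have : e * (x - s) <= e * (y - s) by rewrite ler_pM2l// lerB.
      move: h4; set S := \sum_(i < n) _; lra.
  have [Ac A'c cs cs1] : [/\ ~ A c, ~ A' c, c <> s & c <> s'].
    by split=> H; apply: Nc; rewrite /N /=; tauto.
  have sc' : s < c by rewrite lt_neqAle sc andbT; apply/eqP => H; exact: cs.
  have cs'' : c < s' by rewrite lt_neqAle cs' andbT; apply/eqP.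
  have dc : is_derive (c : R^o) (1 : R^o) (F : R^o -> R^o) (w c).
    by apply: hA => //; lra.
  have wc : w c <= 0 by apply: hA' => //; rewrite sc' cs''.
  have [r r0 hr] := is_derive_expand dc e0.
  exists r => // x y sx xc cy ys' rx yr [n [u [v [h1 h2 h3 h4]]]].
  exists n, u, v; split => //.
    by move=> i iin; have [? ? ?] := h1 i iin; split => //; lra.
  have hy : F y - F c <= e * (y - c).
    have := hr (y - c); rewrite ger0_norm ?subr_ge0// => /(_ _)/wrap[]; first lra.
    rewrite (addrC c) subrK ler_norml => /andP[_].
    have : (y - c) * w c <= 0 by rewrite mulr_ge0_le0// subr_ge0.
    lra.
  have hx : F c - F x <= e * (c - x).
    have := hr (x - c); rewrite distrC ger0_norm ?subr_ge0// => /(_ _)/wrap[]; first lra.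
    rewrite (addrC c) subrK ler_norml => /andP[+ _].
    have : (c - x) * w c <= 0 by rewrite mulr_ge0_le0// subr_ge0.
    lra.
  move: h4; set S := \sum_(i < n) _; lra.
move=> [n [u [v [h1 h2 h3 h4]]]].
have tr : trivIset [set: 'I_n] (fun i => `]u i, v i[%classic).
  apply/trivIsetP => i j _ _ ij; apply/seteqP; split => // z [] /=.
  rewrite !in_itv/= => /andP[uz zv] /andP[uz' zv'].
  have : (i < j)%N \/ (j < i)%N by apply/orP; rewrite -neq_ltn.
  by case=> ltij; have := h2 _ _ ltij (ltn_ord _); lra.
have hs : \sum_(i < n) (v i - u i) <= d / 2.
  rewrite -lee_fin; apply: le_trans muGd; rewrite -sumEFin.
  rewrite (eq_bigr (fun i : 'I_n => mu `]u i, v i[%classic)); last first.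
    move=> i _; rewrite lebesgue_measure_itv/= lte_fin; case: ifPn => //.
    have [] := h1 i (ltn_ord i).
    by move=> _ + _; rewrite -leNgt => a1 a2; rewrite (le_anti (introT andP (conj a1 a2))) subrr.
  have mS : measurable (\big[setU/set0]_(k < n) `]u k, v k[%classic).
    exact: bigsetU_measurable.
  rewrite -(@measure_semi_additive_ord _ _ _ mu n (fun i : 'I_n => `]u i, v i[%classic))//.
  apply: le_measure; rewrite ?inE//.
  apply: (big_ind (fun X : set R => X `<=` G)) => //.
    by move=> X Y XG YG z [/XG|/YG].
  by move=> i _; exact: h3.
have hF : \sum_(i < n) `|F (v i) - F (u i)| < e.
  apply: (hd n (fun i => u i) (fun i => v i)) => //; last by lra.
  by move=> i; have [? ? ?] := h1 i (ltn_ord i); split; [lra|split => //; lra].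
have hF' : \sum_(i < n) (F (v i) - F (u i)) <= e.
  apply: le_trans (ltW hF); apply: ler_sum => i _; exact: ler_norm.
have : e * (s' - s + 1) = e1 by rewrite /e divfK// gt_eqF.
move: h4 hF'; set S := \sum_(i < n) _; lra.
Qed.

(** * Calculus of absolutely continuous functions and of their derivatives *)

Lemma abs_cont_lip (R : realType) (V W : normedModType R) (b c : R)
    (x : R -> V) (y : R -> W) :
  (forall s t, 0 <= s -> s <= t -> t <= b -> `|y t - y s| <= c * `|x t - x s|) ->
  abs_cont b x -> abs_cont b y.
Proof.
move=> hl acx e e0.
have c1 : 0 < `|c| + 1 by rewrite ltr_wpDl.
have [d d0 hd] := acx (e / (`|c| + 1)) (divr_gt0 e0 c1).
exists d => // n s t hst tr hs; have := hd n s t hst tr hs.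
rewrite ltr_pdivlMr// => h.
apply: le_lt_trans h; rewrite mulr_suml; apply: ler_sum => i _.
have [s0 [st tb]] := hst i.
apply: le_trans (hl _ _ s0 st tb) _; rewrite mulrC ler_wpM2l//.
by rewrite (le_trans (ler_norm _))// lerDl.
Qed.

Lemma abs_contD (R : realType) (V : normedModType R) (b : R) (x y : R -> V) :
  abs_cont b x -> abs_cont b y -> abs_cont b (fun t => x t + y t).
Proof.
move=> acx acy e e0.
have e2 : 0 < e / 2 by rewrite divr_gt0.
have [d d0 hd] := acx _ e2; have [d' d'0 hd'] := acy _ e2.
exists (Num.min d d'); first by rewrite lt_min d0.
move=> n s t hst tr; rewrite lt_min => /andP[h h'].
have := ltrD (hd n s t hst tr h) (hd' n s t hst tr h').
rewrite -splitr; apply: le_lt_trans; rewrite -big_split/=; apply: ler_sum => i _.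
by rewrite opprD addrACA ler_normD.
Qed.

Lemma aeS (R : realType) (P Q : R -> Prop) : (forall t, P t -> Q t) ->
  {ae (@lebesgue_measure R), forall t, P t} ->
  {ae (@lebesgue_measure R), forall t, Q t}.
Proof. by apply: filterS; exact: (ae_filter_ringOfSetsType mu). Qed.

Lemma aeS2 (R : realType) (P Q S : R -> Prop) : (forall t, P t -> Q t -> S t) ->
  {ae (@lebesgue_measure R), forall t, P t} ->
  {ae (@lebesgue_measure R), forall t, Q t} ->
  {ae (@lebesgue_measure R), forall t, S t}.
Proof. by apply: filterS2; exact: (ae_filter_ringOfSetsType mu). Qed.

Lemma ae_forall_fin (R : realType) (I : finType) (P : I -> R -> Prop) :
  (forall i, {ae (@lebesgue_measure R), forall t, P i t}) ->
  {ae (@lebesgue_measure R), forall t, forall i, P i t}.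
Proof. by apply: filter_forall; exact: (ae_filter_ringOfSetsType mu). Qed.

Lemma ae_neq (R : realType) (c : R) :
  {ae (@lebesgue_measure R), forall t, t <> c}.
Proof.
exists [set c]; split=> //; first exact: lebesgue_measure_set1.
by move=> t /= /contrapT.
Qed.

Lemma mx_norm_le (R : realType) (p q : nat) (A : 'M[R]_(p, q)) (c : R) :
  0 <= c -> (forall i j, `|A i j| <= c) -> `|A| <= c.
Proof.
move=> c0 h; rewrite [leLHS]/Num.norm/= mx_normrE.
by apply: bigmax_le => // ij _; exact: h.
Qed.

Lemma le_mx_norm (R : realType) (p q : nat) (A : 'M[R]_(p, q)) i j :
  `|A i j| <= `|A|.
Proof.
rewrite [leRHS]/Num.norm/= mx_normrE.
by apply: (le_trans _ (le_bigmax _ _ (i, j))).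
Qed.

Lemma mx_norm_mul_le (R : realType) (p q r : nat) (A : 'M[R]_(p, q))
  (B : 'M[R]_(q, r)) : `|A *m B| <= q%:R * `|A| * `|B|.
Proof.
apply: mx_norm_le => [|i j]; first by rewrite !mulr_ge0.
rewrite mxE (le_trans (ler_norm_sum _ _ _))//.
rewrite (@le_trans _ _ (\sum_(k < q) `|A| * `|B|))//.
  by apply: ler_sum => k _; rewrite normrM ler_pM// le_mx_norm.
by rewrite sumr_const card_ord -[leRHS]mulrA mulr_natl.
Qed.

Lemma is_derive_mxP (R : realType) (p q : nat) (x : R -> 'M[R]_(p, q)) t v :
  is_derive (t : R^o) (1 : R^o) (x : R^o -> 'M[R]_(p, q)) v <->
  forall i j, is_derive (t : R^o) (1 : R^o) ((fun t => x t i j) : R^o -> R^o) (v i j).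
Proof.
split=> [[dx vx] i j|h].
  split; first exact: (derivable_mxP (x : R^o -> _) t 1).1.
  by rewrite -vx (derive_mx dx) mxE.
have dx : derivable (x : R^o -> _) (t : R^o) 1.
  by apply/derivable_mxP => i j; case: (h i j).
split=> //; rewrite (derive_mx dx); apply/matrixP => i j; rewrite mxE.
by case: (h i j).
Qed.

Lemma abs_cont_sum (R : realType) (V : normedModType R) (b : R) n
    (x : 'I_n -> R -> V) :
  (forall i, abs_cont b (x i)) -> abs_cont b (fun t => \sum_i x i t).
Proof.
elim: n x => [|n IH] x h.
  move=> e e0; exists 1 => // k s t _ _ _.
  by rewrite big1// => i _; rewrite !big_ord0 subrr normr0.
have := abs_contD (IH (fun i => x (widen_ord (leqnSn n) i)) (fun i => h _))
  (h ord_max).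
by under [X in _ -> abs_cont _ X]eq_fun do rewrite big_ord_recr/=.
Qed.

Lemma abs_cont_mxP (R : realType) (p q : nat) (b : R) (x : R -> 'M[R]_(p, q)) :
  abs_cont b x <-> forall i j, @abs_cont R R^o b (fun t => x t i j).
Proof.
split=> [acx i j|h].
  apply: (@abs_cont_lip _ _ _ _ 1 x) => // s t _ _ _; rewrite mul1r.
  by rewrite (le_trans _ (le_mx_norm _ i j))// !mxE.
have hs : @abs_cont R R^o b (fun t => \sum_i \sum_j (x t i j : R^o)).
  by apply: abs_cont_sum => i; exact: abs_cont_sum.
have hd : abs_cont b (fun t => \sum_i \sum_j (x t i j *: delta_mx i j)).
  apply: abs_cont_sum => i; apply: abs_cont_sum => j.
  apply: (@abs_cont_lip _ _ _ _ `|delta_mx i j : 'M[R]_(p, q)|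
    ((fun t => x t i j) : R -> R^o)) => // s t _ _ _.
  by rewrite -scalerBl normrZ mulrC.
by rewrite [x](_ : _ = fun t => \sum_i \sum_j (x t i j *: delta_mx i j))//;
   apply/funext => t; exact: matrix_sum_delta.
Qed.

Lemma solves_on_mxP (R : realType) (p q : nat) (b : R) (x v : R -> 'M[R]_(p, q)) :
  solves_on b x v <->
  forall i j, @solves_on R R^o b (fun t => x t i j) (fun t => v t i j).
Proof.
split=> [[acx dx] i j|h].
  split; first exact: (abs_cont_mxP _ _).1.
  by apply: aeS dx => t dx /dx /is_derive_mxP.
split; first by apply/abs_cont_mxP => i j; case: (h i j).
have : {ae mu, forall t, forall ij : 'I_p * 'I_q, 0 < t < b ->
  is_derive (t : R^o) (1 : R^o) ((fun t => x t ij.1 ij.2) : R^o -> R^o)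
    (v t ij.1 ij.2)}.
  by apply: ae_forall_fin => -[i j]; case: (h i j).
apply: aeS => t ht tb; apply/is_derive_mxP => i j; exact: (ht (i, j)).
Qed.

Lemma abs_cont_cvg (R : realType) (V : normedModType R) (b : R) (x : R -> V) :
  abs_cont b x -> forall e, 0 < e -> exists2 d : R, 0 < d &
    forall s t, 0 <= s <= b -> 0 <= t <= b -> `|t - s| < d -> `|x t - x s| < e.
Proof.
move=> acx e e0; have [d d0 hd] := acx e e0; exists d => // s t.
wlog st : s t / s <= t.
  move=> H hs ht; have /orP[st|ts] := le_total s t; first exact: H.
  by rewrite distrC (distrC (x t)); exact: H.
move=> /andP[s0 sb] /andP[t0 tb]; rewrite ger0_norm ?subr_ge0// => std.
have := hd 1%N (fun=> s) (fun=> t); rewrite !big_ord1; apply => //.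
by apply/trivIsetP => i j _ _; rewrite !ord1 eqxx.
Qed.

Lemma abs_cont_continuous (R : realType) (V : normedModType R) (b : R) (x : R -> V) :
  abs_cont b x -> {within `[0, b], continuous x}.
Proof.
move=> acx; apply/subspace_continuousP => t /=; rewrite in_itv/= => tb.
apply/cvgrPdist_lt => e e0; have [d d0 hd] := abs_cont_cvg acx e0.
rewrite near_withinE/=; exists d => //= s /= ts; rewrite in_itv/= => sb.
by apply: hd.
Qed.

Lemma abs_cont_bounded (R : realType) (V : normedModType R) (b : R) (x : R -> V) :
  abs_cont b x -> exists2 M : R, 0 <= M & forall t, 0 <= t <= b -> `|x t| <= M.
Proof.
move=> /abs_cont_continuous cx.
have /compact_bounded[M [_ hM]] := continuous_compact cx (@segment_compact _ 0 b).
exists (`|M| + 1); first by rewrite addr_ge0.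
move=> t tb; apply: hM; first by rewrite (le_lt_trans (ler_norm _))// ltrDl.
by exists t => //=; rewrite in_itv.
Qed.

Lemma abs_cont_eq (R : realType) (V : normedModType R) (b : R) (x y : R -> V) :
  (forall t : R, 0 <= t <= b -> x t = y t) -> abs_cont b x -> abs_cont b y.
Proof.
move=> xy acx e e0; have [d d0 hd] := acx e e0; exists d => // n s t hst tr h.
apply: le_lt_trans (hd n s t hst tr h); apply: ler_sum => i _.
have [? [? ?]] := hst i; rewrite !xy//; first lra.
by apply/andP; split => //; apply: le_trans; eauto.
Qed.

Lemma solves_on_eq (R : realType) (V : normedModType R) (b : R) (x v y w : R -> V) :
  (forall t : R, 0 <= t <= b -> x t = y t) ->
  {ae (@lebesgue_measure R), forall t, 0 < t < b -> v t = w t} ->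
  solves_on b x v -> solves_on b y w.
Proof.
move=> xy vw [acx dx]; split; first exact: abs_cont_eq acx.
apply: aeS2 vw dx => t vwt dxt tb; rewrite -vwt//.
apply: near_eq_is_derive (dxt tb).
have : nbhs t `]0, b[%classic by apply: open_nbhs_nbhs; split; [exact: interval_open|rewrite /= in_itv].
apply: filterS => s /=; rewrite in_itv/= => /andP[s0 sb]; apply: xy.
by rewrite (ltW s0) (ltW sb).
Qed.

Lemma solves_on_cst (R : realType) (V : normedModType R) (b : R) (c : V) :
  solves_on b (fun=> c) (fun=> 0).
Proof.
split.
  by move=> e e0; exists 1 => // n s t _ _ _; rewrite big1// => i _; rewrite subrr normr0.
by apply: aeW => t _; exact: is_derive_cst.
Qed.

Lemma solves_onD (R : realType) (V : normedModType R) (b : R) (x v y w : R -> V) :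
  solves_on b x v -> solves_on b y w ->
  solves_on b (fun t => x t + y t) (fun t => v t + w t).
Proof.
move=> [acx dx] [acy dy]; split; first exact: abs_contD.
by apply: aeS2 dx dy => t hx hy tb; apply: is_deriveD; [exact: hx|exact: hy].
Qed.

Lemma solves_onZ (R : realType) (V : normedModType R) (b c : R) (x v : R -> V) :
  solves_on b x v -> solves_on b (fun t => c *: x t) (fun t => c *: v t).
Proof.
move=> [acx dx]; split.
  apply: (@abs_cont_lip _ _ _ _ `|c| x) => // s t _ _ _.
  by rewrite -scalerBr normrZ.
by apply: aeS dx => t hx tb; apply: is_deriveZ; exact: hx.
Qed.

Lemma solves_onN (R : realType) (V : normedModType R) (b : R) (x v : R -> V) :
  solves_on b x v -> solves_on b (fun t => - x t) (fun t => - v t).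
Proof.
move=> /(solves_onZ (-1)); apply: solves_on_eq => [t _|].
  by rewrite scaleN1r.
by apply: aeW => t _; rewrite scaleN1r.
Qed.

Lemma solves_onB (R : realType) (V : normedModType R) (b : R) (x v y w : R -> V) :
  solves_on b x v -> solves_on b y w ->
  solves_on b (fun t => x t - y t) (fun t => v t - w t).
Proof. by move=> hx /solves_onN; exact: solves_onD. Qed.

(** By polarisation it suffices to treat squares, and squaring is Lipschitz on the bounded range of
    an absolutely continuous function. *)
Lemma abs_cont_mul (R : realType) (b : R) (x y : R -> R) :
  @abs_cont R R^o b x -> @abs_cont R R^o b y ->
  @abs_cont R R^o b (fun t => x t * y t).
Proof.
have sq z : @abs_cont R R^o b z -> @abs_cont R R^o b (fun t => z t ^+ 2).
  move=> acz; have [M M0 hM] := abs_cont_bounded acz.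
  apply: (abs_cont_lip _ acz (c := M *+ 2)) => s t s0 st tb.
  rewrite subr_sqr normrM mulrC ler_wpM2r// mulr2n (le_trans (ler_normD _ _))//.
  by rewrite lerD// hM//; [rewrite (le_trans s0 st)|rewrite s0 (le_trans st)].
have opp z : @abs_cont R R^o b z -> @abs_cont R R^o b (fun t => - z t).
  move=> acz; apply: (abs_cont_lip _ acz (c := 1)) => s t _ _ _.
  by rewrite mul1r -opprD normrN.
move=> acx acy.
have := abs_contD (sq _ (abs_contD acx acy)) (abs_contD (opp _ (sq _ acx)) (opp _ (sq _ acy))).
move=> h; apply: (abs_cont_lip _ h (c := 1 / 2)) => s t _ _ _.
rewrite -[X in _ <= X * _]ger0_norm ?divr_ge0// -normrM.
by rewrite le_eqVlt; apply/orP; left; apply/eqP; congr (`| _ |); field.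
Qed.

Lemma solves_on_mul (R : realType) (b : R) (x v y w : R -> R) :
  @solves_on R R^o b x v -> @solves_on R R^o b y w ->
  @solves_on R R^o b (fun t => x t * y t) (fun t => v t * y t + x t * w t).
Proof.
move=> [acx dx] [acy dy]; split; first exact: abs_cont_mul.
apply: aeS2 dx dy => t hx hy tb.
have := @is_deriveM R R^o x y t 1 _ _ (hx tb) (hy tb).
by rewrite [v t * y t]mulrC (addrC (y t * v t)).
Qed.

Lemma solves_on_sum (R : realType) (V : normedModType R) (b : R) n
    (x v : 'I_n -> R -> V) :
  (forall i, solves_on b (x i) (v i)) ->
  solves_on b (fun t => \sum_i x i t) (fun t => \sum_i v i t).
Proof.
move=> h; split; first by apply: abs_cont_sum => i; case: (h i).
have : {ae mu, forall t, forall i : 'I_n, 0 < t < b ->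
  is_derive (t : R^o) (1 : R^o) (x i : R^o -> V) (v i t)}.
  by apply: ae_forall_fin => i; case: (h i).
apply: aeS => t ht tb.
rewrite [X in is_derive _ _ X](_ : _ = \sum_i (x i)); last first.
  by apply/funext => s; rewrite fct_sumE.
by apply: is_derive_sum => i; exact: ht.
Qed.

Lemma expR_lip (R : realType) (M x y : R) : x <= M -> y <= M ->
  `|expR x - expR y| <= expR M * `|x - y|.
Proof.
wlog xy : x y / x <= y.
  move=> H xM yM; have /orP[xy|yx] := le_total x y; first exact: H.
  by rewrite distrC (distrC x); exact: H.
move=> xM yM; rewrite !ler0_norm ?subr_le0 ?ler_expR// !opprB.
have := expR_ge1Dx (x - y); rewrite expRD expRN => h.
have ey := expR_gt0 y.
have h2 : expR y * (1 + (x - y)) <= expR x.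
  rewrite -(@ler_pM2r _ (expR y)^-1) ?invr_gt0// (mulrC (expR y)) mulfK ?gt_eqF//.
have : expR y * (y - x) <= expR M * (y - x).
  by rewrite ler_wpM2r ?subr_ge0// ler_expR.
lra.
Qed.

Lemma solves_on_expR (R : realType) (b : R) (x v : R -> R) :
  @solves_on R R^o b x v ->
  @solves_on R R^o b (fun t => expR (x t)) (fun t => expR (x t) * v t).
Proof.
move=> [acx dx]; split.
  have [M M0 hM] := abs_cont_bounded acx.
  apply: (abs_cont_lip _ acx (c := expR M)) => s t s0 st tb.
  by apply: expR_lip; rewrite (le_trans (ler_norm _))// hM//; lra.
apply: aeS dx => t hx tb.
by have := @is_derive1_comp R expR x t _ _ (is_derive_expR _) (hx tb).
Qed.

Lemma solves_on_le (R : realType) (b : R) (F v W w : R -> R) (s t : R) :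
  @solves_on R R^o b F v -> @solves_on R R^o b W w ->
  {ae (@lebesgue_measure R), forall r, 0 < r < b -> v r <= w r} ->
  0 <= s -> s <= t -> t <= b -> F t - F s <= W t - W s.
Proof.
move=> hF hW vw s0 st tb.
have := solves_on_nonincr (solves_onB hF hW) (s := s) (s' := t).
move=> /(_ _ s0 st tb) /wrap[]; last by lra.
apply: aeS vw => r h /andP[sr rt]; rewrite subr_le0; apply: h.
by rewrite (le_lt_trans s0 sr) (lt_le_trans rt).
Qed.

(** The norm being the maximum of the entries, the scalar comparison for each entry and its negative
    suffices. The absolute value on the right admits both orders of s and t, as estimates from an
    interior base time require. *)
Lemma solves_on_norm_le (R : realType) p q (b : R) (F v : R -> 'M[R]_(p, q))
    (W w : R -> R) (s t : R) :
  solves_on b F v -> @solves_on R R^o b W w ->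
  {ae (@lebesgue_measure R), forall r, 0 < r < b -> `|v r| <= w r} ->
  0 <= s <= b -> 0 <= t <= b -> `|F t - F s| <= `|W t - W s|.
Proof.
wlog st : s t / s <= t.
  move=> H hF hW h hs ht; have /orP[st|ts] := le_total s t; first exact: H.
  by rewrite distrC (distrC (W t)); exact: H.
move=> hF hW vw /andP[s0 sb] /andP[t0 tb].
have hij i j : `|F t i j - F s i j| <= W t - W s.
  have /(_ i j) hFij := (solves_on_mxP b F v).1 hF.
  rewrite ler_norml; apply/andP; split; last first.
    apply: (solves_on_le hFij hW) => //.
    apply: aeS vw => r h /h; apply: le_trans.
    exact: le_trans (ler_norm _) (le_mx_norm _ _ _).
  have := solves_on_le (solves_onN hFij) hW _ s0 st tb.
  rewrite lerNl opprB opprK (addrC _ (F s i j)); apply.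
  apply: aeS vw => r h /h; apply: le_trans.
  by rewrite (le_trans (ler_norm _))// normrN le_mx_norm.
apply: mx_norm_le => // i j; rewrite !mxE.
exact: le_trans (hij i j) (ler_norm _).
Qed.

(** * Primitives of integrable functions *)

(** Neither function is assumed measurable: the integral is a supremum over simple functions, and a
    simple function below [f], set to 0 on the exceptional null set, lies below [f']. *)
Lemma ae_le_ge0_integral d (T : measurableType d) (R : realType)
  (nu : {measure set T -> \bar R}) (f f' : T -> \bar R) :
  (forall x, 0 <= f x)%E -> (forall x, 0 <= f' x)%E ->
  {ae nu, forall x, f x <= f' x}%E ->
  (\int[nu]_x f x <= \int[nu]_x f' x)%E.
Proof.
move=> f0 f'0 [N [mN N0 hN]].
rewrite !ge0_integralTE//; apply: ge_ereal_sup => _ [h /= hf <-].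
have mCN : measurable (~` N) by exact: measurableC.
pose h' := mul_nnsfun h (indic_nnsfun R mCN).
have -> : sintegral nu h = sintegral nu h'.
  rewrite -!integralT_nnsfun; apply: ae_eq_integral => //.
  - exact/measurable_EFinP.
  - exact/measurable_EFinP.
  - exists N; split => // x /=; apply: contra_notP => Nx _.
    by rewrite /= /mindic indicE mem_set ?mulr1.
apply: ereal_sup_ubound; exists h' => //= x.
rewrite /mindic indicE; have [Nx|Nx] := pselect (N x).
  by rewrite memNset/= ?mulr0//; apply.
rewrite mem_set//= mulr1 (le_trans (hf x))//.
by apply: contrapT => fx; apply: Nx; exact: hN.
Qed.

Lemma ae_eq_Rintegral (R : realType) (D : set R) (f f' : R -> R) :
  {ae (@lebesgue_measure R), forall x, D x -> f x = f' x} ->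
  \int[mu]_(x in D) f x = \int[mu]_(x in D) f' x.
Proof.
move=> ff'; congr fine; rewrite integralE [RHS]integralE.
have H (g g' : R -> \bar R) : (forall x, 0 <= g x)%E -> (forall x, 0 <= g' x)%E ->
    {ae (@lebesgue_measure R), forall x, D x -> g x = g' x}%E ->
    (\int[mu]_(x in D) g x = \int[mu]_(x in D) g' x)%E.
  move=> g0 g'0 gg'; rewrite integral_mkcond [RHS]integral_mkcond.
  have r0 (k : R -> \bar R) x : (forall x, 0 <= k x)%E -> (0 <= (k \_ D) x)%E.
    by move=> k0; rewrite patchE; case: ifPn.
  apply/eqP; rewrite eq_le; apply/andP; split; apply: ae_le_ge0_integral => //;
    try by move=> x; exact: r0.
  - by apply: aeS gg' => x h; rewrite !patchE; case: ifPn => // /set_mem/h->.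
  - by apply: aeS gg' => x h; rewrite !patchE; case: ifPn => // /set_mem/h->.
by congr (_ - _)%E; apply: H => // ; apply: aeS ff' => x h /h;
  rewrite ?funeposE ?funenegE => ->.
Qed.

Definition ae_integrable (R : realType) (b : R) (q : R -> R) : Prop :=
  exists2 q' : R -> R, (@lebesgue_measure R).-integrable `[0, b] (EFin \o q')
    & {ae (@lebesgue_measure R), forall t, 0 <= t <= b -> q t = q' t}.

Definition ae_measurable (R : realType) (b : R) (q : R -> R) : Prop :=
  exists2 q' : R -> R, measurable_fun `[0, b] q'
    & {ae (@lebesgue_measure R), forall t, 0 <= t <= b -> q t = q' t}.

(** The integral of |h| is an absolutely continuous set function; it is evaluated at the union of
    the given disjoint intervals. *)
Lemma integrable_primitive_AC (R : realType) (b : R) (h : R -> R) :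
  (@lebesgue_measure R).-integrable `[0, b] (EFin \o h) ->
  @abs_cont R R^o b (fun T => \int[mu]_(t in `[0, T]) h t).
Proof.
move=> ih e e0.
have iT : mu.-integrable setT (EFin \o h \_ `[0, b]).
  by rewrite -restrict_EFin; apply/integrable_restrict => //=; rewrite setTI.
have [d [d0 hd]] := integral_normr_continuous iT e0.
exists d => // n s t hst tr hs.
have itvE i : mu `]s i, t i[%classic = (t i - s i)%:E.
  rewrite lebesgue_measure_itv/= lte_fin; case: ifPn => //.
  have [_ [+ _]] := hst i.
  by rewrite -leNgt => a1 a2; rewrite (le_anti (introT andP (conj a1 a2))) subrr.
pose A := \big[setU/set0]_(i < n) `]s i, t i[%classic.
have mA : measurable A by exact: bigsetU_measurable.
have muA : (mu A < d%:E)%E.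
  rewrite (@measure_semi_additive_ord _ _ _ mu n (fun i : 'I_n => `]s i, t i[%classic))//.
  by rewrite (eq_bigr (fun i => (t i - s i)%:E)) ?sumEFin ?lte_fin// => i _; exact: itvE.
apply: le_lt_trans (hd A mA muA).
have sub i : `]s i, t i[ `<=` `[0, b].
  have [? [? ?]] := hst i.
  by move=> x /=; rewrite !in_itv/= => /andP[? ?]; apply/andP; split; lra.
have iA : mu.-integrable A (EFin \o (fun x => `|(h \_ `[0, b]) x|)).
  by have := integrable_abse iT; apply: integrableS.
rewrite -lee_fin /Rintegral fineK; last exact: integrable_fin_num.
rewrite -sumEFin.
rewrite (@ge0_integral_bigsetU _ _ _ mu 'I_n (fun i : 'I_n => `]s i, t i[%classic)
   (fun x => `|(h \_ `[0, b]) x|%:E) (index_enum _))//; last first.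
- by apply/measurable_EFinP; case/integrableP : iA => /measurable_EFinP.
- by apply: sub_trivIset tr.
- exact: index_enum_uniq.
apply: lee_sum => i _.
have [s0 [st tb]] := hst i.
have it : mu.-integrable `[0, t i] (EFin \o h).
  apply: integrableS ih => //.
  by move=> x /=; rewrite !in_itv/= => /andP[-> /=]; move/le_trans; apply.
have := @Rintegral_itvB R h (BLeft 0) (BRight (t i)) (s i) it.
rewrite !bnd_simp => /(_ s0 st) ->.
have ist : mu.-integrable `]s i, t i] (EFin \o h).
  apply: integrableS it => //.
  by move=> x /=; rewrite !in_itv/= => /andP[? ->]; rewrite andbT; lra.
apply: (@le_trans _ _ (\int[mu]_(x in `]s i, t i]) `|h x|)%:E).
  by rewrite lee_fin le_normr_Rintegral.
have ist' : mu.-integrable `]s i, t i] (EFin \o (fun x => `|h x|)).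
  by have := integrable_abse ist.
rewrite -Rintegral_itv_bndo_bndc; last first.
  apply: integrableS ist' => //.
  by move=> x /=; rewrite !in_itv/= => /andP[-> /ltW ->].
rewrite /Rintegral fineK; last first.
  apply: integrable_fin_num => //; apply: integrableS ist' => //.
  by move=> x /=; rewrite !in_itv/= => /andP[-> /ltW ->].
rewrite le_eqVlt; apply/orP; left; apply/eqP; apply: eq_integral => x /set_mem /sub xb.
by rewrite patchE mem_set.
Qed.

Lemma solves_on_primitive (R : realType) (b : R) (q : R -> R) : 0 <= b ->
  ae_integrable b q ->
  @solves_on R R^o b (fun T => \int[mu]_(t in `[0, T]) q t) q.
Proof.
move=> b0 [h ih qh].
apply: (@solves_on_eq _ _ _ (fun T => \int[mu]_(t in `[0, T]) h t : R^o) h).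
- move=> t /andP[t0 tb]; apply: ae_eq_Rintegral.
  apply: aeS qh => x + /=; rewrite in_itv/= => hx /andP[x0 xt]; rewrite hx//.
  by rewrite x0 (le_trans xt).
- by apply: aeS qh => x hx /andP[x0 xb]; rewrite hx// !ltW.
split; first exact: integrable_primitive_AC.
(* Extension by 0 gives an integrand on the whole line, to which the differentiation theorem
   applies; inside ]0, b[ its primitive is the original one. *)
have iT : mu.-integrable setT (EFin \o h \_ `[0, b]).
  by rewrite -restrict_EFin; apply/integrable_restrict => //=; rewrite setTI.
have li : locally_integrable [set: R] (h \_ `[0, b]) by exact: integrable_locally.
have iy y : mu.-integrable `[0, y] (EFin \o h \_ `[0, b]) by exact: integrableS iT.
have := FTC1 (a := BLeft 0) iy li.
apply: aeS => x /= hx /andP[x0 xb].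
have [|dF vF] := hx _; first by rewrite lte_fin.
have dx : is_derive (x : R^o) (1 : R^o)
    ((fun y => \int[mu]_(t in `[0, y]) (h \_ `[0, b]) t) : R^o -> R^o) (h x).
  split => //; rewrite -derive1E vF patchE mem_set//=.
  by rewrite in_itv/= !ltW.
apply: near_eq_is_derive dx.
have : nbhs x `]0, b[%classic.
  by apply: open_nbhs_nbhs; split; [exact: interval_open|rewrite /= in_itv/= x0].
apply: filterS => y /=; rewrite in_itv/= => /andP[y0 yb].
apply: eq_Rintegral => z /set_mem /=; rewrite in_itv/= => /andP[z0 zy].
by rewrite patchE mem_set//= in_itv/= z0 (le_trans zy)// ltW.
Qed.

Lemma ae_integrable_measurable (R : realType) (b : R) (q : R -> R) :
  ae_integrable b q -> ae_measurable b q.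
Proof. by move=> [h /integrableP[/measurable_EFinP mh _] qh]; exists h. Qed.

Lemma ae_measurableD (R : realType) (b : R) (q r : R -> R) :
  ae_measurable b q -> ae_measurable b r -> ae_measurable b (fun t => q t + r t).
Proof.
move=> [q' mq hq] [r' mr hr]; exists (fun t => q' t + r' t).
  exact: measurable_funD.
by apply: aeS2 hq hr => t hq hr tb; rewrite hq// hr.
Qed.

Lemma ae_measurableM (R : realType) (b : R) (q r : R -> R) :
  ae_measurable b q -> ae_measurable b r -> ae_measurable b (fun t => q t * r t).
Proof.
move=> [q' mq hq] [r' mr hr]; exists (fun t => q' t * r' t).
  exact: measurable_funM.
by apply: aeS2 hq hr => t hq hr tb; rewrite hq// hr.
Qed.

Lemma ae_measurable_eq (R : realType) (b : R) (q r : R -> R) :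
  {ae (@lebesgue_measure R), forall t, 0 <= t <= b -> q t = r t} ->
  ae_measurable b q -> ae_measurable b r.
Proof.
move=> qr [q' mq hq]; exists q' => //.
by apply: aeS2 qr hq => t h1 h2 tb; rewrite -h1// h2.
Qed.

Lemma measurable_ae (R : realType) (b : R) (q : R -> R) :
  measurable_fun `[0, b] q -> ae_measurable b q.
Proof. by exists q => //; apply: aeW. Qed.

Lemma ae_measurable_sum (R : realType) (b : R) n (q : 'I_n -> R -> R) :
  (forall i, ae_measurable b (q i)) -> ae_measurable b (fun t => \sum_i q i t).
Proof.
elim: n q => [|n IH] q h.
  apply: (@ae_measurable_eq _ _ (fun=> 0)); first by apply: aeW => t _; rewrite big_ord0.
  exact: measurable_ae.
apply: (@ae_measurable_eq _ _ (fun t => \sum_(i < n) q (widen_ord (leqnSn n) i) t + q ord_max t)).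
  by apply: aeW => t _; rewrite big_ord_recr.
by apply: ae_measurableD => //; exact: IH.
Qed.

Lemma ae_integrable_le (R : realType) (b : R) (q l : R -> R) :
  ae_measurable b q -> ae_integrable b l ->
  {ae (@lebesgue_measure R), forall t, 0 <= t <= b -> `|q t| <= l t} ->
  ae_integrable b q.
Proof.
move=> [q' mq hq] [l' il hl] ql.
have /ae_negl[N [mN N0 hN]] :
  {ae (@lebesgue_measure R), forall t, 0 <= t <= b -> q t = q' t /\ `|q' t| <= `|l' t|}.
  apply: (aeS2 _ hq (aeS2 (fun t => @conj _ _) hl ql)) => t h1 [h2 h3] tb.
  by rewrite -h1// -h2//; split => //; rewrite (le_trans (h3 tb))// ler_norm.
exists (q' \_ (~` N)).
  apply: (@le_integrable _ _ _ mu _ _ _ (EFin \o l')) => //.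
  - apply/measurable_EFinP; apply/measurable_restrict => //; first exact: measurableC.
    by apply: measurable_funS mq => // x [].
  - move=> t /=; rewrite in_itv/= => tb; rewrite lee_fin patchE; case: ifPn => [/set_mem Nt|_].
      by have [] := hN t Nt tb.
    by rewrite normr0.
exists N; split => // t /=; apply: contra_notP => Nt tb.
by rewrite patchE mem_set//; have [] := hN t Nt tb.
Qed.

Lemma ae_integrable_eq (R : realType) (b : R) (q r : R -> R) :
  {ae (@lebesgue_measure R), forall t, 0 <= t <= b -> q t = r t} ->
  ae_integrable b q -> ae_integrable b r.
Proof.
move=> qr [q' mq hq]; exists q' => //.
by apply: aeS2 qr hq => t h1 h2 tb; rewrite -h1// h2.
Qed.

Lemma ae_integrableD (R : realType) (b : R) (q r : R -> R) :
  ae_integrable b q -> ae_integrable b r -> ae_integrable b (fun t => q t + r t).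
Proof.
move=> [q' mq hq] [r' mr hr]; exists (fun t => q' t + r' t).
  by rewrite (_ : _ \o _ = (EFin \o q') \+ (EFin \o r'))%E//; exact: integrableD.
by apply: aeS2 hq hr => t hq hr tb; rewrite hq// hr.
Qed.

Lemma ae_integrableZ (R : realType) (b c : R) (q : R -> R) :
  ae_integrable b q -> ae_integrable b (fun t => c * q t).
Proof.
move=> [q' mq hq]; exists (fun t => c * q' t).
  rewrite (_ : _ \o _ = (fun t => c%:E * (EFin \o q') t))%E//; exact: integrableZl.
by apply: aeS hq => t hq tb; rewrite hq.
Qed.

Lemma ae_integrable_cst (R : realType) (b c : R) : ae_integrable b (fun=> c).
Proof.
exists (fun=> c); last by apply: aeW.
apply: measurable_bounded_integrable => //.
  by rewrite /= lebesgue_measure_itv/=; case: ifP => _; rewrite ltry.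
by exists `|c|; split; [exact: num_real|move=> y cy t _ /=; exact: ltW].
Qed.

Lemma loc_integrable_ae (R : realType) (b : R) (q : R -> R) :
  loc_integrable q -> ae_integrable b q.
Proof. by move=> [q' iq hq]; exists q' => //; apply: aeS hq => t h /andP[/h]. Qed.

Lemma Rintegral_itv0 (R : realType) (q : R -> R) : \int[mu]_(t in `[0, 0]) q t = 0.
Proof. by rewrite set_itv1 Rintegral_set1. Qed.

Lemma primitive_le (R : realType) (b : R) (q : R -> R) (s t : R) :
  ae_integrable b q ->
  {ae (@lebesgue_measure R), forall r, 0 <= r <= b -> 0 <= q r} ->
  0 <= s -> s <= t -> t <= b ->
  \int[mu]_(r in `[0, s]) q r <= \int[mu]_(r in `[0, t]) q r.
Proof.
move=> iq q0 s0 st tb.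
have := solves_on_le (solves_on_cst b (0 : R^o))
  (solves_on_primitive (le_trans s0 (le_trans st tb)) iq) _ s0 st tb.
rewrite subrr subr_ge0; apply.
by apply: aeS q0 => r h /andP[r0 rb]; apply: h; rewrite !ltW.
Qed.

Lemma primitive_ge0 (R : realType) (b : R) (q : R -> R) (t : R) :
  ae_integrable b q ->
  {ae (@lebesgue_measure R), forall r, 0 <= r <= b -> 0 <= q r} ->
  0 <= t <= b -> 0 <= \int[mu]_(r in `[0, t]) q r.
Proof.
move=> iq q0 /andP[t0 tb].
by have := primitive_le iq q0 (lexx 0) t0 tb; rewrite Rintegral_itv0.
Qed.

Lemma primitive_dist (R : realType) (b : R) (q : R -> R) (s t : R) :
  ae_integrable b q ->
  {ae (@lebesgue_measure R), forall r, 0 <= r <= b -> 0 <= q r} ->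
  0 <= s <= b -> 0 <= t <= b ->
  `|\int[mu]_(r in `[0, t]) q r - \int[mu]_(r in `[0, s]) q r|
  <= \int[mu]_(r in `[0, b]) q r.
Proof.
move=> iq q0 hs ht.
have := primitive_ge0 iq q0 hs; have := primitive_ge0 iq q0 ht.
move: hs ht => /andP[s0 sb] /andP[t0 tb].
have := primitive_le iq q0 t0 tb (lexx _); have := primitive_le iq q0 s0 sb (lexx _).
by move=> *; rewrite ler_norml; apply/andP; split; lra.
Qed.

(** * Gronwall's inequality and Picard's theorem *)

(** This is 2 cosh(2r). A single exponential would work as a weight only forward in time; the even
    weight serves on both sides of a base time. *)
Definition symexp (R : realType) (r : R) : R := expR (2 * r) + expR (- (2 * r)).

Lemma symexp_ge2 (R : realType) (r : R) : 2 <= symexp r.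
Proof.
have := expR_ge1Dx (2 * r); have := expR_ge1Dx (- (2 * r)).
rewrite /symexp; lra.
Qed.

Lemma symexp_le (R : realType) (r M : R) : `|r| <= M -> symexp r <= 2 * expR (2 * M).
Proof.
rewrite ler_norml => /andP[h1 h2].
have : expR (2 * r) <= expR (2 * M) by rewrite ler_expR; lra.
have : expR (- (2 * r)) <= expR (2 * M) by rewrite ler_expR; lra.
rewrite /symexp; lra.
Qed.

(* sinh' = cosh makes the weight [symexp (Lam t - Lam t0)] reproduce itself,
   with a factor 1/2, under integration from [t0] in both time directions. *)
Lemma solves_on_symexp (R : realType) (b t0 : R) (l : R -> R) :
  0 <= b -> ae_integrable b l ->
  let r (t : R) := \int[mu]_(s in `[0, t]) l s - \int[mu]_(s in `[0, t0]) l s in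
  @solves_on R R^o b
    (fun t => (expR (2 * r t) - expR (- (2 * r t))) / 2)
    (fun t => l t * symexp (r t)).
Proof.
move=> b0 il r.
have hr : @solves_on R R^o b (fun t => 2 * r t) (fun t => 2 * l t).
  apply: (@solves_on_eq _ _ _ _ _ _ _ _ _ (solves_onZ 2
    (solves_onB (solves_on_primitive b0 il)
      (solves_on_cst b (\int[mu]_(s in `[0, t0]) l s : R^o))))) => //.
  by apply: aeW => t _; rewrite subr0.
have := solves_onZ (2^-1) (solves_onB (solves_on_expR hr) (solves_on_expR (solves_onN hr))).
apply: solves_on_eq => [t _|]; first by rewrite /= [LHS]mulrC.
apply: aeW => t _; rewrite /symexp.
rewrite -[_ *: _]/(2^-1 * (expR (2 * r t) * (2 * l t) - expR (- (2 * r t)) * - (2 * l t))).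
by field.
Qed.

Lemma sinh_le_symexp (R : realType) (r : R) :
  `|(expR (2 * r) - expR (- (2 * r))) / 2| <= symexp r / 2.
Proof.
have := expR_gt0 (2 * r); have := expR_gt0 (- (2 * r)).
by rewrite /symexp => *; rewrite ler_norml; apply/andP; split; lra.
Qed.

(** Let N be the supremum of |y| divided by the weight [symexp], and c = |y(t0)| plus the integral
    of h. Integration from t0 gives |y| <= c + N symexp / 2; dividing by the weight, which is at
    least 2, yields N <= c/2 + N/2, hence N <= c. The constant in the conclusion bounds the
    weight. *)
Lemma gronwall (R : realType) p q (b t0 : R) (y v : R -> 'M[R]_(p, q))
    (l h : R -> R) :
  solves_on b y v -> ae_integrable b l -> ae_integrable b h ->
  {ae (@lebesgue_measure R), forall t, 0 <= t <= b ->
     [/\ 0 <= l t, 0 <= h t & `|v t| <= l t * `|y t| + h t]} ->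
  0 <= t0 <= b ->
  forall t, 0 <= t <= b ->
  `|y t| <= 2 * expR (2 * \int[mu]_(s in `[0, b]) l s)
            * (`|y t0| + \int[mu]_(s in `[0, b]) h s).
Proof.
move=> hy il ih hv t0b.
have b0 : 0 <= b by case/andP: t0b; exact: le_trans.
have l0 : {ae (@lebesgue_measure R), forall t, 0 <= t <= b -> 0 <= l t}.
  by apply: aeS hv => t ht /ht[].
have h0 : {ae (@lebesgue_measure R), forall t, 0 <= t <= b -> 0 <= h t}.
  by apply: aeS hv => t ht /ht[].
pose r (t : R) := \int[mu]_(s in `[0, t]) l s - \int[mu]_(s in `[0, t0]) l s.
pose H := \int[mu]_(s in `[0, b]) h s.
have H0 : 0 <= H by apply: (primitive_ge0 ih h0); rewrite b0 lexx.
have [M M0 hM] := abs_cont_bounded hy.1.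
pose S := [set x | exists2 t : R, 0 <= t <= b & x = `|y t| / symexp (r t)].
have sp t : 0 < symexp (r t) by rewrite (lt_le_trans _ (symexp_ge2 _)).
have supS : has_sup S.
  split; first by exists (`|y t0| / symexp (r t0)); exists t0.
  exists M => _ [t tb ->]; rewrite ler_pdivrMr//.
  rewrite (le_trans (hM t tb))// ler_peMr// (le_trans _ (symexp_ge2 _))//; lra.
pose N := sup S.
have yN t : 0 <= t <= b -> `|y t| <= N * symexp (r t).
  move=> tb; rewrite -ler_pdivrMr//; apply: ub_le_sup; first by case: supS.
  by exists t.
have N0 : 0 <= N.
  have := yN t0 t0b; rewrite -ler_pdivrMr//; apply: le_trans.
  by rewrite divr_ge0// ltW.
have hW := solves_onD (solves_onZ N (solves_on_symexp t0 b0 il)) (solves_on_primitive b0 ih).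
have key t : 0 <= t <= b -> `|y t| <= `|y t0| + H + N * symexp (r t) / 2.
  move=> tb; have := solves_on_norm_le hy hW _ t0b tb => /(_ _)/wrap[].
    apply: aeS hv => s hs /andP[s0 sb].
    have sb' : 0 <= s <= b by rewrite !ltW.
    have [ls hs0 vs] := hs sb'; apply: le_trans vs _; rewrite lerD2r.
    rewrite -[_ *: _]/(N * (l s * symexp (r s))).
    by rewrite mulrCA ler_wpM2l// yN.
  rewrite -/(r t) -/(r t0) => hd.
  have -> : y t = y t0 + (y t - y t0) by rewrite addrC subrK.
  rewrite (le_trans (ler_normD _ _))// -addrA lerD2l (le_trans hd)//.
  rewrite /r subrr mulr0 oppr0 subrr mul0r scaler0 add0r -/(r t) -addrA.
  rewrite addrC (le_trans (ler_normD _ _))// lerD//.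
    exact: primitive_dist.
  rewrite normrZ ger0_norm// -mulrA ler_wpM2l//; exact: sinh_le_symexp.
have NH : N <= `|y t0| + H.
  have : N <= (`|y t0| + H) / 2 + N / 2.
    apply: ge_sup; first by case: supS.
    move=> _ [t tb ->]; rewrite ler_pdivrMr// (le_trans (key t tb))//.
    rewrite mulrDl mulrAC (mulrAC N) lerD2r.
    have yH : 0 <= (`|y t0| + H) / 2 by rewrite divr_ge0// addr_ge0.
    have := ler_wpM2l yH (symexp_ge2 (r t)); lra.
  lra.
move=> t tb; rewrite (le_trans (yN t tb))// mulrC ler_pM//; first exact: ltW.
apply: symexp_le; exact: primitive_dist.
Qed.

(** The intervals of radius k n = 2K/2^n around u n are nested, because k n - k (n+1) = K/2^n. The
    supremum of their left ends belongs to all of them. *)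
Lemma geometric_limit (R : realType) (u : nat -> R) (K : R) : 0 <= K ->
  (forall n, `|u n.+1 - u n| <= K / 2 ^+ n) ->
  exists l, forall n, `|l - u n| <= 2 * K / 2 ^+ n.
Proof.
move=> K0 hu.
pose k n := 2 * K / 2 ^+ n.
have kS n : k n.+1 = K / 2 ^+ n.
  by rewrite /k exprS; field; rewrite expf_neq0.
have k2 n : k n = 2 * k n.+1 by rewrite kS /k mulrA.
have k0 n : 0 <= k n by rewrite /k divr_ge0// ?mulr_ge0// exprn_ge0.
have hS n : u n - k n <= u n.+1 - k n.+1 /\ u n.+1 + k n.+1 <= u n + k n.
  by have := hu n; rewrite -kS (k2 n) ler_norml => /andP[? ?]; split; lra.
have ha m n : (m <= n)%N -> u m - k m <= u n - k n.
  move=> /subnK <-; elim: (n - m)%N => [|d IH]; first by rewrite add0n.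
  by rewrite addSn; apply: le_trans IH _; have [] := hS (d + m)%N.
have hb m n : (m <= n)%N -> u n + k n <= u m + k m.
  move=> /subnK <-; elim: (n - m)%N => [|d IH]; first by rewrite add0n.
  by rewrite addSn; apply: le_trans IH; have [] := hS (d + m)%N.
have hab m n : u m - k m <= u n + k n.
  have h1 := ha m _ (leq_maxl m n); have h2 := hb n _ (leq_maxr m n).
  have := k0 (maxn m n); lra.
pose S := [set u n - k n | n in setT].
have hS' : has_sup S.
  split; first by exists (u 0%N - k 0%N); exists 0%N.
  by exists (u 0%N + k 0%N) => _ [n _ <-].
exists (sup S) => n; rewrite -/(k n) ler_norml; apply/andP; split.
  have : u n - k n <= sup S by apply: ub_le_sup; [case: hS' | exists n].
  lra.
have : sup S <= u n + k n by apply: ge_sup; [case: hS' | move=> _ [m _ <-]].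
lra.
Qed.

Definition mx_primitive (R : realType) p q (w : R -> 'M[R]_(p, q)) (T : R) : 'M[R]_(p, q) :=
  \matrix_(i, j) \int[mu]_(t in `[0, T]) w t i j.

Lemma solves_on_mx_primitive (R : realType) p q (b : R) (w : R -> 'M[R]_(p, q)) :
  0 <= b -> (forall i j, ae_integrable b (fun t => w t i j)) ->
  solves_on b (mx_primitive w) w.
Proof.
move=> b0 h; apply/solves_on_mxP => i j.
apply: solves_on_eq (solves_on_primitive b0 (h i j)) => [t _|]; first by rewrite mxE.
exact: aeW.
Qed.

Lemma abs_cont_measurable (R : realType) (b : R) (x : R -> R) :
  @abs_cont R R^o b x -> measurable_fun `[0, b] x.
Proof.
move=> /abs_cont_continuous cx.
exact: subspace_continuous_measurable_fun.
Qed.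

(** Measured with the weight [symexp], each iteration halves the distance of successive iterates, so
    the iterates converge on all of [0, b] at once, without subdivision and for any base time t0. *)
Lemma picard (R : realType) p q (b t0 : R) (x1 : 'M[R]_(p, q))
    (v : R -> 'M[R]_(p, q) -> 'M[R]_(p, q)) (L M : R -> R) :
  0 <= t0 <= b -> ae_integrable b L -> ae_integrable b M ->
  {ae (@lebesgue_measure R), forall t, 0 <= t <= b ->
     [/\ 0 <= L t, `|v t x1| <= M t
       & forall x y, `|v t x - v t y| <= L t * `|x - y|]} ->
  (forall x : R -> 'M[R]_(p, q), (forall i j, measurable_fun `[0, b] (fun t => x t i j)) ->
     forall i j, ae_measurable b (fun t => v t (x t) i j)) ->
  exists2 x, solves_on b x (fun t => v t (x t)) & x t0 = x1.
Proof.
move=> t0b iL iM hv mv.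
have b0 : 0 <= b by case/andP: t0b; exact: le_trans.
have L0 : {ae (@lebesgue_measure R), forall t, 0 <= t <= b -> 0 <= L t}.
  by apply: aeS hv => t ht /ht[].
have M0 : {ae (@lebesgue_measure R), forall t, 0 <= t <= b -> 0 <= M t}.
  by apply: aeS hv => t ht /ht[_ + _]; exact: le_trans.
have int_v (x : R -> 'M[R]_(p, q)) :
    (forall i j, measurable_fun `[0, b] (fun t => x t i j)) ->
    (exists B, forall t, 0 <= t <= b -> `|x t| <= B) ->
    forall i j, ae_integrable b (fun t => v t (x t) i j).
  move=> mx [B hB] i j.
  apply: (@ae_integrable_le _ _ _ (fun t => M t + (B + `|x1|) * L t)).
  - exact: mv.
  - by apply: ae_integrableD => //; exact: ae_integrableZ.
  apply: aeS hv => t ht tb; have [Lt vt lip] := ht tb.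
  rewrite (le_trans (le_mx_norm _ _ _))//.
  rewrite -[X in `|X|](subrK (v t x1)) (le_trans (ler_normD _ _))// addrC lerD//.
  rewrite (le_trans (lip _ _))// mulrC ler_wpM2r//.
  by rewrite (le_trans (ler_normB _ _))// lerD2r hB.
pose Phi x t := x1 + (mx_primitive (fun s => v s (x s)) t - mx_primitive (fun s => v s (x s)) t0).
have PhiP (x : R -> 'M[R]_(p, q)) :
    (forall i j, measurable_fun `[0, b] (fun t => x t i j)) ->
    (exists B, forall t, 0 <= t <= b -> `|x t| <= B) ->
    solves_on b (Phi x) (fun t => v t (x t)).
  move=> mx Bx.
  have := solves_onD (solves_on_cst b x1)
    (solves_onB (solves_on_mx_primitive b0 (int_v x mx Bx))
      (solves_on_cst b (mx_primitive (fun s => v s (x s)) t0))).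
  by apply: solves_on_eq => //; apply: aeW => t _; rewrite subr0 add0r.
have Phi0 x : Phi x t0 = x1 by rewrite /Phi subrr addr0.
have good (x w : R -> 'M[R]_(p, q)) : solves_on b x w ->
    (forall i j, measurable_fun `[0, b] (fun t => x t i j)) /\
    (exists B, forall t, 0 <= t <= b -> `|x t| <= B).
  move=> [acx _]; split.
    by move=> i j; apply: abs_cont_measurable; exact: (abs_cont_mxP _ _).1.
  by have [B _ hB] := abs_cont_bounded acx; exists B.
pose X n := iter n Phi (fun=> x1).
have XS n : solves_on b (X n.+1) (fun t => v t (X n t)).
  elim: n => [|n IH].
    by have [m1 B1] := good _ _ (solves_on_cst b x1); exact: PhiP.
  by have [m1 B1] := good _ _ IH; exact: PhiP.
pose r (t : R) := \int[mu]_(s in `[0, t]) L s - \int[mu]_(s in `[0, t0]) L s.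
pose c := \int[mu]_(s in `[0, b]) M s.
have c0 : 0 <= c by apply: (primitive_ge0 iM M0); rewrite b0 lexx.
have step n t : 0 <= t <= b -> `|X n.+1 t - X n t| <= c / 2 ^+ n * symexp (r t).
  elim: n t => [|n IH] t tb.
    rewrite expr0 divr1.
    have hM := solves_on_primitive b0 iM.
    have := solves_on_norm_le (XS 0%N) hM _ t0b tb => /(_ _)/wrap[].
      by apply: aeS hv => s hs /andP[s0 sb]; have [] := hs _; first by rewrite !ltW.
    rewrite [X in `|_ - X|]Phi0 => h; rewrite (le_trans h)//.
    rewrite (le_trans (primitive_dist iM M0 t0b tb))// ler_peMr//.
    by rewrite (le_trans _ (symexp_ge2 _))//; lra.
  have hX := solves_onB (XS n.+1) (XS n).
  have hW := solves_onZ (c / 2 ^+ n) (solves_on_symexp t0 b0 iL).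
  have := solves_on_norm_le hX hW _ t0b tb => /(_ _)/wrap[].
    apply: aeS hv => s hs /andP[s0 sb].
    have sb' : 0 <= s <= b by rewrite !ltW.
    have [Ls _ lip] := hs sb'; rewrite (le_trans (lip _ _))//.
    rewrite -[_ *: _]/(c / 2 ^+ n * (L s * symexp (r s))).
    by rewrite mulrCA ler_wpM2l// IH.
  rewrite -/(r t) -/(r t0) /= !Phi0 subrr subr0.
  have -> : r t0 = 0 by rewrite /r subrr.
  rewrite mulr0 oppr0 subrr mul0r scaler0 subr0 => h.
  rewrite (le_trans h)// normrZ ger0_norm; last by rewrite divr_ge0// exprn_ge0.
  have -> : c / 2 ^+ n.+1 * symexp (r t) = c / 2 ^+ n * (symexp (r t) / 2).
    by rewrite exprS; field; rewrite expf_neq0.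
  by rewrite ler_wpM2l ?sinh_le_symexp// divr_ge0// exprn_ge0.
pose K := c * (2 * expR (2 * \int[mu]_(s in `[0, b]) L s)).
have K0 : 0 <= K by rewrite !mulr_ge0// expR_ge0.
have stepK n t : 0 <= t <= b -> `|X n.+1 t - X n t| <= K / 2 ^+ n.
  move=> tb; rewrite (le_trans (step n t tb))// /K mulrAC ler_wpM2r ?invr_ge0 ?exprn_ge0//.
  by rewrite ler_wpM2l// symexp_le// primitive_dist.
have lim_ex (a : R * 'I_p * 'I_q) : exists l : R, 0 <= a.1.1 <= b ->
    forall n, `|l - X n a.1.1 a.1.2 a.2| <= 2 * K / 2 ^+ n.
  have [tb|ntb] := boolP (0 <= a.1.1 <= b); last by exists 0.
  have [|l hl] := @geometric_limit R (fun n => X n a.1.1 a.1.2 a.2) K K0.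
    move=> n; apply: le_trans (stepK n _ tb).
    by have := le_mx_norm (X n.+1 a.1.1 - X n a.1.1) a.1.2 a.2; rewrite !mxE.
  by exists l.
have [lim hlim] := choice lim_ex.
pose x t : 'M[R]_(p, q) := \matrix_(i, j) lim (t, i, j).
have k0 n : 0 <= 2 * K / 2 ^+ n by rewrite divr_ge0// ?mulr_ge0// exprn_ge0.
have xX n t : 0 <= t <= b -> `|x t - X n t| <= 2 * K / 2 ^+ n.
  by move=> tb; apply: mx_norm_le => // i j; rewrite !mxE; exact: (hlim (t, i, j)).
have k_cvg (C e : R) : 0 < e -> exists n : nat, C / 2 ^+ n < e.
  move=> e0; have [n hn] : exists n : nat, `|C| / e < n%:R.
    exists (Num.trunc (`|C| / e)).+1; exact: truncnS_gt.
  exists n; rewrite ltr_pdivrMr ?exprn_gt0// (le_lt_trans (ler_norm _))//.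
  rewrite -ltr_pdivrMl// mulrC (lt_le_trans hn)// -natrX ler_nat.
  exact/ltnW/ltn_expl.
have mx i j : measurable_fun `[0, b] (fun t => x t i j).
  apply: (measurable_fun_cvg (h := fun n t => X n t i j)).
  - move=> [|n]; first exact: measurable_cst.
    by have [] := good _ _ (XS n).
  - move=> t /=; rewrite in_itv/= => tb; apply/cvgrPdist_lt => e e0.
    have [n hn] := k_cvg (2 * K) e e0; exists n => // m /= nm.
    have := le_mx_norm (x t - X m t) i j; rewrite !mxE => h.
    rewrite (le_lt_trans h)// (le_lt_trans (xX m t tb))// (le_lt_trans _ hn)//.
    rewrite ler_wpM2l ?mulr_ge0// lef_pV2 ?posrE ?exprn_gt0//.
    by rewrite ler_eXn2l// ltr1n.
have Bx : exists B, forall t, 0 <= t <= b -> `|x t| <= B.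
  exists (2 * K + `|x1|) => t tb.
  rewrite -[x t](subrK (X 0%N t)) (le_trans (ler_normD _ _))// lerD//.
  by have := xX 0%N t tb; rewrite expr0 divr1.
have xE t : 0 <= t <= b -> Phi x t = x t.
  move=> tb; apply/eqP; rewrite -subr_eq0 -normr_le0.
  apply/ler_addgt0Pr => e e0; rewrite add0r.
  (* The first term bounds the distance from [Phi x] to the iterate n+1, the second that from this
     iterate to x, both in units of 1/2^n. *)
  pose C := 2 * K * \int[mu]_(s in `[0, b]) L s + 2 * K.
  have [n hn] := k_cvg C e e0; rewrite (le_trans _ (ltW hn))//.
  have hd := solves_onB (PhiP x mx Bx) (XS n).
  have hW := solves_onZ (2 * K / 2 ^+ n) (solves_on_primitive b0 iL).
  have := solves_on_norm_le hd hW _ t0b tb => /(_ _)/wrap[].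
    apply: aeS hv => s hs /andP[s0 sb].
    have sb' : 0 <= s <= b by rewrite !ltW.
    have [Ls _ lip] := hs sb'; rewrite (le_trans (lip _ _))//.
    by rewrite mulrC ler_wpM2r// xX.
  rewrite /= !Phi0 subrr subr0 => h.
  have -> : Phi x t - x t = (Phi x t - X n.+1 t) - (x t - X n.+1 t) by rewrite opprB addrA subrK.
  rewrite (le_trans (ler_normB _ _))// /C mulrDl lerD//.
    rewrite (le_trans h)// -scalerBr normrZ ger0_norm// [leRHS]mulrAC.
    apply: ler_wpM2l => //; exact: primitive_dist.
  rewrite (le_trans (xX n.+1 t tb))// ler_wpM2l ?mulr_ge0//.
  by rewrite lef_pV2 ?posrE ?exprn_gt0// ler_eXn2l// ltr1n.
exists x; last by rewrite -xE.
by apply: (solves_on_eq _ _ (PhiP x mx Bx)); [exact: xE | exact: aeW].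
Qed.

(** * Measurability and local bounds of Caratheodory functions *)

Lemma generated_measurable (R : realType) (T : pointedType) (O : set (set T)) (f : T -> R) :
  (forall V, open V -> O (f @^-1` V)) ->
  measurable_fun setT (f : g_sigma_algebraType O -> R).
Proof.
move=> cf; apply: (measurability _ (RGenOpens.measurableE R)).
move=> _ [_ [a [b ->] <-]]; rewrite setTI; apply: sub_gen_smallest.
by apply: cf; exact: interval_open.
Qed.

Lemma continuous_borel_measurable (R : realType) (T : ptopologicalType) (f : T -> R) :
  continuous f -> measurable_fun setT (f : borel T -> R).
Proof. by move=> cf; apply: generated_measurable => V; exact: open_comp. Qed.

Lemma measurable_coord d (T : measurableType d) (R : realType) p q (D : set T)
    (h : T -> 'M[R]_(p, q)) i j :
  measurable_fun D (h : T -> borel 'M[R]_(p, q)) -> measurable_fun D (fun z => h z i j).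
Proof.
move=> mh; have := continuous_borel_measurable (@coord_continuous R p q i j).
by move=> mc; exact: (measurableT_comp mc mh).
Qed.

(** Here [real_induction] does the work of compactness: near each c a local bound extends a bound on
    [0, x] to one on [0, y]. *)
Lemma locally_bounded_itv (R : realType) (V : normedModType R) (u : R -> V) (b : R) :
  [locally [bounded u t | t in halfline R]] -> 0 <= b ->
  exists2 M : R, 0 <= M & forall t : R, 0 <= t <= b -> `|u t| <= M.
Proof.
move=> hu b0.
apply: (@real_induction R (fun c => exists2 M : R, 0 <= M & forall t : R, 0 <= t <= c -> `|u t| <= M) 0 b) => //.
  exists `|u 0| => // t /andP[t0 t0']; have -> : t = 0 by apply: le_anti; rewrite t0 t0'.
  by [].
move=> c /andP[c0 cb].
have /hu : halfline R c by rewrite /= in_itv/= c0.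
rewrite /bounded_near => /pinfty_ex_gt0[M M0].
move=> /nbhs_ballP[r /= r0 hr].
exists r => // x y x0 xc cy yb rx yr [N N0 hN].
exists (Num.max M N); first by rewrite le_max N0 orbT.
move=> t /andP[t0 ty]; rewrite le_max.
have [tx|xt] := leP t x; first by rewrite hN ?orbT// t0.
rewrite hr//; last by rewrite /= in_itv/= t0.
by rewrite /ball/= ltr_norml; apply/andP; split; lra.
Qed.

Definition grid (R : realType) (n : nat) (r : R) : int := Num.floor (r * n.+1%:R).

Definition ungrid (R : realType) (n : nat) (k : int) : R := k%:~R / n.+1%:R.

Lemma grid_dist (R : realType) (n : nat) (r : R) :
  `|r - ungrid R n (grid n r)| <= n.+1%:R^-1.
Proof.
have n0 : 0 < n.+1%:R :> R by [].
have /andP[h1 h2] := floor_itv (r * n.+1%:R).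
rewrite -/(grid n r) in h1 h2; rewrite /ungrid.
have -> : r - (grid n r)%:~R / n.+1%:R = (r * n.+1%:R - (grid n r)%:~R) / n.+1%:R.
  by field; rewrite gt_eqF.
rewrite normrM [X in _ * X]ger0_norm ?invr_ge0// -[leRHS]mul1r ler_wpM2r ?invr_ge0//.
by move: h2; rewrite intrD mulr1z ler_norml => h2; apply/andP; split; lra.
Qed.

Lemma measurable_grid d (T : measurableType d) (R : realType) (D : set T)
    (h : T -> R) n (k : int) : measurable D -> measurable_fun D h ->
  measurable (D `&` [set z | grid n (h z) = k]).
Proof.
move=> mD mh.
have n0 : 0 < n.+1%:R :> R by [].
have := mh mD `[ungrid R n k, ungrid R n (k + 1)[%classic (measurable_itv _).
congr measurable; apply/seteqP; split => z [Dz] /=; rewrite in_itv/= /ungrid => hz; split=> //.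
  by apply: floor_def; move: hz; rewrite ler_pdivrMr// ltr_pdivlMr.
by have := floor_itv (h z * n.+1%:R); rewrite -/(grid n (h z)) hz ler_pdivrMr// ltr_pdivlMr.
Qed.

(* The composition is the limit of its values at arguments rounded to a grid. *)
Lemma caratheodory_measurable d (T : measurableType d) (R : realType) (m k : nat)
    (a : running R m k) (D : set T) (s : T -> R)
    (y : T -> 'cV[R]_m) (w : T -> 'cV[R]_k) :
  measurable D ->
  (forall x u, measurable_fun (halfline R) (fun t => a t x u)) ->
  (forall z, D z -> 0 <= s z) ->
  (forall z, D z -> continuous (fun xu : 'cV[R]_m * 'cV[R]_k => a (s z) xu.1 xu.2)) ->
  measurable_fun D s -> (forall i, measurable_fun D (fun z => y z i 0)) ->
  (forall i, measurable_fun D (fun z => w z i 0)) ->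
  measurable_fun D (fun z => a (s z) (y z) (w z)).
Proof.
move=> mD ma s0 ca ms my mw.
pose cy n z : {ffun 'I_m -> int} := [ffun i => grid n (y z i 0)].
pose cw n z : {ffun 'I_k -> int} := [ffun i => grid n (w z i 0)].
pose vy n (c : {ffun 'I_m -> int}) : 'cV[R]_m := \col_i ungrid R n (c i).
pose vw n (c : {ffun 'I_k -> int}) : 'cV[R]_k := \col_i ungrid R n (c i).
pose F n z := a (s z) (vy n (cy n z)) (vw n (cw n z)).
have mgrid n l (h : T -> 'cV[R]_l) (c : {ffun 'I_l -> int}) :
    (forall i, measurable_fun D (fun z => h z i 0)) ->
    measurable (D `&` [set z | [ffun i => grid n (h z i 0)] = c]).
  move=> mh.
  have -> : D `&` [set z | [ffun i => grid n (h z i 0)] = c] =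
      D `&` \bigcap_(i in [set: 'I_l]) (D `&` [set z | grid n (h z i 0) = c i]).
    apply/seteqP; split => z [Dz] /=.
      move=> <-; split => //; move=> i _; split => //=.
      by rewrite ffunE.
    move=> H; split => //.
    by apply/ffunP => i; rewrite ffunE; have [] := H i I.
  apply: measurableI => //; apply: fin_bigcap_measurable => [|i _].
    exact: finite_finset.
  exact: measurable_grid.
have mF n : measurable_fun D (F n).
  move=> _ B mB.
  (* Rounded arguments take countably many values, and on each grid cell only the time argument
     varies. *)
  have -> : D `&` F n @^-1` B = \bigcup_(c : {ffun 'I_m -> int} * {ffun 'I_k -> int})
     ((D `&` [set z | cy n z = c.1]) `&` (D `&` [set z | cw n z = c.2]) `&`
      (D `&` (fun z => a (s z) (vy n c.1) (vw n c.2)) @^-1` B)).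
    apply/seteqP; split => z.
      by move=> [Dz Fz]; exists (cy n z, cw n z).
    by move=> [[c1 c2] _ [[[Dz /= <-] [_ <-]] [_ Bz]]].
  apply: countable_bigcupT_measurable => [|c]; first exact: countableP.
  apply: measurableI; first by apply: measurableI; exact: mgrid.
  have := @measurable_comp _ _ _ _ _ _ (halfline R) (fun t => a t (vy n c.1) (vw n c.2)) D s.
  apply => //.
  by move=> _ [z Dz <-] /=; rewrite in_itv/= s0.
apply: (measurable_fun_cvg mF) => z Dz.
have nearSinv (e : R) : 0 < e -> \forall n \near \oo, n.+1%:R^-1 <= e.
  move=> e0; have := near_infty_natSinv_lt (PosNum e0).
  by apply: filterS => n /ltW.
have cvgY : vy n (cy n z) @[n --> \oo] --> y z.
  apply/cvgrPdist_le => e e0; near=> n; apply: mx_norm_le => [|i j]; first exact: ltW.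
  rewrite !mxE !ffunE !ord1 (le_trans (grid_dist _ _))//.
  near: n; exact: nearSinv.
have cvgW : vw n (cw n z) @[n --> \oo] --> w z.
  apply/cvgrPdist_le => e e0; near=> n; apply: mx_norm_le => [|i j]; first exact: ltW.
  rewrite !mxE !ffunE !ord1 (le_trans (grid_dist _ _))//.
  near: n; exact: nearSinv.
exact: (cvg_comp (fun n => (vy n (cy n z), vw n (cw n z)))
  (fun xu : 'cV[R]_m * 'cV[R]_k => a (s z) xu.1 xu.2) (cvg_pair cvgY cvgW) (ca z Dz (y z, w z))).
Unshelve. all: by end_near. Qed.

Lemma regular_coord (R : realType) m k p q (a : R -> 'cV[R]_m -> 'cV[R]_k -> 'M[R]_(p, q)) :
  caratheodory a -> exists N : set R, [/\ measurable N, mu N = 0%E,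
    (forall i j x u, measurable_fun (halfline R) (fun t => a t x u i j)) &
    (forall i j t, 0 <= t -> ~ N t ->
       continuous (fun xu : 'cV[R]_m * 'cV[R]_k => a t xu.1 xu.2 i j))].
Proof.
move=> [ma /ae_negl[N [mN N0 hN]]]; exists N; split => //.
  by move=> i j x u; exact: measurable_coord (ma x u).
move=> i j t t0 Nt xu.
exact: (continuous_comp (hN t Nt t0 xu) (@coord_continuous R p q i j _)).
Qed.

Lemma caratheodory_ae_measurable (R : realType) m k
    (a : running R m k) (N : set R) (b : R)
    (x : R -> 'cV[R]_m) (u : R -> 'cV[R]_k) :
  measurable N -> mu N = 0%E ->
  (forall x u, measurable_fun (halfline R) (fun t => a t x u)) ->
  (forall t, 0 <= t -> ~ N t ->
       continuous (fun xu : 'cV[R]_m * 'cV[R]_k => a t xu.1 xu.2)) ->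
  (forall i, measurable_fun `[0, b] (fun t => x t i 0)) ->
  (forall i, measurable_fun `[0, b] (fun t => u t i 0)) ->
  ae_measurable b (fun t => a t (x t) (u t)).
Proof.
move=> mN N0 ma ca mx mu_.
have mCN : measurable (~` N) by exact: measurableC.
exists ((fun t => a t (x t) (u t)) \_ (~` N)); last first.
  exists N; split => // t /=; apply: contra_notP => Nt tb.
  by rewrite patchE mem_set.
apply/measurable_restrict => //.
have sub : `[0, b] `&` ~` N `<=` `[0, b] by move=> t [].
apply: caratheodory_measurable => //.
- exact: measurableI.
- by move=> t [/=]; rewrite in_itv/= => /andP[].
- by move=> t [/=]; rewrite in_itv/= => /andP[t0 _] Nt; exact: ca.
- by move=> i; apply: measurable_funS (mx i).
- by move=> i; apply: measurable_funS (mu_ i).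
Qed.

Lemma regular_ae_measurable (R : realType) m k p q
    (a : R -> 'cV[R]_m -> 'cV[R]_k -> 'M[R]_(p, q)) (b : R)
    (x : R -> 'cV[R]_m) (u : R -> 'cV[R]_k) :
  caratheodory a ->
  (forall i, measurable_fun `[0, b] (fun t => x t i 0)) ->
  (forall i, measurable_fun `[0, b] (fun t => u t i 0)) ->
  forall i j, ae_measurable b (fun t => a t (x t) (u t) i j).
Proof.
move=> /regular_coord[N [mN N0 ma ca]] mx mu_ i j.
by apply: (@caratheodory_ae_measurable _ _ _ (fun t x u => a t x u i j) N) => // t t0 Nt; exact: ca.
Qed.

Lemma regular_ae_measurableR (R : realType) m k
    (a : running R m k) (b : R)
    (x : R -> 'cV[R]_m) (u : R -> 'cV[R]_k) :
  caratheodory ((fun t x u => a t x u) : R -> 'cV[R]_m -> 'cV[R]_k -> R^o) ->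
  (forall i, measurable_fun `[0, b] (fun t => x t i 0)) ->
  (forall i, measurable_fun `[0, b] (fun t => u t i 0)) ->
  ae_measurable b (fun t => a t (x t) (u t)).
Proof.
move=> [ma /ae_negl[N [mN N0 hN]]] mx mu_.
apply: (@caratheodory_ae_measurable _ _ _ a N) => //.
- move=> x' u'; have mc := @continuous_borel_measurable R R^o idfun (fun x => cvg_id).
  exact: (measurableT_comp mc (ma x' u')).
- by move=> t t0 Nt; exact: hN.
Qed.

Lemma compact_col_ball (R : realType) n (c : R) :
  compact [set x : 'cV[R]_n | `|x| <= c].
Proof.
have tn p q (A : 'M[R]_(p, q)) : `|A^T| <= `|A|.
  by apply: mx_norm_le => // i j; rewrite mxE le_mx_norm.
have -> : [set x : 'cV[R]_n | `|x| <= c] = trmx @` [set x : 'rV[R]_n | `|x| <= c].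
  apply/seteqP; split => [x /= xc|_ [x /= xc <-]].
    exists x^T; last by rewrite trmxK.
    by rewrite /= (le_trans (tn _ _ _)).
  by rewrite (le_trans (tn _ _ _)).
have ct : continuous (trmx : 'rV[R]_n -> 'cV[R]_n).
  move=> x; apply: (@cvgrPdist_le R 'cV[R]_n _ (nbhs x) _ trmx x^T).2 => e e0.
  apply/nbhs_ballP; exists e => // y; rewrite -ball_normE/= => xy.
  by rewrite -linearB/= (le_trans (tn _ _ _))// ltW.
apply: continuous_compact; first exact: continuous_subspaceT.
apply: bounded_closed_compact.
  exists c; split; first exact: num_real.
  by move=> y cy x /= xc; rewrite (le_trans xc)// ltW.
have -> : [set x : 'rV[R]_n | `|x| <= c] = (fun x : 'rV[R]_n => `|x|) @^-1` [set r | r <= c] by [].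
apply: closed_comp; last exact: closed_le.
by move=> x _; exact: norm_continuous.
Qed.

Lemma regular_bounds (R : realType) m k (V : normedModType R)
    (a : R -> 'cV[R]_m -> 'cV[R]_k -> V) (r c : R) :
  regular a -> exists l : R -> R, [/\ (forall t, 0 <= t -> 0 <= l t),
    (forall b, ae_integrable b l),
    (forall t x y u, 0 <= t -> `|x| <= r -> `|y| <= r -> `|u| <= c ->
       `|a t x u - a t y u| <= l t * `|x - y|) &
    (forall t x u, 0 <= t -> `|x| <= r -> `|u| <= c -> `|a t x u| <= l t)].
Proof.
move=> [_ ra].
have cK := compact_setX (@compact_col_ball R m r) (@compact_col_ball R k c).
have [L [M [LM0 iL iM hL hM]]] := ra _ cK.
exists (fun t => L t + M t); split.
- by move=> t /LM0[? ?]; exact: addr_ge0.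
- by move=> b; apply: ae_integrableD; exact: loc_integrable_ae.
- move=> t x y u t0 xr yr uc; rewrite (le_trans (hL t x y u t0 _ _))//.
  by rewrite ler_wpM2r// lerDl; have [] := LM0 t t0.
- move=> t x u t0 xr uc; rewrite (le_trans (hM t x u t0 _))//.
  by rewrite lerDr; have [] := LM0 t t0.
Qed.

(** * Derivatives in the state and first-order Taylor estimates *)

Lemma grad_diff (R : realType) m (h : 'cV[R]_m -> R) (x v : 'cV[R]_m) :
  'd (h : 'cV[R]_m -> R^o) x v = (grad h x *m v) 0 0.
Proof.
have {1}-> : v = \sum_(j < m) v j 0 *: (delta_mx j 0 : 'cV[R]_m).
  apply/colP => i; rewrite summxE (bigD1 i)//= big1 ?addr0.
    by rewrite !mxE !eqxx mulr1.
  by move=> j ji; rewrite !mxE eq_sym (negbTE ji) mulr0.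
rewrite linear_sum mxE; apply: eq_bigr => j _; rewrite linearZ /= mxE.
by rewrite [RHS]mulrC.
Qed.

Lemma coord_diff (R : realType) m p (h : 'cV[R]_m -> 'cV[R]_p) (x : 'cV[R]_m) i :
  differentiable h x ->
  differentiable ((fun y => h y i 0) : 'cV[R]_m -> R^o) x /\
  forall v, 'd ((fun y => h y i 0) : 'cV[R]_m -> R^o) x v = ('d h x v) i 0.
Proof.
move=> dh.
pose co : 'cV[R]_p -> R^o := fun y => y i 0.
have lco : linear co by move=> a y z; rewrite /co !mxE.
pose coL : {linear 'cV[R]_p -> R^o} := HB.pack co (GRing.isLinear.Build _ _ _ _ co lco).
have cco : continuous coL by exact: coord_continuous.
have dco y : differentiable coL y by exact: linear_differentiable.
have -> : (fun y => h y i 0) = coL \o h by [].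
split; first exact: differentiable_comp.
move=> v; rewrite (diff_comp dh (dco (h x)))/= (diff_lin (h x) cco).
by [].
Qed.

Lemma jac_grad (R : realType) m p (h : 'cV[R]_m -> 'cV[R]_p) (x : 'cV[R]_m) i :
  differentiable h x -> grad (fun y => h y i 0) x = row i (jac h x).
Proof. by move=> /(coord_diff i)[_ dE]; apply/rowP => j; rewrite !mxE dE. Qed.

Lemma is_derive_line (R : realType) m (h : 'cV[R]_m -> R) (c v : 'cV[R]_m) (s : R) :
  differentiable (h : 'cV[R]_m -> R^o) (c + s *: v) ->
  is_derive (s : R^o) (1 : R^o) ((fun s => h (c + s *: v)) : R^o -> R^o)
    ((grad h (c + s *: v) *m v) 0 0).
Proof.
move=> dh.
have dv := @diff_derivable _ _ _ _ _ v dh.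
have -> : (grad h (c + s *: v) *m v) 0 0 = 'D_v (h : 'cV[R]_m -> R^o) (c + s *: v).
  by rewrite deriveE// grad_diff.
have E : (fun e : R => e^-1 *: (((fun s => h (c + s *: v) : R^o) \o shift s) (e *: (1 : R^o)) - h (c + s *: v))) =
         (fun e : R => e^-1 *: (((h : 'cV[R]_m -> R^o) \o shift (c + s *: v)) (e *: v) - h (c + s *: v))).
  apply/funext => e /=; congr (_ *: (h _ - _)).
  by rewrite /shift/= -[e%:A]/(e * 1) mulr1 scalerDl addrA addrAC addrC addrA.
by split; rewrite /derivable /derive E.
Qed.

(** The gradient is frozen at a third point x: the adjoint equation carries derivatives along a
    reference trajectory, while the two trajectories compared are merely close to it. By convexity
    the mean value point on the segment from c to a stays within D of x; the factor m comes from
    matrix products in the sup norm. *)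
Lemma taylor_scalar (R : realType) m (h : 'cV[R]_m -> R) (r l D : R)
    (a c x : 'cV[R]_m) :
  (forall y, differentiable (h : 'cV[R]_m -> R^o) y) -> 0 <= l ->
  (forall y z, `|y| <= r -> `|z| <= r -> `|grad h y - grad h z| <= l * `|y - z|) ->
  `|a| <= r -> `|c| <= r -> `|x| <= r -> `|a - x| <= D -> `|c - x| <= D ->
  `|h a - h c - (grad h x *m (a - c)) 0 0| <= m%:R * l * D * `|a - c|.
Proof.
move=> dh l0 hl ar cr xr aD cD.
pose ph s := h (c + s *: (a - c)).
have dph s : is_derive (s : R^o) (1 : R^o) (ph : R^o -> R^o)
    ((grad h (c + s *: (a - c)) *m (a - c)) 0 0).
  exact: is_derive_line.
have [|s sI] := MVT_segment (f := ph) ler01 (fun s _ => dph s).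
  apply: derivable_within_continuous => s _; exact: ex_derive.
rewrite subr0 mulr1.
have -> : ph 1 = h a by rewrite /ph scale1r addrC subrK.
have -> : ph 0 = h c by rewrite /ph scale0r addr0.
move=> ->.
have /andP[s0 s1] : 0 <= s <= 1 by move: sI; rewrite in_itv.
rewrite -[_ - _]/((grad h (c + s *: (a - c)) *m (a - c)) 0 0 - _).
have -> (A B : 'M[R]_1) : A 0 0 - B 0 0 = (A - B) 0 0 by rewrite !mxE.
rewrite -mulmxBl (le_trans (le_mx_norm _ _ _))// (le_trans (mx_norm_mul_le _ _))//.
rewrite ler_wpM2r// -mulrA ler_wpM2l//.
have conv (p q : 'cV[R]_m) B : `|p| <= B -> `|q| <= B -> `|q + s *: (p - q)| <= B.
  move=> pB qB; have -> : q + s *: (p - q) = s *: p + (1 - s) *: q.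
    by rewrite scalerBr scalerBl scale1r addrCA.
  rewrite (le_trans (ler_normD _ _))// !normrZ !ger0_norm ?subr_ge0//.
  have := ler_wpM2l s0 pB; have := ler_wpM2l (_ : 0 <= 1 - s) qB => /(_ _)/wrap[].
    by rewrite subr_ge0.
  lra.
rewrite (le_trans (hl _ _ _ _))//; first exact: conv.
rewrite ler_wpM2l//.
have -> : c + s *: (a - c) - x = (c - x) + s *: ((a - x) - (c - x)).
  by rewrite opprB addrA subrK addrAC.
exact: conv.
Qed.

Lemma taylor_vector (R : realType) m p (h : 'cV[R]_m -> 'cV[R]_p) (r l D : R)
    (a c x : 'cV[R]_m) :
  (forall y, differentiable h y) -> 0 <= l -> 0 <= D ->
  (forall y z, `|y| <= r -> `|z| <= r -> `|jac h y - jac h z| <= l * `|y - z|) ->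
  `|a| <= r -> `|c| <= r -> `|x| <= r -> `|a - x| <= D -> `|c - x| <= D ->
  `|h a - h c - jac h x *m (a - c)| <= m%:R * l * D * `|a - c|.
Proof.
move=> dh l0 D0 hl ar cr xr aD cD; apply: mx_norm_le => [|i j].
  by rewrite !mulr_ge0.
rewrite ord1 [X in `|X|](_ : _ = h a i 0 - h c i 0 -
    (grad (fun y => h y i 0) x *m (a - c)) 0 0); last first.
  by rewrite jac_grad// !mxE; congr (_ - _); apply: eq_bigr => k _; rewrite !mxE.
apply: (@taylor_scalar R m (fun y => h y i 0) r) => //.
  by move=> y; have [] := coord_diff i (dh y).
move=> y z yr zr; rewrite !jac_grad//; apply: le_trans (hl y z yr zr).
by apply: mx_norm_le => // i' j'; rewrite -linearB/= !mxE; have := le_mx_norm (jac h y - jac h z) i j'; rewrite !mxE.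
Qed.

(** * Trajectories and the adjoint equation *)

Record reg_bounds (R : realType) m k (f : dynamics R m k)
    (g : running R m k) (r c : R) (l : R -> R) : Prop := {
  rb_ge0 : forall t, 0 <= t -> 0 <= l t;
  rb_int : forall b, ae_integrable b l;
  rb_lip_f : forall t x y u, 0 <= t -> `|x| <= r -> `|y| <= r -> `|u| <= c ->
     `|f t x u - f t y u| <= l t * `|x - y|;
  rb_f : forall t x u, 0 <= t -> `|x| <= r -> `|u| <= c -> `|f t x u| <= l t;
  rb_lip_g : forall t x y u, 0 <= t -> `|x| <= r -> `|y| <= r -> `|u| <= c ->
     `|g t x u - g t y u| <= l t * `|x - y|;
  rb_g : forall t x u, 0 <= t -> `|x| <= r -> `|u| <= c -> `|g t x u| <= l t;
  rb_lip_jac : forall t x y u, 0 <= t -> `|x| <= r -> `|y| <= r -> `|u| <= c ->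
     `|jac (fun z => f t z u) x - jac (fun z => f t z u) y| <= l t * `|x - y|;
  rb_jac : forall t x u, 0 <= t -> `|x| <= r -> `|u| <= c ->
     `|jac (fun z => f t z u) x| <= l t;
  rb_lip_grad : forall t x y u, 0 <= t -> `|x| <= r -> `|y| <= r -> `|u| <= c ->
     `|grad (fun z => g t z u) x - grad (fun z => g t z u) y| <= l t * `|x - y|;
  rb_grad : forall t x u, 0 <= t -> `|x| <= r -> `|u| <= c ->
     `|grad (fun z => g t z u) x| <= l t }.

Lemma reg_boundsP (R : realType) m k (f : dynamics R m k)
    (g : running R m k) (r c : R) :
  regularity_conditions f g -> exists l, reg_bounds f g r c l.
Proof.
move=> [_ [rf rg] rj rgr _].
have [l1 [p1 i1 a1 b1]] := regular_bounds r c rf.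
have [l2 [p2 i2 a2 b2]] := regular_bounds r c rg.
have [l3 [p3 i3 a3 b3]] := regular_bounds r c rj.
have [l4 [p4 i4 a4 b4]] := regular_bounds r c rgr.
have E t : 0 <= t -> [/\ l1 t <= l1 t + l2 t + (l3 t + l4 t), l2 t <= l1 t + l2 t + (l3 t + l4 t),
   l3 t <= l1 t + l2 t + (l3 t + l4 t) & l4 t <= l1 t + l2 t + (l3 t + l4 t)].
  by move=> t0; have := p1 t t0; have := p2 t t0; have := p3 t t0; have := p4 t t0; split; lra.
exists (fun t => l1 t + l2 t + (l3 t + l4 t)); split.
- by move=> t t0; rewrite !addr_ge0 ?p1 ?p2 ?p3 ?p4.
- by move=> b; apply: ae_integrableD; exact: ae_integrableD.
- move=> t x y u t0 xr yr uc; have [h _ _ _] := E t t0.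
  by rewrite (le_trans (a1 t x y u t0 xr yr uc))// ler_wpM2r.
- by move=> t x u t0 xr uc; have [h _ _ _] := E t t0; exact: le_trans (b1 t x u t0 xr uc) h.
- move=> t x y u t0 xr yr uc; have [_ h _ _] := E t t0.
  by rewrite (le_trans (a2 t x y u t0 xr yr uc))// ler_wpM2r.
- by move=> t x u t0 xr uc; have [_ h _ _] := E t t0; exact: le_trans (b2 t x u t0 xr uc) h.
- move=> t x y u t0 xr yr uc; have [_ _ h _] := E t t0.
  by rewrite (le_trans (a3 t x y u t0 xr yr uc))// ler_wpM2r.
- by move=> t x u t0 xr uc; have [_ _ h _] := E t t0; exact: le_trans (b3 t x u t0 xr uc) h.
- move=> t x y u t0 xr yr uc; have [_ _ _ h] := E t t0.
  by rewrite (le_trans (a4 t x y u t0 xr yr uc))// ler_wpM2r.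
- by move=> t x u t0 xr uc; have [_ _ _ h] := E t t0; exact: le_trans (b4 t x u t0 xr uc) h.
Qed.

Lemma growth_bound (R : realType) m k (f : dynamics R m k)
    (g : running R m k) (c : R) :
  regularity_conditions f g -> exists l : R -> R,
  [/\ (forall t, 0 <= t -> 0 <= l t), (forall b, ae_integrable b l) &
   (forall t x u, 0 <= t -> `|u| <= c -> `|f t x u| <= l t * (1 + `|x|))].
Proof.
move=> [_ _ _ _ /(_ _ (@compact_col_ball R k c))[l [l0 il hl]]].
by exists l; split => // b; exact: loc_integrable_ae.
Qed.

Definition bdd_meas (R : realType) n (b c : R) (x : R -> 'cV[R]_n) : Prop :=
  (forall i, measurable_fun `[0, b] (fun t => x t i 0)) /\
  (forall t : R, 0 <= t <= b -> `|x t| <= c).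

Lemma solves_on_bdd_meas (R : realType) n (b c : R) (x v : R -> 'cV[R]_n) :
  solves_on b x v -> (forall t : R, 0 <= t <= b -> `|x t| <= c) -> bdd_meas b c x.
Proof.
move=> [acx _] hc; split => // i; apply: abs_cont_measurable.
exact: (abs_cont_mxP _ _).1.
Qed.

Lemma comp_integrable (R : realType) m k p q
    (a : R -> 'cV[R]_m -> 'cV[R]_k -> 'M[R]_(p, q)) (l : R -> R) (b r c : R)
    (x : R -> 'cV[R]_m) (u : R -> 'cV[R]_k) :
  caratheodory a -> ae_integrable b l ->
  (forall t x u, 0 <= t -> `|x| <= r -> `|u| <= c -> `|a t x u| <= l t) ->
  bdd_meas b r x -> bdd_meas b c u ->
  forall i j, ae_integrable b (fun t => a t (x t) (u t) i j).
Proof.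
move=> ca il hl [mx xr] [mu_ uc] i j.
apply: (@ae_integrable_le _ _ _ l) => //; first exact: regular_ae_measurable.
apply: aeW => t tb; rewrite (le_trans (le_mx_norm _ _ _))// hl//; last 2 first.
- exact: xr.
- exact: uc.
by case/andP: tb.
Qed.

Lemma comp_integrableR (R : realType) m k
    (a : running R m k) (l : R -> R) (b r c : R)
    (x : R -> 'cV[R]_m) (u : R -> 'cV[R]_k) :
  caratheodory ((fun t x u => a t x u) : R -> 'cV[R]_m -> 'cV[R]_k -> R^o) ->
  ae_integrable b l ->
  (forall t x u, 0 <= t -> `|x| <= r -> `|u| <= c -> `|a t x u| <= l t) ->
  bdd_meas b r x -> bdd_meas b c u ->
  ae_integrable b (fun t => a t (x t) (u t)).
Proof.
move=> ca il hl [mx xr] [mu_ uc].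
apply: (@ae_integrable_le _ _ _ l) => //; first exact: regular_ae_measurableR.
apply: aeW => t tb; rewrite hl//; last 2 first.
- exact: xr.
- exact: uc.
by case/andP: tb.
Qed.

Lemma solves_on_mulmx (R : realType) p q s (b : R) (x v : R -> 'M[R]_(p, q))
    (y w : R -> 'M[R]_(q, s)) :
  solves_on b x v -> solves_on b y w ->
  solves_on b (fun t => x t *m y t) (fun t => v t *m y t + x t *m w t).
Proof.
move=> /solves_on_mxP hx /solves_on_mxP hy; apply/solves_on_mxP => i j.
apply: solves_on_eq (solves_on_sum (fun k => solves_on_mul (hx i k) (hy k j))).
  by move=> t _; rewrite mxE.
by apply: aeW => t _; rewrite !mxE -big_split.
Qed.

Lemma solves_on_entry (R : realType) p q (b : R) (x v : R -> 'M[R]_(p, q)) i j :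
  solves_on b x v -> @solves_on R R^o b (fun t => x t i j) (fun t => v t i j).
Proof. by move=> /solves_on_mxP. Qed.

(* Picard is applied to the field precomposed with this retraction on a ball;
   sublinear growth then keeps the solution inside the ball. *)
Definition clip (R : realType) n (r : R) (x : 'cV[R]_n) : 'cV[R]_n :=
  \col_i Num.max (- r) (Num.min r (x i 0)).

Lemma clip_lip (R : realType) n (r : R) (x y : 'cV[R]_n) : 
  `|clip r x - clip r y| <= `|x - y|.
Proof.
apply: mx_norm_le => // i j; rewrite ord1 !mxE.
apply: le_trans (le_mx_norm _ i 0); rewrite !mxE.
rewrite /Num.max /Num.min; do !case: ifPn; rewrite -?leNgt => *;
  rewrite ler_norml; apply/andP; split;
  have := ler_norm (x i 0 - y i 0); have := ler_norm (- (x i 0 - y i 0));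
  rewrite normrN; lra.
Qed.

Lemma clip_le (R : realType) n (r : R) (x : 'cV[R]_n) : 0 <= r -> `|clip r x| <= r.
Proof.
move=> r0; apply: mx_norm_le => // i j; rewrite ord1 !mxE ler_norml.
by rewrite le_max lexx/= ge_max ge_min lexx/= andbT; lra.
Qed.

Lemma clip_id (R : realType) n (r : R) (x : 'cV[R]_n) : `|x| <= r -> clip r x = x.
Proof.
move=> xr; apply/colP => i; rewrite mxE.
have := le_trans (le_mx_norm x i 0) xr; rewrite ler_norml => /andP[h1 h2].
by rewrite min_r// max_r.
Qed.

Lemma clip_norm (R : realType) n (r : R) (x : 'cV[R]_n) : 0 <= r -> `|clip r x| <= `|x|.
Proof.
move=> r0; have c0 : clip r (0 : 'cV[R]_n) = 0 by rewrite clip_id// normr0.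
by have := clip_lip r x 0; rewrite c0 !subr0.
Qed.

Lemma apriori_bound (R : realType) n (b t0 rho : R) (l : R -> R) (x v : R -> 'cV[R]_n) :
  (forall t, 0 <= t -> 0 <= l t) -> ae_integrable b l ->
  solves_on b x v ->
  (forall t, 0 <= t <= b -> `|v t| <= l t * (1 + `|x t|)) ->
  0 <= t0 <= b -> `|x t0| <= rho ->
  forall t, 0 <= t <= b -> `|x t| <= 2 * expR (2 * \int[mu]_(s in `[0, b]) l s)
            * (rho + \int[mu]_(s in `[0, b]) l s).
Proof.
move=> l0 il hx hv t0b xr t tb.
apply: (le_trans (@gronwall _ _ _ b t0 x v l l hx il il _ t0b t tb)).
  apply: aeW => s sb; have s0 : 0 <= s by case/andP: sb.
  by split; rewrite ?l0// (le_trans (hv s sb))// mulrDr mulr1 addrC.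
by rewrite ler_wpM2l ?mulr_ge0 ?expR_ge0// lerD2r.
Qed.

Lemma traj_exists (R : realType) m k (f : dynamics R m k)
    (g : running R m k) (b t0 c : R) (x1 : 'cV[R]_m)
    (w : R -> 'cV[R]_k) :
  regularity_conditions f g -> 0 <= t0 <= b -> bdd_meas b c w ->
  exists2 x, solves_on b x (fun t => f t (x t) (w t)) & x t0 = x1.
Proof.
move=> fg t0b [mw wc].
have b0 : 0 <= b by case/andP: t0b; exact: le_trans.
have [l [l0 il hl]] := growth_bound c fg.
(* This is the bound of [apriori_bound] for the clipped field, which obeys the same growth estimate
   because clipping does not increase norms. The clipped solution hence stays where clipping is the
   identity. *)
pose r := 2 * expR (2 * \int[mu]_(s in `[0, b]) l s)
            * (`|x1| + \int[mu]_(s in `[0, b]) l s).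
have r0 : 0 <= r.
  rewrite !mulr_ge0 ?expR_ge0// addr_ge0//; apply: primitive_ge0 (il b) _ _; last by rewrite b0 lexx.
  by apply: aeW => t /andP[/l0].
have [L hL] := reg_boundsP r c fg.
have [] := @picard R m 1 b t0 x1 (fun t x => f t (clip r x) (w t)) L (fun t => l t * (1 + `|x1|)).
- by [].
- exact: (rb_int hL).
- by apply: ae_integrable_eq (ae_integrableZ (1 + `|x1|) (il b)); apply: aeW => t _; rewrite mulrC.
- apply: aeW => t tb; have t_ge0 : 0 <= t by case/andP: tb.
  split; first exact: (rb_ge0 hL).
    rewrite (le_trans (hl t _ _ t_ge0 _))//; first exact: wc.
    by rewrite ler_wpM2l ?l0// lerD2l clip_norm.
  move=> x y; rewrite (le_trans (rb_lip_f hL t_ge0 (clip_le _ r0) (clip_le _ r0) (wc t tb)))//.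
  by rewrite ler_wpM2l ?(rb_ge0 hL)// clip_lip.
- move=> x mx i j.
  have [_ [[cf _] _] _ _ _] := fg.
  apply: (regular_ae_measurable (x := fun t => clip r (x t)) cf _ mw) => i'.
  apply: (eq_measurable_fun (fun t => Num.max (- r) (Num.min r (x t i' 0)))).
    by move=> t _; rewrite mxE.
  apply: measurable_maxr; first exact: measurable_cst.
  by apply: measurable_minr; first exact: measurable_cst.
move=> x hx xt0; exists x => //.
have xr t : 0 <= t <= b -> `|x t| <= r.
  apply: (apriori_bound l0 (il b) hx _ t0b); last by rewrite xt0.
  move=> s sb; have s0 : 0 <= s by case/andP: sb.
  rewrite (le_trans (hl s _ _ s0 _))//; first exact: wc.
  by rewrite ler_wpM2l ?l0// lerD2l clip_norm.
apply: solves_on_eq hx => //; apply: aeW => t /andP[t0' tb].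
by rewrite clip_id// xr// !ltW.
Qed.

Lemma hamiltonian_integrable (R : realType) m k
    (f : dynamics R m k)
    (g : running R m k) (b r c P lam : R) (l : R -> R)
    (x : R -> 'cV[R]_m) (w : R -> 'cV[R]_k) (psi : R -> 'rV[R]_m) :
  regularity_conditions f g -> reg_bounds f g r c l ->
  abs_cont b psi -> (forall t : R, 0 <= t <= b -> `|psi t| <= P) ->
  bdd_meas b r x -> bdd_meas b c w ->
  ae_integrable b (fun t => hamiltonian f g (x t) t (w t) lam (psi t)).
Proof.
move=> fg hl acpsi hP bx hw.
have [_ [[cf _] [cg _]] _ _ _] := fg.
have il := rb_int hl b.
apply: ae_integrableD; last first.
  by apply: ae_integrableZ; exact: comp_integrableR cg il (rb_g hl) bx hw.
apply: (@ae_integrable_le _ _ _ (fun t => (m%:R * P) * l t)).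
- apply: (@ae_measurable_eq _ _ (fun t => \sum_j psi t 0 j * f t (x t) (w t) j 0)).
    by apply: aeW => t _; rewrite mxE.
  apply: ae_measurable_sum => j; apply: ae_measurableM.
    apply: measurable_ae; apply: abs_cont_measurable.
    exact: (abs_cont_mxP _ _).1.
  apply: ae_integrable_measurable; exact: (comp_integrable cf il (rb_f hl) bx hw).
- exact: ae_integrableZ.
- apply: aeW => t tb; have pP := hP t tb.
  rewrite (le_trans (le_mx_norm _ _ _))// (le_trans (mx_norm_mul_le _ _))//.
  have t0 : 0 <= t by case/andP: tb.
  rewrite ler_pM// ?mulr_ge0 ?ler_wpM2l// (rb_f hl)//.
    by case: bx => _; exact.
  by case: hw => _; exact.
Qed.

(** Differentiate psi (a - z) + lam (payoff difference). The adjoint equation along x cancels the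
    terms linear in a - z, leaving the Hamiltonian difference at x and two remainders: Taylor errors
    of order D^2 l, and the error e D of evaluating the effect of the control change at x instead of
    a. With [ua = u] and [z = x] only a quadratic error is left, which gives the gradient of the
    payoff; with a varied [ua] the result is the needle estimate. *)
Lemma adjoint_expansion (R : realType) m k
    (f : dynamics R m k)
    (g : running R m k) (b r c P D lam : R) (l e : R -> R)
    (a z x : R -> 'cV[R]_m) (ua u : R -> 'cV[R]_k) (psi : R -> 'rV[R]_m) :
  regularity_conditions f g -> reg_bounds f g r c l ->
  0 <= b -> 0 <= D -> 0 <= P -> 0 <= lam ->
  solves_on b a (fun t => f t (a t) (ua t)) ->
  solves_on b z (fun t => f t (z t) (u t)) ->
  solves_on b psi (fun t => - (psi t *m df_dx f u x t
                               + lam *: dg_dx g u x t)) ->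
  bdd_meas b r a -> bdd_meas b r z -> bdd_meas b r x ->
  bdd_meas b c ua -> bdd_meas b c u ->
  ae_integrable b e ->
  (forall t : R, 0 <= t <= b -> [/\ 0 <= e t /\ `|psi t| <= P, `|a t - x t| <= D, `|z t - x t| <= D,
     `|f t (a t) (ua t) - f t (a t) (u t) - (f t (x t) (ua t) - f t (x t) (u t))| <= e t * D
   & `|g t (a t) (ua t) - g t (a t) (u t) - (g t (x t) (ua t) - g t (x t) (u t))| <= e t * D]) ->
  `|(psi b *m (a b - z b)) 0 0 - (psi 0 *m (a 0 - z 0)) 0 0
    + lam * (payoff g ua a b - payoff g u z b)
    - \int[mu]_(t in `[0, b]) (hamiltonian f g (x t) t (ua t) lam (psi t)
                              - hamiltonian f g (x t) t (u t) lam (psi t))|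
  <= (m%:R * P + lam) * (2 * m%:R * D ^+ 2 * (\int[mu]_(t in `[0, b]) l t)
                         + D * \int[mu]_(t in `[0, b]) e t).
Proof.
move=> fg hl b0 D0 P0 lam0 ha hz hpsi ba bz bx bua bu ie hyp.
have [df [[cf _] [cg _]] _ _ _] := fg.
have il := rb_int hl b.
have ig (y : R -> 'cV[R]_m) (w : R -> 'cV[R]_k) : bdd_meas b r y -> bdd_meas b c w ->
    ae_integrable b (fun t => g t (y t) (w t)).
  by move=> hy hw; apply: comp_integrableR cg il (rb_g hl) hy hw.
have ih (w : R -> 'cV[R]_k) : bdd_meas b c w ->
    ae_integrable b (fun t => hamiltonian f g (x t) t (w t) lam (psi t)).
  move=> hw; have hP t : 0 <= t <= b -> `|psi t| <= P by move=> tb; have [[]] := hyp t tb.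
  exact: hamiltonian_integrable fg hl hpsi.1 hP bx hw.
have id_ : ae_integrable b (fun t => hamiltonian f g (x t) t (ua t) lam (psi t)
                              - hamiltonian f g (x t) t (u t) lam (psi t)).
  apply: (@ae_integrable_eq _ _ (fun t => hamiltonian f g (x t) t (ua t) lam (psi t)
     + (-1) * hamiltonian f g (x t) t (u t) lam (psi t))).
    by apply: aeW => t _; rewrite mulN1r.
  by apply: ae_integrableD; [exact: ih|apply: ae_integrableZ; exact: ih].
have hy := solves_onB ha hz.
have hq1 := solves_on_entry 0 0 (solves_on_mulmx hpsi hy).
have hq2 := solves_onZ lam (solves_onB (solves_on_primitive b0 (ig _ _ ba bua))
   (solves_on_primitive b0 (ig _ _ bz bu))).
have hQ := solves_onB (solves_onD hq1 hq2) (solves_on_primitive b0 id_).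
have hW := solves_onZ (m%:R * P + lam) (solves_onD
   (solves_onZ (2 * m%:R * D ^+ 2) (solves_on_primitive b0 il))
   (solves_onZ D (solves_on_primitive b0 ie))).
have le_Q : {ae (@lebesgue_measure R), forall t, 0 < t < b ->
   `|(- (psi t *m df_dx f u x t + lam *: dg_dx g u x t)
       *m (a t - z t) + psi t *m (f t (a t) (ua t) - f t (z t) (u t))) 0 0
     + lam *: (g t (a t) (ua t) - g t (z t) (u t) : R^o)
     - (hamiltonian f g (x t) t (ua t) lam (psi t) - hamiltonian f g (x t) t (u t) lam (psi t))|
   <= (m%:R * P + lam) *: (2 * m%:R * D ^+ 2 *: (l t : R^o) + D *: (e t : R^o))}.
  apply: aeW => t /andP[t0 tb].
  have tb' : 0 <= t <= b by rewrite !ltW.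
  have t_ge0 := ltW t0.
  have [[e0 pP] aD zD fe ge] := hyp t tb'.
  have l0 := rb_ge0 hl t_ge0.
  have ar : `|a t| <= r by case: ba => _; exact.
  have zr : `|z t| <= r by case: bz => _; exact.
  have xr : `|x t| <= r by case: bx => _; exact.
  have uc : `|u t| <= c by case: bu => _; exact.
  have yD : `|a t - z t| <= 2 * D.
    have -> : a t - z t = (a t - x t) - (z t - x t) by rewrite opprB addrA subrK.
    by rewrite (le_trans (ler_normB _ _))//; lra.
  (* First part: how the effect of the control change differs between a and x. Second part: the
     Taylor remainder between a and z with the Jacobian taken at x. *)
  pose vf := f t (a t) (ua t) - f t (a t) (u t) - (f t (x t) (ua t) - f t (x t) (u t))
     + (f t (a t) (u t) - f t (z t) (u t) - df_dx f u x t *m (a t - z t)).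
  pose vg := g t (a t) (ua t) - g t (a t) (u t) - (g t (x t) (ua t) - g t (x t) (u t))
     + (g t (a t) (u t) - g t (z t) (u t) - (dg_dx g u x t *m (a t - z t)) 0 0).
  rewrite [X in `|X|](_ : _ = (psi t *m vf) 0 0 + lam * vg); last first.
    rewrite /hamiltonian /vf /vg.
    rewrite mulNmx mulmxDl -scalemxAl -mulmxA !mulmxDr !mulmxN !mulmxDr !mulmxN !mxE.
    rewrite -[_ *: _]/(lam * (g t (a t) (ua t) - g t (z t) (u t))).
    by ring.
  have B : m%:R * l t * D * `|a t - z t| <= 2 * m%:R * D ^+ 2 * l t.
    rewrite [leRHS](_ : _ = m%:R * l t * D * (2 * D)); last by ring.
    by rewrite ler_wpM2l// !mulr_ge0.
  have hvf : `|vf| <= 2 * m%:R * D ^+ 2 * l t + D * e t.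
    rewrite (le_trans (ler_normD _ _))// addrC lerD//; last by rewrite mulrC.
    apply: le_trans B; apply: (@taylor_vector _ _ _ (fun y => f t y (u t)) r) => //.
      by move=> y; have [] := df t y (u t) t_ge0.
    by move=> y y' yr yr'; exact: (rb_lip_jac hl).
  have hvg : `|vg| <= 2 * m%:R * D ^+ 2 * l t + D * e t.
    rewrite (le_trans (ler_normD _ _))// addrC lerD//; last by rewrite mulrC.
    apply: le_trans B; apply: (@taylor_scalar _ _ (fun y => g t y (u t)) r) => //.
      by move=> y; have [] := df t y (u t) t_ge0.
    by move=> y y' yr yr'; exact: (rb_lip_grad hl).
  rewrite -[leRHS]/((m%:R * P + lam) * (2 * m%:R * D ^+ 2 * l t + D * e t)) mulrDl.
  rewrite (le_trans (ler_normD _ _))// lerD//.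
    rewrite (le_trans (le_mx_norm _ _ _))// (le_trans (mx_norm_mul_le _ _))//.
    by rewrite ler_pM// ?mulr_ge0 ?ler_wpM2l.
  by rewrite normrM ger0_norm// ler_wpM2l.
have b00 : 0 <= (0:R) <= b by rewrite lexx b0.
have bb : 0 <= b <= b by rewrite lexx b0.
have lQ : {ae (@lebesgue_measure R), forall t, 0 < t < b -> 
   (- (psi t *m df_dx f u x t + lam *: dg_dx g u x t)
       *m (a t - z t) + psi t *m (f t (a t) (ua t) - f t (z t) (u t))) 0 0
     + lam *: (g t (a t) (ua t) - g t (z t) (u t) : R^o)
     - (hamiltonian f g (x t) t (ua t) lam (psi t) - hamiltonian f g (x t) t (u t) lam (psi t))
   <= (m%:R * P + lam) *: (2 * m%:R * D ^+ 2 *: (l t : R^o) + D *: (e t : R^o))}.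
  by apply: aeS le_Q => t h /h; apply: le_trans; exact: ler_norm.
have lQ' : {ae (@lebesgue_measure R), forall t, 0 < t < b -> 
   - ((- (psi t *m df_dx f u x t + lam *: dg_dx g u x t)
       *m (a t - z t) + psi t *m (f t (a t) (ua t) - f t (z t) (u t))) 0 0
     + lam *: (g t (a t) (ua t) - g t (z t) (u t) : R^o)
     - (hamiltonian f g (x t) t (ua t) lam (psi t) - hamiltonian f g (x t) t (u t) lam (psi t)))
   <= (m%:R * P + lam) *: (2 * m%:R * D ^+ 2 *: (l t : R^o) + D *: (e t : R^o))}.
  by apply: aeS le_Q => t h /h; apply: le_trans; rewrite -normrN; exact: ler_norm.
have h1 := solves_on_le hQ hW lQ (lexx 0) b0 (lexx b).
have h2 := solves_on_le (solves_onN hQ) hW lQ' (lexx 0) b0 (lexx b).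
have sE (p q : R) : p *: (q : R^o) = p * q by [].
rewrite !Rintegral_itv0 !sE in h1 h2.
rewrite ler_norml /payoff; apply/andP; split; lra.
Qed.

Lemma solves_solves_on (R : realType) (V : normedModType R) (b : R) (x v : R -> V) :
  0 <= b -> solves x v -> solves_on b x v.
Proof.
move=> b0 [acx dx]; split; first exact: acx.
by apply: aeS dx => t h /andP[/ltW t0 _]; exact: h.
Qed.

(** Every positive time is interior to some [0, n]; time 0, where [solves_on] says nothing about the
    derivative, is discarded as a null set. *)
Lemma solves_on_solves (R : realType) (V : normedModType R) (x v : R -> V) :
  (forall b, 0 <= b -> solves_on b x v) -> solves x v.
Proof.
move=> h; split; first by move=> b /h[].
have : {ae (@lebesgue_measure R), forall t, forall n : nat, 0 < t < n%:R ->
    is_derive (t : R^o) (1 : R^o) (x : R^o -> V) (v t)}.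
  by apply: ae_foralln => n; have [] := h n%:R (ler0n _ _).
apply: aeS2 (ae_neq 0) => t t0 ht t_ge0.
apply: (ht (Num.trunc t).+1); rewrite truncnS_gt andbT lt_neqAle t_ge0 andbT.
by apply/eqP => E; apply: t0.
Qed.

Lemma admissible_bdd_meas (R : realType) k (U : R -> set 'cV[R]_k) (u : R -> 'cV[R]_k) (b : R) :
  admissible U u -> 0 <= b -> exists2 c, 0 <= c & bdd_meas b c u.
Proof.
move=> [mu_ bu _] b0; have [c c0 hc] := locally_bounded_itv bu b0.
exists c => //; split=> // i.
apply: measurable_funS (measurable_coord i 0 mu_) => //.
by move=> t /=; rewrite !in_itv/= => /andP[->].
Qed.

(** The datum sits at an arbitrary time [t1]: the final time with value 0 for the gradient of the
    payoff, the initial time for the multiplier. *)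
Lemma adjoint_exists (R : realType) m k
    (f : dynamics R m k)
    (g : running R m k) (b r c lam t1 : R) (l : R -> R)
    (x : R -> 'cV[R]_m) (u : R -> 'cV[R]_k) (p : 'rV[R]_m) :
  regularity_conditions f g -> reg_bounds f g r c l ->
  0 <= t1 <= b -> bdd_meas b r x -> bdd_meas b c u ->
  exists psi : R -> 'rV[R]_m,
  [/\ solves_on b psi (fun t => - (psi t *m df_dx f u x t
                               + lam *: dg_dx g u x t)),
      psi t1 = p &
      forall t : R, 0 <= t <= b -> `|psi t| <=
        2 * expR (2 * \int[mu]_(s in `[0, b]) (m%:R * l s))
        * (`|p| + \int[mu]_(s in `[0, b]) (`|lam| * l s))].
Proof.
move=> fg hl t1b [mx xr] [mu_ uc].
have [_ _ [cj _] [cgr _] _] := fg.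
have il := rb_int hl b.
have bnd t (q : 'rV[R]_m) : 0 <= t <= b ->
   `|- (q *m df_dx f u x t + lam *: dg_dx g u x t)|
   <= m%:R * l t * `|q| + `|lam| * l t.
  move=> tb; have t0 : 0 <= t by case/andP: tb.
  rewrite normrN (le_trans (ler_normD _ _))// lerD//.
    rewrite (le_trans (mx_norm_mul_le _ _))// mulrAC ler_wpM2r// ler_wpM2l//.
    by rewrite (rb_jac hl)// ?xr// uc.
  by rewrite normrZ ler_wpM2l// (rb_grad hl)// ?xr// uc.
have [] := @picard R 1 m b t1 p
  (fun t q => - (q *m df_dx f u x t + lam *: dg_dx g u x t))
  (fun t => m%:R * l t) (fun t => (m%:R * `|p|) * l t + `|lam| * l t).
- by [].
- exact: ae_integrableZ.
- by apply: ae_integrableD; exact: ae_integrableZ.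
- apply: aeW => t tb; have t0 : 0 <= t by case/andP: tb.
  have l0 := rb_ge0 hl t0.
  split; first by rewrite mulr_ge0.
    by rewrite (le_trans (bnd t p tb))// mulrAC.
  move=> q q'; rewrite opprK opprD addrACA addNr addr0 addrC -mulmxBl.
  rewrite (le_trans (mx_norm_mul_le _ _))// distrC mulrAC ler_wpM2r//.
  by rewrite ler_wpM2l// (rb_jac hl)// ?xr// uc.
- move=> q mq i j; rewrite ord1.
  apply: (@ae_measurable_eq _ _ (fun t => (-1) * (\sum_j' q t 0 j' * df_dx f u x t j' j + lam * dg_dx g u x t 0 j))).
    by apply: aeW => t _; rewrite mulN1r !mxE.
  apply: ae_measurableM; first by apply: measurable_ae; exact: measurable_cst.
  apply: ae_measurableD.
    apply: ae_measurable_sum => j'; apply: ae_measurableM; first exact: measurable_ae.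
    exact: (regular_ae_measurable cj mx mu_ j' j).
  apply: ae_measurableM; first by apply: measurable_ae; exact: measurable_cst.
  exact: (regular_ae_measurable cgr mx mu_ 0 j).
move=> psi hpsi psi1; exists psi; split => // t tb.
rewrite -psi1.
apply: (gronwall hpsi (ae_integrableZ _ il) (ae_integrableZ _ il)) => //.
apply: aeW => s sb; have s0 : 0 <= s by case/andP: sb.
have l0 := rb_ge0 hl s0.
by split; rewrite ?mulr_ge0//; exact: bnd.
Qed.

(** If v is in the kernel of A(t), then A v solves a linear equation and vanishes at t; Gronwall
    from base time t down to 0 gives v = A(0) v = 0. *)
Lemma fundamental_unit (R : realType) m k
    (f : dynamics R m k)
    (g : running R m k) (b r c : R) (l : R -> R)
    (x : R -> 'cV[R]_m) (u : R -> 'cV[R]_k) (A : R -> 'M[R]_m) :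
  reg_bounds f g r c l -> bdd_meas b r x -> bdd_meas b c u ->
  solves_on b A (fun t => df_dx f u x t *m A t) -> A 0 = 1%:M ->
  forall t : R, 0 <= t <= b -> A t \in unitmx.
Proof.
move=> hl [mx xr] [mu_ uc] hA A0 t tb.
have b0 : 0 <= b by case/andP: tb; exact: le_trans.
rewrite unitmxE unitfE -det_tr; apply/negP => /det0P[v v0 /(congr1 trmx)].
rewrite trmx_mul trmxK trmx0 => Av.
have hy := solves_on_mulmx hA (solves_on_cst b v^T).
have il := ae_integrableZ m%:R (rb_int hl b).
have := gronwall hy il (ae_integrable_cst b 0) _ tb => /(_ _ 0)/wrap[].
  apply: aeW => s sb; have s0 : 0 <= s by case/andP: sb.
  have l0 := rb_ge0 hl s0.
  split => //; first by rewrite mulr_ge0.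
  rewrite mulmx0 addr0 -mulmxA (le_trans (mx_norm_mul_le _ _))// addr0 ler_wpM2r//.
  by rewrite ler_wpM2l// (rb_jac hl)// ?xr// uc.
rewrite lexx b0 => /(_ isT); rewrite Av normr0 Rintegral_cst// mul0r addr0 mulr0.
rewrite A0 mul1mx normr_le0 => /eqP vT0.
by move/eqP: v0; apply; rewrite -(trmxK v) vT0 trmx0.
Qed.

(** The function psi A + lam I has derivative 0, where I is the sensitivity, and I vanishes at time
    0. *)
Lemma adjoint_formula (R : realType) m k
    (f : dynamics R m k)
    (g : running R m k) (b r c lam : R) (l : R -> R)
    (x : R -> 'cV[R]_m) (u : R -> 'cV[R]_k) (A : R -> 'M[R]_m) (psi : R -> 'rV[R]_m) :
  regularity_conditions f g ->
  reg_bounds f g r c l -> bdd_meas b r x -> bdd_meas b c u ->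
  solves_on b A (fun t => df_dx f u x t *m A t) -> A 0 = 1%:M ->
  solves_on b psi (fun t => - (psi t *m df_dx f u x t
                               + lam *: dg_dx g u x t)) ->
  forall t : R, 0 <= t <= b -> psi t *m A t = psi 0 - lam *: sensitivity g u x A t.
Proof.
move=> fg hl bx bu hA A0 hpsi t tb.
have b0 : 0 <= b by case/andP: tb; exact: le_trans.
have [_ _ _ [cgr _] _] := fg.
have il := rb_int hl b.
have [M M0 hM] := abs_cont_bounded hA.1.
have hI : solves_on b (sensitivity g u x A) (fun t => dg_dx g u x t *m A t).
  have -> : sensitivity g u x A = mx_primitive (fun t => dg_dx g u x t *m A t).
    by apply/funext => s; apply/rowP => j; rewrite !mxE.
  apply: (solves_on_mx_primitive b0) => i j; rewrite ord1.
  apply: (@ae_integrable_le _ _ _ (fun t => (m%:R * M) * l t)).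
  - apply: (@ae_measurable_eq _ _ (fun t => \sum_j' dg_dx g u x t 0 j' * A t j' j)).
      by apply: aeW => s _; rewrite mxE.
    apply: ae_measurable_sum => j'; apply: ae_measurableM.
      by apply: (regular_ae_measurable cgr _ _ 0 j'); [case: bx|case: bu].
    apply: measurable_ae; apply: abs_cont_measurable.
    exact: (abs_cont_mxP _ _).1 hA.1 j' j.
  - exact: ae_integrableZ.
  - apply: aeW => s sb; have s0 : 0 <= s by case/andP: sb.
    rewrite (le_trans (le_mx_norm _ _ _))// (le_trans (mx_norm_mul_le _ _))//.
    rewrite [leRHS]mulrAC ler_pM// ?mulr_ge0 ?hM// ler_wpM2l// (rb_grad hl)//.
      by case: bx => _; exact.
    by case: bu => _; exact.
have hd := solves_onD (solves_on_mulmx hpsi hA) (solves_onZ lam hI).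
have b00 : 0 <= (0:R) <= b by rewrite lexx b0.
have := solves_on_norm_le hd (solves_on_cst b (0 : R^o)) _ b00 tb => /(_ _)/wrap[].
  apply: aeW => s _; rewrite mulNmx mulmxDl -mulmxA -scalemxAl opprD.
  by rewrite -addrA -opprD addNr normr0.
rewrite subrr normr0 normr_le0 subr_eq0 => /eqP.
have -> : sensitivity g u x A 0 = 0.
  by apply/matrixP => i j; rewrite !mxE Rintegral_itv0.
by rewrite A0 mulmx1 scaler0 addr0 => <-; rewrite addrK.
Qed.

(** The adjoint state along [X xi] with psi(b) = 0 has psi(0) equal to the sensitivity at b, by
    [adjoint_formula]; then [adjoint_expansion] with equal controls is the claim. The constant
    depends on b, and is later used only to obtain differentiability and continuity for each fixed
    horizon. *)
Lemma quadratic_expansion (R : realType) m k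
    (f : dynamics R m k)
    (g : running R m k) (U : R -> set 'cV[R]_k) (xinit : 'cV[R]_m)
    (u0 : R -> 'cV[R]_k)
    (X : 'cV[R]_m -> R -> 'cV[R]_m) (A : 'cV[R]_m -> R -> 'M[R]_m) (b : R) :
  regularity_conditions f g -> admissible U u0 ->
  (forall xi : 'cV[R]_m, trajectory f (xinit + xi) u0 (X xi)) ->
  (forall xi : 'cV[R]_m, fundamental_matrix f u0 (X xi) (A xi)) ->
  0 <= b ->
  exists2 C, 0 <= C & forall xi xi' : 'cV[R]_m, `|xi| <= 1 -> `|xi'| <= 1 ->
  `|payoff g u0 (X xi') b - payoff g u0 (X xi) b
    - (sensitivity g u0 (X xi) (A xi) b *m (xi' - xi)) 0 0| <= C * `|xi' - xi| ^+ 2.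
Proof.
move=> fg adm hX hA b0.
have [c c0 bu] := admissible_bdd_meas adm b0.
have [l1 [l10 il1 hl1]] := growth_bound c fg.
pose r := 2 * expR (2 * \int[mu]_(s in `[0, b]) l1 s)
            * ((`|xinit| + 1) + \int[mu]_(s in `[0, b]) l1 s).
have b00 : 0 <= (0:R) <= b by rewrite lexx b0.
have bb : 0 <= b <= b by rewrite lexx b0.
have uc : forall t : R, 0 <= t <= b -> `|u0 t| <= c by case: bu.
have sX xi : solves_on b (X xi) (fun t => f t (X xi t) (u0 t)).
  by apply: solves_solves_on => //; case: (hX xi).
have bX xi : `|xi| <= 1 -> bdd_meas b r (X xi).
  move=> xi1; apply: (solves_on_bdd_meas (sX xi)).
  apply: (apriori_bound l10 (il1 b) (sX xi) _ b00).
    by move=> t tb; apply: hl1; [case/andP: tb|exact: uc].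
  by have [_ ->] := hX xi; rewrite (le_trans (ler_normD _ _))// lerD2l.
have [l hl] := reg_boundsP r c fg.
have il := rb_int hl b.
pose K := 2 * expR (2 * \int[mu]_(s in `[0, b]) l s).
have K0 : 0 <= K by rewrite mulr_ge0// expR_ge0.
have lipX xi xi' : `|xi| <= 1 -> `|xi'| <= 1 -> forall t : R, 0 <= t <= b ->
    `|X xi' t - X xi t| <= K * `|xi' - xi|.
  move=> xi1 xi1' t tb.
  have := gronwall (solves_onB (sX xi') (sX xi)) il (ae_integrable_cst b 0) _ b00 tb => /(_ _)/wrap[].
    apply: aeW => s sb; have s0 : 0 <= s by case/andP: sb.
    split => //; first exact: (rb_ge0 hl).
    rewrite addr0 (rb_lip_f hl)//; last exact: uc.
      by case: (bX _ xi1') => _; exact.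
    by case: (bX _ xi1) => _; exact.
  rewrite Rintegral_cst// mul0r addr0.
  by have [_ ->] := hX xi; have [_ ->] := hX xi'; rewrite opprD addrACA subrr add0r.
pose P := 2 * expR (2 * \int[mu]_(s in `[0, b]) (m%:R * l s))
        * (`|0 : 'rV[R]_m| + \int[mu]_(s in `[0, b]) (`|1 : R| * l s)).
have P0 : 0 <= P.
  rewrite !mulr_ge0 ?expR_ge0// addr_ge0//; apply: primitive_ge0 (ae_integrableZ `|1| il) _ bb.
  by apply: aeW => t /andP[/(rb_ge0 hl) ? _]; rewrite mulr_ge0.
pose J := \int[mu]_(s in `[0, b]) l s.
have J0 : 0 <= J.
  by apply: primitive_ge0 il _ bb; apply: aeW => t /andP[/(rb_ge0 hl)].
exists ((m%:R * P + 1) * (2 * m%:R * K ^+ 2 * J)).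
  apply: mulr_ge0; first by apply: addr_ge0 => //; exact: mulr_ge0.
  by rewrite !mulr_ge0 ?exprn_ge0.
move=> xi xi' xi1 xi1'.
have [psi [hpsi psib psiP]] := @adjoint_exists R m k f g b r c 1 b l (X xi) u0 0 fg hl bb (bX _ xi1) bu.
have [sA A0] := hA xi.
have psi0 : psi 0 = sensitivity g u0 (X xi) (A xi) b.
  have := adjoint_formula fg hl (bX _ xi1) bu (solves_solves_on b0 sA) A0 hpsi bb.
  by rewrite psib mul0mx scale1r => /esym/eqP; rewrite subr_eq0 => /eqP.
have := @adjoint_expansion R m k f g b r c P (K * `|xi' - xi|) 1 l (fun=> 0) (X xi') (X xi) (X xi) u0 u0 psi fg hl b0.
move=> /(_ (mulr_ge0 K0 (normr_ge0 _)) P0 ler01 (sX _) (sX _) hpsi (bX _ xi1') (bX _ xi1) (bX _ xi1) bu bu (ae_integrable_cst b 0)).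
move=> /(_ _)/wrap[].
  move=> t tb; split.
  - by split => //; exact: psiP.
  - exact: lipX.
  - by rewrite subrr normr0 mulr_ge0.
  - by rewrite !subrr normr0 mul0r.
  - by rewrite !subrr normr0 mul0r.
rewrite psib mul0mx psi0 mxE sub0r mul1r.
have [_ ->] := hX xi; have [_ ->] := hX xi'.
rewrite opprD addrACA subrr add0r.
have -> : \int[mu]_(t in `[0, b]) (hamiltonian f g (X xi t) t (u0 t) 1 (psi t) -
      hamiltonian f g (X xi t) t (u0 t) 1 (psi t)) = 0.
  under eq_Rintegral do rewrite subrr.
  by rewrite Rintegral_cst// mul0r.
rewrite Rintegral_cst// mul0r mulr0 addr0 subr0 -/J.
rewrite (addrC (- (sensitivity g u0 (X xi) (A xi) b *m (xi' - xi)) 0 0)) => h.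
apply: le_trans h _.
by rewrite exprMn le_eqVlt; apply/orP; left; apply/eqP; ring.
Qed.

(** An expansion at every base point of the segment differentiates s -> G(s xi), to which the mean
    value theorem applies. The constant C disappears from the conclusion, so its growth with the
    horizon is harmless. Strictness of |xi| < 1 leaves room for a two-sided derivative at s = 1. *)
Lemma mean_value_payoff (R : realType) m (G : 'cV[R]_m -> R) (I : 'cV[R]_m -> 'rV[R]_m)
    (C : R) (xi : 'cV[R]_m) :
  (forall x y : 'cV[R]_m, `|x| <= 1 -> `|y| <= 1 ->
     `|G y - G x - (I x *m (y - x)) 0 0| <= C * `|y - x| ^+ 2) ->
  `|xi| < 1 ->
  exists2 s : R, 0 < s < 1 & G xi - G 0 = (I (s *: xi) *m xi) 0 0.
Proof.
move=> hG xi1.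
have C0 : 0 <= `|C| + 1 by rewrite addr_ge0.
have hG' s t : `|s *: xi| <= 1 -> `|t *: xi| <= 1 ->
    `|G (t *: xi) - G (s *: xi) - (t - s) * (I (s *: xi) *m xi) 0 0| <= (`|C| + 1) * (t - s) ^+ 2.
  move=> hs ht; have := hG _ _ hs ht.
  rewrite -scalerBl -scalemxAr mxE => h; apply: le_trans h _.
  rewrite normrZ exprMn mulrCA mulrC -normrX (ger0_norm (sqr_ge0 _)) ler_wpM2r ?sqr_ge0//.
  have : C * `|xi| ^+ 2 <= `|C| * `|xi| ^+ 2.
    by rewrite ler_wpM2r ?exprn_ge0// ler_norm.
  have : `|C| * `|xi| ^+ 2 <= `|C| * 1.
    by rewrite ler_wpM2l// expr_le1// ltW.
  lra.
pose ph s := G (s *: xi).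
have dph (s : R) : 0 <= s <= 1 -> is_derive (s : R^o) (1 : R^o) (ph : R^o -> R^o) ((I (s *: xi) *m xi) 0 0).
  move=> /andP[s0 s1]; set w := (_ *m _) 0 0.
  have hs : `|s *: xi| <= 1 by rewrite normrZ ger0_norm// mulr_ile1// ltW.
  have hc : (fun e : R => e^-1 *: (((ph : R^o -> R^o) \o shift s) (e *: (1 : R^o)) - ph s)) @ 0^' --> (w : R^o).
    apply/cvgrPdist_le => e e0; near=> h.
    have h0 : h != 0 by near: h; exact: nbhs_dnbhs_neq.
    have hh : `|h| <= Num.min (e / (`|C| + 1)) (1 - `|xi|).
      near: h; apply: dnbhs0_le; rewrite !lt_min subr_gt0 xi1 !andbT divr_gt0//.
    move: hh; rewrite !le_min => /andP[h1 h2].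
    rewrite /shift/= -[h%:A]/(h * 1) mulr1 -[_ *: _]/(h^-1 * _).
    have hsh : `|(h + s) *: xi| <= 1.
      rewrite scalerDl (le_trans (ler_normD _ _))// !normrZ (ger0_norm s0).
      have : s * `|xi| <= 1 * `|xi| by rewrite ler_wpM2r.
      have : `|h| * `|xi| <= `|h| * 1 by rewrite ler_wpM2l// ltW.
      lra.
    have := hG' s (h + s) hs hsh; rewrite addrK -/w => hle.
    have hp : 0 < `|h| by rewrite normr_gt0.
    rewrite -(ler_pM2l hp) -normrM mulrBr mulrA divff// mul1r distrC.
    apply: le_trans hle _; rewrite -[h ^+ 2]ger0_norm ?sqr_ge0// normrX expr2 mulrA mulrC.
    rewrite ler_wpM2l//; move: h1; rewrite ler_pdivlMr; last by rewrite ltr_wpDl.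
    by rewrite mulrC.
  have dd : derivable (ph : R^o -> R^o) (s : R^o) (1 : R^o) by apply/cvg_ex; exists w.
  by split => //; apply/cvg_lim.
have [||s sI] := MVT (f := ph) (df := fun s => (I (s *: xi) *m xi) 0 0) ltr01.
- by move=> s; rewrite in_itv/= => /andP[s0 s1]; apply: dph; rewrite !ltW.
- apply: derivable_within_continuous => s; rewrite in_itv/= => hs.
  by have [] := dph s hs.
by rewrite /ph scale1r scale0r subr0 mulr1 => E; exists s.
Unshelve. all: by end_near. Qed.

(** Reach x + h from 0 directly and through x, with h equal to |x| times a basis vector. The three
    expansion errors are at most C|x|^2, 4C|x|^2 and C|x|^2; dividing their sum by |x| bounds one
    entry. *)
Lemma gradient_continuous (R : realType) m (G : 'cV[R]_m -> R) (I : 'cV[R]_m -> 'rV[R]_m)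
    (C : R) : 0 <= C ->
  (forall x y : 'cV[R]_m, `|x| <= 1 -> `|y| <= 1 ->
     `|G y - G x - (I x *m (y - x)) 0 0| <= C * `|y - x| ^+ 2) ->
  forall x : 'cV[R]_m, 2 * `|x| <= 1 -> `|I x - I 0| <= 6 * C * `|x|.
Proof.
move=> C0 hG x x1.
have [->|x0] := eqVneq x 0; first by rewrite subrr !normr0 mulr0.
have xp : 0 < `|x| by rewrite normr_gt0.
apply: mx_norm_le => [|i j]; first by rewrite !mulr_ge0.
rewrite ord1.
pose h : 'cV[R]_m := `|x| *: delta_mx j 0.
have nh : `|h| <= `|x|.
  rewrite normrZ normr_id -[leRHS]mulr1 ler_wpM2l//.
  apply: mx_norm_le => // i' j'; rewrite !mxE; case: (_ && _); rewrite ?normr1 ?normr0//.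
have nxh : `|x + h| <= 2 * `|x| by rewrite (le_trans (ler_normD _ _))//; lra.
have h1 := hG x (x + h) (ltac:(lra)) (le_trans nxh x1).
have h2 := hG 0 (x + h) (ltac:(by rewrite normr0)) (le_trans nxh x1).
have h3 := hG 0 x (ltac:(by rewrite normr0)) (ltac:(lra)).
have xhx : x + h - x = h by rewrite addrAC subrr add0r.
rewrite xhx in h1; rewrite !subr0 in h2 h3.
have e1 : C * `|h| ^+ 2 <= C * `|x| ^+ 2 by rewrite ler_wpM2l// ler_sqr ?nnegrE.
have e2 : C * `|x + h| ^+ 2 <= C * (2 * `|x|) ^+ 2.
  by rewrite ler_wpM2l// ler_sqr ?nnegrE// mulr_ge0.
rewrite mulmxDr mxE in h2.
have E (B : 'rV[R]_m) : (B *m h) 0 0 = `|x| * B 0 j.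
  rewrite -scalemxAr mxE; congr (_ * _); rewrite mxE (bigD1 j)//= big1 ?addr0.
    by rewrite mxE !eqxx mulr1.
  by move=> k kj; rewrite mxE (negbTE kj) mulr0.
rewrite !E in h1 h2.
rewrite -(ler_pM2l xp) -{1}(ger0_norm (ltW xp)) -normrM !mxE mulrBr.
rewrite [leRHS](_ : _ = C * `|x| ^+ 2 + C * (2 * `|x|) ^+ 2 + C * `|x| ^+ 2); last by ring.
move: h1 h2 h3; rewrite !ler_norml => /andP[? ?] /andP[? ?] /andP[? ?].
by apply/andP; split; lra.
Qed.

(** * Needle variations *)

Lemma payoff_solves (R : realType) m k
    (f : dynamics R m k)
    (g : running R m k) (U : R -> set 'cV[R]_k) (xi : 'cV[R]_m)
    (u : R -> 'cV[R]_k) (x : R -> 'cV[R]_m) (b : R) :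
  regularity_conditions f g -> admissible U u -> trajectory f xi u x -> 0 <= b ->
  @solves_on R R^o b (payoff g u x) (fun t => g t (x t) (u t)).
Proof.
move=> fg adm [hx _] b0.
have sx := solves_solves_on b0 hx.
have [c c0 bu] := admissible_bdd_meas adm b0.
have [r r0 hr] := abs_cont_bounded sx.1.
have [l hl] := reg_boundsP r c fg.
have [_ [_ [cg _]] _ _ _] := fg.
apply: solves_on_primitive => //.
exact: comp_integrableR cg (rb_int hl b) (rb_g hl) (solves_on_bdd_meas sx hr) bu.
Qed.

(** Meant for the truncations t -> min(t, b) and t -> max(t, b): they shrink each open interval
    within itself or make it empty, so disjoint families remain disjoint. *)
Lemma abs_cont_comp (R : realType) (V : normedModType R) (b c : R) (h : R -> R)
    (x : R -> V) :
  (forall s t : R, 0 <= s -> s <= t -> t <= c ->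
     [/\ 0 <= h s, h s <= h t, h t <= b, h t - h s <= t - s &
       `]h s, h t[ `<=` `]s, t[]) ->
  abs_cont b x -> abs_cont c (fun t => x (h t)).
Proof.
move=> hh acx e e0; have [d d0 hd] := acx e e0; exists d => // n s t hst tr hs.
apply: (hd n (h \o s) (h \o t)) => /=.
- by move=> i; have [s0 [st tc]] := hst i; have [? ? ? ? _] := hh _ _ s0 st tc.
- apply/trivIsetP => i j _ _ ij; apply/seteqP; split => // y [y1 y2].
  move/trivIsetP : tr => /(_ i j I I ij) <-.
  have [s0 [st tc]] := hst i; have [_ _ _ _ sub] := hh _ _ s0 st tc.
  have [s0' [st' tc']] := hst j; have [_ _ _ _ sub'] := hh _ _ s0' st' tc'.
  by split; [exact: sub|exact: sub'].
- apply: le_lt_trans hs; apply: ler_sum => i _.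
  by have [s0 [st tc]] := hst i; have [_ _ _ ? _] := hh _ _ s0 st tc.
Qed.

Lemma solves_glue (R : realType) (V : normedModType R) (b : R) (x y v w : R -> V) :
  0 <= b -> solves_on b x v -> solves y w -> x b = y b ->
  solves (fun t => if t <= b then x t else y t) (fun t => if t <= b then v t else w t).
Proof.
move=> b0 [acx dx] [acy dy] xy; split.
  move=> c c0.
  (* On either side of b one summand is frozen, so this sum is the glued function; each summand is
     absolutely continuous by truncation of time. *)
  pose z t := x (Num.min t b) + (y (Num.max t b) - y b).
  apply: (@abs_cont_eq _ _ _ z).
    move=> t _; rewrite /z; have [tb|bt] := leP t b.
      by rewrite subrr addr0.
    by rewrite xy addrC subrK.
  have mm : b <= Num.max c b by rewrite le_max lexx orbT.
  apply: abs_contD.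
    apply: (abs_cont_comp (b := b)) => // s t s0 st tc.
    have [sb|bs] := leP s b; have [tb|bt] := leP t b; split => //; try lra;
      by move=> q /=; rewrite !in_itv/= => /andP[? ?]; apply/andP; split; lra.
  have h : abs_cont c (fun t => y (Num.max t b)).
    apply: (abs_cont_comp (b := Num.max c b)); last by apply: acy; exact: le_trans mm.
    move=> s t s0 st tc.
    have tm : Num.max t b <= Num.max c b by rewrite ge_max !le_max tc lexx orbT.
    move: tm; have [sb|bs] := leP s b; have [tb|bt] := leP t b => tm; split => //; try lra;
      by move=> q /=; rewrite !in_itv/= => /andP[? ?]; apply/andP; split; lra.
  apply: (abs_cont_lip _ h (c := 1)) => s t _ _ _.
  by rewrite mul1r opprB addrA subrK.
have [N0 Nb] := (ae_neq (0:R), ae_neq b).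
apply: aeS2 (aeS2 (fun t => @conj _ _) N0 Nb) (aeS2 (fun t => @conj _ _) dx dy).
move=> t [t0 tnb] [dxt dyt] t_ge0.
have t_gt0 : 0 < t by rewrite lt_neqAle t_ge0 andbT; apply/eqP => E; apply: t0.
have [tb|bt] := leP t b.
  have tb' : t < b by rewrite lt_neqAle tb andbT; apply/eqP.
  apply: near_eq_is_derive (dxt _); last by rewrite t_gt0.
  have : nbhs t `]0, b[%classic.
    by apply: open_nbhs_nbhs; split; [exact: interval_open|rewrite /= in_itv/= t_gt0].
  by apply: filterS => s /=; rewrite in_itv/= => /andP[_ /ltW ->].
apply: near_eq_is_derive (dyt t_ge0).
have : nbhs t `]b, t + 1[%classic.
  by apply: open_nbhs_nbhs; split; [exact: interval_open|rewrite /= in_itv/= bt ltrDl ltr01].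
by apply: filterS => s /=; rewrite in_itv/= => /andP[bs _]; rewrite leNgt bs.
Qed.

Definition switch (R : realType) (V : Type) (E : set R) (p u : R -> V) (t : R) : V :=
  if t \in E then p t else u t.

Lemma measurable_switch d (V : measurableType d) (R : realType) (D E : set R) (p u : R -> V) :
  measurable E -> measurable_fun E p -> measurable_fun D u ->
  measurable_fun D (switch E p u).
Proof.
move=> mE mp mu_ mD B mB.
have -> : D `&` switch E p u @^-1` B =
   (D `&` (E `&` p @^-1` B)) `|` ((D `&` u @^-1` B) `\` E).
  apply/seteqP; split => t.
    move=> [Dt]; rewrite /switch/=; case: ifPn => [/set_mem Et Bt|/negP nE Bt].
      by left.
    by right; split => //; move=> Et; apply: nE; exact: mem_set.
  rewrite /switch/=; move=> [[Dt [Et Bt]]|[[Dt Bt] Et]]; split => //=.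
    by rewrite mem_set.
  by rewrite memNset.
apply: measurableU; first by apply: measurableI => //; exact: mp.
by apply: measurableD => //; exact: mu_.
Qed.

Lemma admissible_switch (R : realType) k (U : R -> set 'cV[R]_k) (E : set R)
    (p u : R -> 'cV[R]_k) (c : R) :
  measurable E -> measurable_fun E (p : R -> borel 'cV[R]_k) ->
  (forall t, E t -> U t (p t) /\ `|p t| <= c) ->
  admissible U u -> admissible U (switch E p u).
Proof.
move=> mE mp hp [mu_ bu Uu]; split.
- exact: (@measurable_switch _ (borel 'cV[R]_k)).
- move=> t /bu; rewrite /bounded_near => /pinfty_ex_gt0[M M0 hM].
  near=> N; apply: filterS hM => s; rewrite /switch/= => us.
  have NM : M <= N by near: N; apply: nbhs_pinfty_ge; exact: num_real.
  have Nc : c <= N by near: N; apply: nbhs_pinfty_ge; exact: num_real.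
  case: ifPn => [/set_mem/hp[_ ps]|_]; first exact: le_trans Nc.
  exact: le_trans NM.
- by move=> t t0; rewrite /switch; case: ifPn => [/set_mem/hp[]//|_]; exact: Uu.
Unshelve. all: by end_near. Qed.

Lemma bdd_meas_switch (R : realType) k (E : set R) (p u : R -> 'cV[R]_k) (b c : R) :
  measurable E -> measurable_fun E (p : R -> borel 'cV[R]_k) ->
  (forall t, E t -> `|p t| <= c) ->
  bdd_meas b c u -> bdd_meas b c (switch E p u).
Proof.
move=> mE mp hp [mu_ bu]; split.
  move=> i; have := measurable_switch mE (measurable_coord i 0 mp) (mu_ i).
  by apply: eq_measurable_fun => t _; rewrite /switch; case: ifP.
by move=> t tb; rewrite /switch; case: ifPn => [/set_mem/hp//|_]; exact: bu.
Qed.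

Lemma gronwall_radius (R : realType) (rho J : R) : 0 <= rho -> 0 <= J ->
  rho <= 2 * expR (2 * J) * (rho + J).
Proof.
move=> rho0 J0; have e1 : 1 <= expR (2 * J) by rewrite -expR0 ler_expR mulr_ge0.
have : rho * 1 <= rho * expR (2 * J) by rewrite ler_wpM2l.
have : 0 <= expR (2 * J) * J by rewrite mulr_ge0// expR_ge0.
have : 0 <= expR (2 * J) * rho by rewrite mulr_ge0// expR_ge0.
lra.
Qed.

(** The difference of the payoffs has derivative 0 after b; monotonicity of it and of its negative
    makes it constant there. *)
Lemma payoff_tail (R : realType) m k
    (f : dynamics R m k)
    (g : running R m k) (U : R -> set 'cV[R]_k) (xi xi' : 'cV[R]_m)
    (u u' : R -> 'cV[R]_k) (x x' : R -> 'cV[R]_m) (b T : R) :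
  regularity_conditions f g -> admissible U u -> admissible U u' ->
  trajectory f xi u x -> trajectory f xi' u' x' -> 0 <= b -> b <= T ->
  (forall t, b < t -> u t = u' t /\ x t = x' t) ->
  payoff g u x T - payoff g u' x' T = payoff g u x b - payoff g u' x' b.
Proof.
move=> fg adm adm' hx hx' b0 bT E.
have T0 := le_trans b0 bT.
have s1 := payoff_solves fg adm hx T0; have s2 := payoff_solves fg adm' hx' T0.
have sd := solves_onB s1 s2; have sd' := solves_onB s2 s1.
have h1 := solves_on_nonincr sd (s := b) (s' := T) _ b0 bT (lexx T).
have h2 := solves_on_nonincr sd' (s := b) (s' := T) _ b0 bT (lexx T).
move: h1 => /(_ _)/wrap[].
  by apply: aeW => t /andP[bt _]; have [-> ->] := E t bt; rewrite subrr.
move: h2 => /(_ _)/wrap[].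
  by apply: aeW => t /andP[bt _]; have [-> ->] := E t bt; rewrite subrr.
by move=> *; apply/eqP; rewrite eq_le; apply/andP; split; lra.
Qed.

Lemma ae_integrable_indic (R : realType) (b : R) (E : set R) : measurable E ->
  ae_integrable b (\1_E : R -> R).
Proof.
move=> mE; apply: (@ae_integrable_le _ _ _ (fun=> 1)).
- by apply: measurable_ae; exact: measurable_indic.
- exact: ae_integrable_cst.
- by apply: aeW => t _; rewrite indicE; case: (_ \in _); rewrite ?normr1 ?normr0.
Qed.

Lemma traj_unique (R : realType) m k
    (f : dynamics R m k)
    (g : running R m k) (b t0 c : R)
    (u : R -> 'cV[R]_k) (x y : R -> 'cV[R]_m) :
  regularity_conditions f g -> 0 <= t0 <= b -> bdd_meas b c u ->
  solves_on b x (fun t => f t (x t) (u t)) ->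
  solves_on b y (fun t => f t (y t) (u t)) -> x t0 = y t0 ->
  forall t, 0 <= t <= b -> x t = y t.
Proof.
move=> fg t0b bu hx hy xy t tb.
have [r1 r10 hr1] := abs_cont_bounded hx.1.
have [r2 r20 hr2] := abs_cont_bounded hy.1.
have [l hl] := reg_boundsP (r1 + r2) c fg.
have := gronwall (solves_onB hx hy) (rb_int hl b) (ae_integrable_cst b 0) _ t0b tb => /(_ _)/wrap[].
  apply: aeW => s sb; have s0 : 0 <= s by case/andP: sb.
  split => //; first exact: (rb_ge0 hl).
  rewrite addr0 (rb_lip_f hl)//; last by case: bu => _; exact.
    by rewrite (le_trans (hr1 s sb))// lerDl.
  by rewrite (le_trans (hr2 s sb))// lerDr.
rewrite xy subrr normr0 Rintegral_cst// mul0r addr0 mulr0 normr_le0 subr_eq0.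
by move/eqP.
Qed.

Lemma solves_on_norm_leR (R : realType) (b : R) (F v W w : R -> R) (t : R) :
  @solves_on R R^o b F v -> @solves_on R R^o b W w ->
  {ae (@lebesgue_measure R), forall r, 0 < r < b -> `|v r| <= w r} ->
  0 <= t <= b -> `|F t - F 0| <= W t - W 0.
Proof.
move=> hF hW vw /andP[t0 tb].
have := solves_on_le hF hW _ (lexx 0) t0 tb => /(_ _)/wrap[].
  by apply: aeS vw => r h /h; apply: le_trans; exact: ler_norm.
have := solves_on_le (solves_onN hF) hW _ (lexx 0) t0 tb => /(_ _)/wrap[].
  by apply: aeS vw => r h /h; apply: le_trans; rewrite -normrN ler_norm.
rewrite -[_ - _ in X in X -> _]opprB opprK => h1 h2; rewrite ler_norml; apply/andP; split; lra.
Qed.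

(* [d] is the change of the payoff on [0, b]; after [b] the varied trajectory
   coincides with [X xi], the trajectory of the unvaried control from a
   perturbed initial state. *)
Lemma needle_variation (R : realType) m k
    (f : dynamics R m k)
    (g : running R m k) (U : R -> set 'cV[R]_k) (xinit : 'cV[R]_m)
    (u0 : R -> 'cV[R]_k) (x0 : R -> 'cV[R]_m)
    (X : 'cV[R]_m -> R -> 'cV[R]_m) (b c : R) :
  regularity_conditions f g -> admissible U u0 -> trajectory f xinit u0 x0 ->
  (forall xi : 'cV[R]_m, trajectory f (xinit + xi) u0 (X xi)) ->
  0 <= b -> bdd_meas b c u0 ->
  exists2 l : R -> R, ae_integrable b l & forall (lam : R) (psi : R -> 'rV[R]_m),
  0 <= lam ->
  solves_on b psi (fun t => - (psi t *m df_dx f u0 x0 t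
                               + lam *: dg_dx g u0 x0 t)) ->
  forall M0 eta, 0 <= M0 -> exists2 K : R, 0 <= K &
  forall (E : set R) (p : R -> 'cV[R]_k),
  measurable E -> E `<=` `[0, b] -> measurable_fun E (p : R -> borel 'cV[R]_k) ->
  (forall t, E t -> [/\ U t (p t), `|p t| <= c, l t <= M0 &
     eta <= hamiltonian f g (x0 t) t (p t) lam (psi t)
            - hamiltonian f g (x0 t) t (u0 t) lam (psi t)]) ->
  let eps := \int[mu]_(t in `[0, b]) \1_E t in
  exists (u : R -> 'cV[R]_k) (x : R -> 'cV[R]_m) (xi : 'cV[R]_m) (d : R),
  [/\ admissible U u, trajectory f xinit u x,
     `|xi| <= K * eps /\ `|d| <= K * eps,
     (forall T, b <= T -> payoff g u x T - payoff g u0 (X xi) T = d) &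
     eta * eps - K * eps ^+ 2 <= lam * d + (psi 0 *m xi) 0 0].
Proof.
move=> fg adm hx0 hX b0 bu.
have b00 : 0 <= (0:R) <= b by rewrite lexx b0.
have bb : 0 <= b <= b by rewrite lexx b0.
have [l1 [l10 il1 hl1]] := growth_bound c fg.
pose J1 := \int[mu]_(s in `[0, b]) l1 s.
have J10 : 0 <= J1.
  by apply: primitive_ge0 (il1 b) _ bb; apply: aeW => t /andP[/l10].
pose F rho := 2 * expR (2 * J1) * (rho + J1).
have F0 rho : 0 <= rho -> 0 <= F rho.
  by move=> rho0; rewrite /F !mulr_ge0 ?expR_ge0 ?addr_ge0.
have Fle rho : 0 <= rho -> rho <= F rho by move=> rho0; exact: gronwall_radius.
(* [r1] bounds trajectories starting from [xinit], [r2] those that pass at time b through a state of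
   size [r1]; r dominates both. *)
pose r1 := F `|xinit|; pose r2 := F r1; pose r := F r2.
have r10 : 0 <= r1 by exact: F0.
have r20 : 0 <= r2 by exact: F0.
have r1r2 : r1 <= r2 by exact: Fle.
have r2r : r2 <= r by exact: Fle.
have bound (w : R -> 'cV[R]_k) (y : R -> 'cV[R]_m) t0 rho : bdd_meas b c w ->
    solves_on b y (fun t => f t (y t) (w t)) -> 0 <= t0 <= b -> `|y t0| <= rho ->
    forall t : R, 0 <= t <= b -> `|y t| <= F rho.
  move=> [_ wc] hy t0b yr; apply: (apriori_bound l10 (il1 b) hy) t0b yr => t tb.
  by apply: hl1; [case/andP: tb|exact: wc].
have [l hl] := reg_boundsP r c fg.
have il := rb_int hl b.
(* The bound l is fixed before [M0]: the needle is then confined to times with l <= [M0], so that an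
   integral over it is at most [M0] eps instead of merely tending to 0. *)
exists l => // lam psi lam0 hpsi M0 eta M00.
have [P P0 hP] := abs_cont_bounded hpsi.1.
pose J := \int[mu]_(s in `[0, b]) l s.
have J0 : 0 <= J by apply: primitive_ge0 il _ bb; apply: aeW => t /andP[/(rb_ge0 hl)].
pose G := 2 * expR (2 * J).
have G0 : 0 <= G by rewrite mulr_ge0// expR_ge0.
have G1 : 1 <= G.
  have := gronwall_radius ler01 J0; have : 1 <= expR (2 * J) by rewrite -expR0 ler_expR mulr_ge0.
  by rewrite /G; lra.
(* In units of eps, [K1] bounds [xE - x0] by Gronwall, [K2] bounds [z - x0] by a second Gronwall
   step backwards from b, and [K3] bounds d; [K4] is the quadratic error of [adjoint_expansion]. *)
pose K1 := G * (2 * M0).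
have K10 : 0 <= K1 by rewrite !mulr_ge0.
pose K2 := G * K1.
have K20 : 0 <= K2 by rewrite mulr_ge0.
have K12 : K1 <= K2 by rewrite /K2 ler_peMl.
pose K3 := 2 * K2 * J + 2 * M0.
have K30 : 0 <= K3 by rewrite addr_ge0 ?mulr_ge0.
pose K4 := (m%:R * P + lam) * (2 * m%:R * K2 ^+ 2 * J + K2 * (2 * M0)).
have K40 : 0 <= K4 by rewrite mulr_ge0 ?addr_ge0 ?mulr_ge0 ?exprn_ge0.
exists (K2 + K3 + K4); first by rewrite addr_ge0// addr_ge0.
move=> E p mE Eb mp hp eps.
have iE := ae_integrable_indic b mE.
have E0 (t : R) : 0 <= (\1_E t : R) by rewrite indicE.
have eps0 : 0 <= eps by apply: primitive_ge0 iE _ bb; apply: aeW.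
pose u := switch E p u0.
have hpU t : E t -> U t (p t) /\ `|p t| <= c by move=> /hp[].
have admu : admissible U u by exact: admissible_switch hpU adm.
have bdu : bdd_meas b c u by apply: bdd_meas_switch => // t /hp[].
have uE t : E t -> u t = p t by move=> Et; rewrite /u /switch mem_set.
have unE t : ~ E t -> u t = u0 t by move=> Et; rewrite /u /switch memNset.
have [xE hxE xE0] := traj_exists xinit fg b00 bdu.
have [z hz zb] := traj_exists (xE b) fg bb bu.
pose xi := z 0 - xinit.
have sX : solves_on b (X xi) (fun t => f t (X xi t) (u0 t)).
  by apply: solves_solves_on => //; case: (hX xi).
have X0 : X xi 0 = z 0 by have [_ ->] := hX xi; rewrite /xi addrC subrK.
have Xz t : 0 <= t <= b -> X xi t = z t by exact: (traj_unique fg b00 bu sX hz X0).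
have sx0 : solves_on b x0 (fun t => f t (x0 t) (u0 t)).
  by apply: solves_solves_on => //; case: hx0.
have x00 : x0 0 = xinit by case: hx0.
have xE_r1 t : 0 <= t <= b -> `|xE t| <= r1.
  by apply: (bound u xE 0) => //; rewrite xE0.
have x0_r1 t : 0 <= t <= b -> `|x0 t| <= r1.
  by apply: (bound u0 x0 0) => //; rewrite x00.
have z_r2 t : 0 <= t <= b -> `|z t| <= r2.
  by apply: (bound u0 z b) => //; rewrite zb; exact: xE_r1.
have xE_r t : 0 <= t <= b -> `|xE t| <= r.
  by move=> tb; rewrite (le_trans (xE_r1 t tb))// (le_trans r1r2).
have x0_r t : 0 <= t <= b -> `|x0 t| <= r.
  by move=> tb; rewrite (le_trans (x0_r1 t tb))// (le_trans r1r2).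
have z_r t : 0 <= t <= b -> `|z t| <= r.
  by move=> tb; rewrite (le_trans (z_r2 t tb)).
have uc t : 0 <= t <= b -> `|u t| <= c by case: bdu => _; exact.
have u0c t : 0 <= t <= b -> `|u0 t| <= c by case: bu => _; exact.
have ih : ae_integrable b (fun t => 2 * M0 * \1_E t) by exact: ae_integrableZ.
have ihE : \int[mu]_(t in `[0, b]) (2 * M0 * \1_E t) = 2 * M0 * eps.
  have [q iq hq] := iE.
  rewrite (@ae_eq_Rintegral _ _ _ (fun t => 2 * M0 * q t)); last first.
    by apply: aeS hq => t h; rewrite /= in_itv/= => /h ->.
  rewrite RintegralZl//; congr (_ * _); apply/esym/ae_eq_Rintegral.
  by apply: aeS hq => t h; rewrite /= in_itv/= => /h ->.
have fdiff t (y : 'cV[R]_m) : 0 <= t <= b -> `|y| <= r ->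
    `|f t y (u t) - f t y (u0 t)| <= 2 * M0 * \1_E t.
  move=> tb yr; have t0 : 0 <= t by case/andP: tb.
  have [Et|Et] := pselect (E t); last first.
    by rewrite unE// subrr normr0 mulr_ge0// mulr_ge0.
  rewrite indicE mem_set// mulr1 (le_trans (ler_normB _ _))//.
  have [_ _ lM _] := hp t Et.
  have h1 := rb_f hl t0 yr (uc t tb); have h2 := rb_f hl t0 yr (u0c t tb).
  by apply: le_trans (lerD h1 h2) _; lra.
have gdiff t (y : 'cV[R]_m) : 0 <= t <= b -> `|y| <= r ->
    `|g t y (u t) - g t y (u0 t)| <= 2 * M0 * \1_E t.
  move=> tb yr; have t0 : 0 <= t by case/andP: tb.
  have [Et|Et] := pselect (E t); last first.
    by rewrite unE// subrr normr0 mulr_ge0// mulr_ge0.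
  rewrite indicE mem_set// mulr1 (le_trans (ler_normB _ _))//.
  have [_ _ lM _] := hp t Et.
  have h1 := rb_g hl t0 yr (uc t tb); have h2 := rb_g hl t0 yr (u0c t tb).
  by apply: le_trans (lerD h1 h2) _; lra.
have d1 t : 0 <= t <= b -> `|xE t - x0 t| <= K1 * eps.
  move=> tb; have := gronwall (solves_onB hxE sx0) il ih _ b00 tb => /(_ _)/wrap[].
    apply: aeW => s sb; have s0 : 0 <= s by case/andP: sb.
    split; [exact: (rb_ge0 hl)|by rewrite !mulr_ge0|].
    have -> : f s (xE s) (u s) - f s (x0 s) (u0 s) =
      (f s (xE s) (u s) - f s (x0 s) (u s)) + (f s (x0 s) (u s) - f s (x0 s) (u0 s)).
      by rewrite addrA subrK.
    rewrite (le_trans (ler_normD _ _))// lerD//.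
      by apply: (rb_lip_f hl) => //; [exact: xE_r|exact: x0_r|exact: uc].
    by apply: fdiff => //; exact: x0_r.
  by rewrite xE0 x00 subrr normr0 add0r ihE mulrA.
have d2 t : 0 <= t <= b -> `|z t - x0 t| <= K2 * eps.
  move=> tb; have := gronwall (solves_onB hz sx0) il (ae_integrable_cst b 0) _ bb tb => /(_ _)/wrap[].
    apply: aeW => s sb; have s0 : 0 <= s by case/andP: sb.
    split; [exact: (rb_ge0 hl)|by []|].
    by rewrite addr0; apply: (rb_lip_f hl) => //; [exact: z_r|exact: x0_r|exact: u0c].
  rewrite Rintegral_cst// mul0r addr0 zb => h; rewrite (le_trans h)//.
  rewrite -[leRHS]mulrA; apply: ler_wpM2l => //; exact: d1.
have d1' t : 0 <= t <= b -> `|xE t - x0 t| <= K2 * eps.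
  by move=> tb; rewrite (le_trans (d1 t tb))// ler_wpM2r.
pose x t := if t <= b then xE t else X xi t.
have hx : trajectory f xinit u x.
  split; last by rewrite /x b0.
  have /(_ _)/wrap[] := solves_glue b0 hxE (hX xi).1.
    by rewrite Xz.
  move=> [acx dx]; split => //; apply: aeS dx => t h t0; have := h t0.
  congr is_derive; rewrite /x; case: ifPn => // tb; rewrite unE// => /Eb /=.
  by rewrite in_itv/= (negbTE tb) andbF.
pose d := payoff g u xE b - payoff g u0 z b.
have dE T : b <= T -> payoff g u x T - payoff g u0 (X xi) T = d.
  move=> bT; rewrite (payoff_tail fg admu adm hx (hX xi) b0 bT); last first.
    move=> t bt; rewrite /x leNgt bt; split => //; apply: unE => /Eb /=.
    by rewrite in_itv/= [t <= b]leNgt bt andbF.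
  by congr (_ - _); apply: eq_Rintegral => t; rewrite inE/= in_itv/= => /andP[t0 tb];
    rewrite ?/x ?tb ?Xz// t0.
have [_ [_ [cg _]] _ _ _] := fg.
have bxE : bdd_meas b r xE by exact: solves_on_bdd_meas hxE xE_r.
have bz : bdd_meas b r z by exact: solves_on_bdd_meas hz z_r.
have bx0 : bdd_meas b r x0 by exact: solves_on_bdd_meas sx0 x0_r.
have hd : `|d| <= K3 * eps.
  have i1 := comp_integrableR cg il (rb_g hl) bxE bdu.
  have i2 := comp_integrableR cg il (rb_g hl) bz bu.
  have sd := solves_onB (solves_on_primitive b0 i1) (solves_on_primitive b0 i2).
  have sW := solves_onD (solves_onZ (2 * K2 * eps) (solves_on_primitive b0 il))
    (solves_on_primitive b0 ih).
  have := solves_on_norm_leR sd sW _ bb => /(_ _)/wrap[].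
    apply: aeW => s /andP[s0 sb]; have sb' : 0 <= s <= b by rewrite !ltW.
    have -> : g s (xE s) (u s) - g s (z s) (u0 s) =
      (g s (xE s) (u s) - g s (xE s) (u0 s)) + (g s (xE s) (u0 s) - g s (z s) (u0 s)).
      by rewrite addrA subrK.
    rewrite (le_trans (ler_normD _ _))// addrC lerD//; last by rewrite gdiff// xE_r.
    have := rb_lip_g hl (ltW s0) (xE_r s sb') (z_r s sb') (u0c s sb').
    move=> h; apply: le_trans h _; rewrite -[leRHS]/(2 * K2 * eps * l s) mulrC.
    have ls := rb_ge0 hl (ltW s0); rewrite ler_wpM2r//.
    have -> : xE s - z s = (xE s - x0 s) - (z s - x0 s) by rewrite opprB addrA subrK.
    by rewrite (le_trans (ler_normB _ _))//; have := d1' s sb'; have := d2 s sb'; lra.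
  have sE (q1 q2 : R) : q1 *: (q2 : R^o) = q1 * q2 by [].
  rewrite /= !Rintegral_itv0 !sE mulr0 addr0 !subr0 ihE => h.
  rewrite (le_trans h)// /K3 -/J le_eqVlt; apply/orP; left; apply/eqP; ring.
have hxi : `|xi| <= K2 * eps.
  by rewrite /xi -x00 d2.
have Ke : K2 * eps <= (K2 + K3 + K4) * eps by rewrite ler_wpM2r//; lra.
have Ke3 : K3 * eps <= (K2 + K3 + K4) * eps by rewrite ler_wpM2r//; lra.
have Ke4 : K4 * eps ^+ 2 <= (K2 + K3 + K4) * eps ^+ 2 by rewrite ler_wpM2r ?sqr_ge0//; lra.
exists u, x, xi, d; split => //.
  by split; [exact: le_trans Ke|exact: le_trans Ke3].
(* The controls differ only on E, where both Lipschitz constants are at most [M0]; thus e is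
   [2 * M0] times the indicator of E. Its integral is of order eps and D is of order eps, so the
   error is of order eps^2. *)
have := @adjoint_expansion R m k f g b r c P (K2 * eps) lam l (fun t => 2 * M0 * \1_E t)
  xE z x0 u u0 psi fg hl b0 (mulr_ge0 K20 eps0) P0 lam0 hxE hz hpsi bxE bz bx0 bdu bu ih.
move=> /(_ _)/wrap[].
  move=> t tb; have t0 : 0 <= t by case/andP: tb.
  have l0 := rb_ge0 hl t0.
  have rr (q1 q2 q3 q4 : R) : 0 <= K2 * eps -> E t -> `|q1| <= l t * (K2 * eps) -> `|q2| <= l t * (K2 * eps) ->
      `|q1 - q2| <= 2 * M0 * (K2 * eps).
    move=> Kp Et h1 h2; have [_ _ lM _] := hp t Et.
    rewrite (le_trans (ler_normB _ _))// (le_trans (lerD h1 h2))//.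
    have : l t * (K2 * eps) <= M0 * (K2 * eps) by rewrite ler_wpM2r.
    lra.
  have e0 : 0 <= 2 * M0 * \1_E t * (K2 * eps) by rewrite !mulr_ge0.
  split.
  - by split; [rewrite !mulr_ge0|exact: hP].
  - exact: d1'.
  - exact: d2.
  - have [Et|Et] := pselect (E t); last by rewrite unE// !subrr normr0.
    have -> : f t (xE t) (u t) - f t (xE t) (u0 t) - (f t (x0 t) (u t) - f t (x0 t) (u0 t))
      = (f t (xE t) (u t) - f t (x0 t) (u t)) - (f t (xE t) (u0 t) - f t (x0 t) (u0 t)).
      by rewrite !opprB addrACA [RHS]addrACA; congr (_ + _); rewrite addrC.
    rewrite indicE mem_set// mulr1 (le_trans (ler_normB _ _))//.
    have h1 := rb_lip_f hl t0 (xE_r t tb) (x0_r t tb) (uc t tb).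
    have h2 := rb_lip_f hl t0 (xE_r t tb) (x0_r t tb) (u0c t tb).
    have [_ _ lM _] := hp t Et.
    have h3 : l t * `|xE t - x0 t| <= M0 * (K2 * eps) by rewrite ler_pM// d1'.
    by rewrite (le_trans (lerD h1 h2))//; lra.
  - have [Et|Et] := pselect (E t); last by rewrite unE// !subrr normr0.
    have -> : g t (xE t) (u t) - g t (xE t) (u0 t) - (g t (x0 t) (u t) - g t (x0 t) (u0 t))
      = (g t (xE t) (u t) - g t (x0 t) (u t)) - (g t (xE t) (u0 t) - g t (x0 t) (u0 t)).
      by ring.
    rewrite indicE mem_set// mulr1 (le_trans (ler_normB _ _))//.
    have h1 := rb_lip_g hl t0 (xE_r t tb) (x0_r t tb) (uc t tb).
    have h2 := rb_lip_g hl t0 (xE_r t tb) (x0_r t tb) (u0c t tb).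
    have [_ _ lM _] := hp t Et.
    have h3 : l t * `|xE t - x0 t| <= M0 * (K2 * eps) by rewrite ler_pM// d1'.
    by rewrite (le_trans (lerD h1 h2))//; lra.
rewrite zb subrr mulmx0 xE0 mxE sub0r -/d ihE.
set S := \int[mu]_(t in _) _ => hS.
have eS : eta * eps <= S.
  have i1 := hamiltonian_integrable lam fg hl hpsi.1 hP bx0 bdu.
  have i2 := hamiltonian_integrable lam fg hl hpsi.1 hP bx0 bu.
  have i3 : ae_integrable b (fun t => hamiltonian f g (x0 t) t (u t) lam (psi t)
     - hamiltonian f g (x0 t) t (u0 t) lam (psi t)).
    apply: ae_integrable_eq (ae_integrableD i1 (ae_integrableZ (-1) i2)).
    by apply: aeW => t _; rewrite mulN1r.
  have := solves_on_le (solves_onZ eta (solves_on_primitive b0 iE)) (solves_on_primitive b0 i3)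
    _ (lexx 0) b0 (lexx b) => /(_ _)/wrap[].
    apply: aeW => t /andP[t0 tb]; rewrite -[leLHS]/(eta * \1_E t).
    have [Et|Et] := pselect (E t).
      by rewrite indicE mem_set// mulr1 uE//; have [] := hp t Et.
    by rewrite indicE memNset// mulr0 unE// subrr.
  have sE (q1 q2 : R) : q1 *: (q2 : R^o) = q1 * q2 by [].
  by rewrite /= !Rintegral_itv0 !sE mulr0 !subr0.
have E1 : (psi 0 *m xi) 0 0 = - (psi 0 *m (xinit - z 0)) 0 0.
  by rewrite /xi -opprB mulmxN mxE.
rewrite E1.
have hK4 : (m%:R * P + lam) * (2 * m%:R * (K2 * eps) ^+ 2 * (\int[mu]_(t in `[0, b]) l t)
    + K2 * eps * (2 * M0 * eps)) = K4 * eps ^+ 2.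
  by rewrite /K4 -/J; ring.
rewrite hK4 in hS.
move: hS; rewrite ler_norml => /andP[h1 h2].
by move: eS Ke4 h1; lra.
Qed.

(** * Measurable selection *)

Lemma le_mu (R : realType) (A B : set R) : measurable A -> measurable B ->
  A `<=` B -> (mu A <= mu B)%E.
Proof. by move=> mA mB AB; apply: le_measure; rewrite ?inE. Qed.

(* Closedness of [H] in the product of [Z] with the Baire space [nat -> nat]. *)
Definition baire_closed (Z : topologicalType) (H : Z -> (nat -> nat) -> Prop) : Prop :=
  forall z s, (forall V n, nbhs z V ->
    exists z' s', [/\ V z', (forall i, (i < n)%N -> s' i = s i) & H z' s']) -> H z s.

(** The Suslin, or analytic, sets, as projections of closed sets along the Baire space. *)
Definition souslin (Z : topologicalType) (G : set Z) : Prop :=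
  exists2 H, baire_closed H & G = [set z | exists s, H z s].

Lemma souslin_closed (Z : topologicalType) (G : set Z) : closed G -> souslin G.
Proof.
move=> cG; exists (fun z _ => G z); last first.
  by apply/seteqP; split => z; [move=> Gz; exists (fun=> 0%N)|case].
move=> z s h; apply: cG => V /(h _ 0%N)[z' [s' [Vz' _ Gz']]].
by exists z'.
Qed.

(** The first term of the sequence selects the index n, and the shifted sequence is the witness for
    it. *)
Lemma souslin_bigcup (Z : topologicalType) (G : nat -> set Z) :
  (forall n, souslin (G n)) -> souslin (\bigcup_n G n).
Proof.
move=> sG.
have /choice[H hH] : forall n, exists H, baire_closed H /\ G n = [set z | exists s, H z s].
  by move=> n; have [H ? ?] := sG n; exists H.
exists (fun z s => H (s 0%N) z (fun i => s i.+1)).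
  move=> z s h; have [cH _] := hH (s 0%N); apply: cH => V n Vz.
  have [z' [s' [Vz' ss' Hz']]] := h V n.+1 Vz.
  exists z', (fun i => s' i.+1); split => //; last by rewrite -ss'.
  by move=> i iin; exact: ss'.
apply/seteqP; split => z.
  move=> [n _]; have [_ ->] := hH n => -[s Hs].
  by exists (fun i => if i is i'.+1 then s i' else n).
move=> [s Hs]; exists (s 0%N) => //; have [_ ->] := hH (s 0%N).
by exists (fun i => s i.+1).
Qed.

(** One sequence interleaves the witnesses for all j through a coding of pairs. An initial segment
    of the j-th witness is determined by a sufficiently long one of the whole sequence, which keeps
    the relation closed. *)
Lemma souslin_bigcap (Z : topologicalType) (G : nat -> set Z) :
  (forall n, souslin (G n)) -> souslin (\bigcap_n G n).
Proof.
move=> sG.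
have /choice[H hH] : forall n, exists H, baire_closed H /\ G n = [set z | exists s, H z s].
  by move=> n; have [H ? ?] := sG n; exists H.
exists (fun z s => forall j, H j z (fun i => s (pickle (j, i)))).
  move=> z s h j; have [cH _] := hH j; apply: cH => V n Vz.
  pose N := (\max_(i < n) (pickle (j, i : nat)).+1)%N.
  have [z' [s' [Vz' ss' Hz']]] := h V N Vz.
  exists z', (fun i => s' (pickle (j, i))); split => // i iin.
  by apply: ss'; exact: (@leq_bigmax _ (fun i : 'I_n => (pickle (j, i : nat)).+1) (Ordinal iin)).
apply/seteqP; split => z.
  move=> hz; have /choice[s hs] : forall n, exists s, H n z s.
    by move=> n; have := hz n I; have [_ ->] := hH n.
  exists (fun q => if unpickle q is Some (j, i) then s j i else 0%N) => j.
  rewrite (_ : (fun i => _) = s j)//.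
  by apply/funext => i; rewrite pickleK.
move=> [s Hs] n _; have [_ ->] := hH n.
by exists (fun i => s (pickle (n, i))).
Qed.

(** The points whose ball of radius 1/(n+1) is contained in G form a closed set, and G is the union
    of these sets. *)
Lemma souslin_open (R : realType) (Z : normedModType R) (G : set Z) : open G -> souslin G.
Proof.
move=> oG.
have -> : G = \bigcup_n [set z | forall y, `|z - y| < n.+1%:R^-1 -> G y].
  apply/seteqP; split => z.
    move=> Gz; have /nbhs_ballP[e /= e0 he] : nbhs z G by exact: open_nbhs_nbhs.
    have [n hn] : exists n : nat, n.+1%:R^-1 < e.
      by have [n _ hn] := near_infty_natSinv_lt (PosNum e0); exists n; apply: (hn n) => /=.
    exists n => // y zy; apply: he; rewrite -ball_normE/=; exact: lt_trans hn.
  by move=> [n _]; apply; rewrite subrr normr0 invr_gt0.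
apply: souslin_bigcup => n; apply: souslin_closed => z hz y zy.
pose e := n.+1%:R^-1 - `|z - y|.
have e0 : 0 < e by rewrite subr_gt0.
have [w [hw zw]] := hz _ (nbhsx_ballx z e e0).
apply: hw; move: zw; rewrite -ball_normE/= distrC => zw.
have -> : w - y = (w - z) + (z - y) by rewrite addrA subrK.
by rewrite (le_lt_trans (ler_normD _ _))// -ltrBrDr.
Qed.

(** Suslin sets are not stable under complements, so the induction runs over the sets that are
    Suslin together with their complement; these form a sigma-algebra. *)
Lemma souslin_borel (R : realType) (Z : normedModType R) (G : set Z) :
  measurable (G : set (borel Z)) -> souslin G.
Proof.
move=> mG.
pose S : set (set Z) := [set G | souslin G /\ souslin (~` G)].
suff : S G by case.
apply: (smallest_sub _ _ mG) => [|V oV]; last first.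
  by split; [exact: souslin_open|apply: souslin_closed; exact: open_closedC].
split.
- split; first exact: souslin_closed closed0.
  by rewrite setC0; exact: souslin_closed closedT.
- by move=> V [s1 s2]; rewrite setTD; split => //; rewrite setCK.
- move=> F hF; split; first by apply: souslin_bigcup => n; case: (hF n).
  by rewrite setC_bigcup; apply: souslin_bigcap => n; case: (hF n).
Qed.

(** The outer Lebesgue measure of S exceeds c; phrased by measurable covers, because S will be a
    projection not known to be measurable. *)
Definition outer_gt (R : realType) (c : R) (S : set R) : Prop :=
  ~ exists A : set R, [/\ measurable A, S `<=` A & (mu A <= c%:E)%E].

(** Continuity from below of the outer measure. If every S n had a cover A n of measure at most c,
    the intersections of A m over m >= n would be increasing covers of S n, and their union would
    cover everything with measure at most c. *)
Lemma outer_gt_bigcup (R : realType) (c : R) (S : nat -> set R) :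
  (forall m n, (m <= n)%N -> S m `<=` S n) ->
  outer_gt c (\bigcup_n S n) -> exists n, outer_gt c (S n).
Proof.
move=> ndS hS; apply: contrapT => /forallNP h; apply: hS.
have /choice[A hA] : forall n, exists A : set R, [/\ measurable A, S n `<=` A & (mu A <= c%:E)%E].
  by move=> n; apply: contrapT; exact: h.
pose B n := \bigcap_(m in [set m | (n <= m)%N]) A m.
have mB n : measurable (B n) by apply: bigcap_measurable => [|m _]; [exists n => /=|case: (hA m)].
have ndB : nondecreasing_seq B.
  move=> m n mn; apply/subsetPset => t hB k /= nk; apply: hB => /=; exact: leq_trans nk.
exists (\bigcup_n B n); split.
- exact: bigcup_measurable.
- by move=> t [n _ St]; exists n => // k /= nk; case: (hA k) => _ + _; apply; exact: ndS St.
- have cB := @nondecreasing_cvg_mu _ _ _ (@lebesgue_measure R) B mB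
    (bigcup_measurable (fun n _ => mB n)) ndB.
  have <- : limn (mu \o B) = mu (\bigcup_n B n) by exact: cvg_lim cB.
  apply: lime_le; first by apply/cvg_ex; eexists; exact: cB.
  apply: nearW => n; case: (hA n) => mA _; apply: le_trans.
  by apply: le_mu => // t; apply => /=.
Qed.

Lemma outer_gt_exists (R : realType) (S : set R) :
  ~ (@lebesgue_measure R).-negligible S -> exists2 c : R, 0 < c & outer_gt c S.
Proof.
move=> nS; apply: contrapT => h; apply: nS.
have /choice[A hA] : forall n : nat, exists A : set R,
    [/\ measurable A, S `<=` A & (mu A <= (n.+1%:R^-1)%:E)%E].
  move=> n; apply: contrapT => hn; apply: h; exists (n.+1%:R^-1) => //.
exists (\bigcap_n A n); split.
- by apply: bigcap_measurable => // n _; case: (hA n).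
- apply/eqP; rewrite eq_le measure_ge0 andbT.
  apply/lee_addgt0Pr => e e0; rewrite add0e.
  have [n hn] : exists n : nat, n.+1%:R^-1 < e.
    by have [n _ hn] := near_infty_natSinv_lt (PosNum e0); exists n; apply: (hn n) => /=.
  have [mA _ An] := hA n.
  apply: (@le_trans _ _ (n.+1%:R^-1)%:E); last by rewrite lee_fin ltW.
  apply: le_trans An; apply: le_mu => //.
  + by apply: bigcap_measurable => // k _; case: (hA k).
  + by move=> t; apply.
- by move=> t St n _; case: (hA n) => _ + _; apply.
Qed.

(** Along an ultrafilter the points converge in the compact set B, and each bounded coordinate of
    the sequences is constant on a member of the filter. Finitely many coordinates at a time are
    enough for closedness of H to reach the limit. *)
Lemma baire_ultra (I : Type) (F : set_system I) (Z : topologicalType)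
    (H : Z -> (nat -> nat) -> Prop) (B : set Z)
    (m : nat -> nat) (z : I -> Z) (s : I -> nat -> nat) :
  UltraFilter F -> baire_closed H -> compact B -> F [set n | B (z n)] ->
  F [set n | H (z n) (s n)] -> (forall i, F [set n | (s n i <= m i)%N]) ->
  exists2 z' : Z, exists s', H z' s' /\ (forall i, (s' i <= m i)%N)
    & forall V, nbhs z' V -> F [set n | V (z n)].
Proof.
move=> FU cH cB Bz Hz sm.
have PF : ProperFilter F by exact: ultra_proper.
have [z' [Bz' cz']] : B `&` cluster (z @ F) !=set0 by apply: (cB (z @ F)).
have zz' V : nbhs z' V -> F [set k | V (z k)].
  move=> Vz'; have [//|Fv] := in_ultra_setVsetC [set k | V (z k)] FU.
  by have [w [? ?]] := cz' (~` V) V Fv Vz'.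
have /choice[s' hs'] : forall i, exists v, (v <= m i)%N /\ F [set n | s n i = v].
  move=> i; apply: contrapT => /forallNP h.
  have h' : forall v : 'I_(m i).+1, F (~` [set n | s n i = v]).
    move=> v; have [Fv|//] := in_ultra_setVsetC [set n | s n i = v] FU.
    by exfalso; apply: (h v); split => //; rewrite -ltnS.
  have hF : F (fun n => forall v : 'I_(m i).+1, (~` [set n | s n i = v]) n) by exact: filter_forall.
  have [n [/= h1 h2]] := filter_ex (filterI hF (sm i)).
  have sl : (s n i < (m i).+1)%N by rewrite ltnS.
  exact: (h1 (Ordinal sl)).
exists z' => //; exists s'; split; last by move=> i; case: (hs' i).
apply: cH => V n Vz'.
have FV : F [set k | V (z k)] by exact: zz'.
have Fs : F (fun k => forall i : 'I_n, s k i = s' i).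
  by apply: filter_forall => i; case: (hs' i).
have [k [[/= Vk Hk] sk]] := filter_ex (filterI (filterI FV Hz) Fs).
by exists (z k), (s k); split => // i iin; exact: (sk (Ordinal iin)).
Qed.

Lemma baire_bounded_compact (Z : topologicalType)
    (H : Z -> (nat -> nat) -> Prop) (B : set Z) (m : nat -> nat) :
  baire_closed H -> compact B -> (forall z s, H z s -> B z) ->
  compact [set z | exists s, H z s /\ (forall i, (s i <= m i)%N)].
Proof.
move=> cH cB HB; rewrite compact_ultra => F FU FD.
have PF : ProperFilter F by exact: ultra_proper.
have /choice[s hs] : forall z, exists s, (exists s, H z s /\ (forall i, (s i <= m i)%N)) ->
    H z s /\ (forall i, (s i <= m i)%N).
  move=> z; have [[s ?]|h] := pselect (exists s, H z s /\ (forall i, (s i <= m i)%N)).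
    by exists s.
  by exists (fun=> 0%N) => /h.
have [] := @baire_ultra Z F Z H B m id s FU cH cB.
- by apply: filterS FD => z [s' [/HB]].
- by apply: filterS FD => z /hs[].
- by move=> i; apply: filterS FD => z /hs[_ h]; exact: h.
by move=> z' hz' zz'; exists z'; split.
Qed.

(* The bounds m 0, m 1, ... are chosen one by one, keeping the outer measure of
   the projection above c. *)
Lemma souslin_capacity (R : realType) (Z : topologicalType)
    (H : Z -> (nat -> nat) -> Prop) (B : set Z) (pr : Z -> R) (c : R) :
  baire_closed H -> compact B -> (forall z s, H z s -> B z) -> continuous pr ->
  outer_gt c [set pr z | z in [set z | exists s, H z s]] ->
  exists m : nat -> nat,
    (c%:E <= mu [set pr z | z in [set z | exists s, H z s /\ (forall i, (s i <= m i)%N)]])%E.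
Proof.
move=> cH cB HB cpr h0.
pose S (l : seq nat) := [set t | exists z s,
  [/\ H z s, (forall i, (i < size l)%N -> (s i <= nth 0 l i)%N) & pr z = t]].
have /choice[v hv] : forall l, exists v, outer_gt c (S l) -> outer_gt c (S (rcons l v)).
  move=> l; have [hl|hl] := pselect (outer_gt c (S l)); last by exists 0%N => /hl.
  have E : S l = \bigcup_v S (rcons l v).
    apply/seteqP; split => t.
      move=> [z [s [Hz sl prz]]]; exists (s (size l)) => //; exists z, s; split => // i.
      rewrite size_rcons ltnS leq_eqVlt nth_rcons => /predU1P[->|il]; first by rewrite ltnn eqxx.
      by rewrite il sl.
    move=> [v _ [z [s [Hz sl prz]]]]; exists z, s; split => // i il.
    by have := sl i; rewrite size_rcons nth_rcons il; apply; exact: ltnW.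
  rewrite E in hl; have [] := outer_gt_bigcup _ hl; last by move=> v hv; exists v.
  move=> a b ab t [z [s [Hz sl prz]]]; exists z, s; split => // i.
  rewrite size_rcons => il; have := sl i; rewrite size_rcons !nth_rcons => /(_ il).
  case: ifP => // _; case: ifP => // _ /leq_trans; exact.
pose l n := iter n (fun l => rcons l (v l)) [::].
have sl n : size (l n) = n by elim: n => //= n IH; rewrite size_rcons IH.
pose m i := v (l i).
have lm n i : (i < n)%N -> nth 0 (l n) i = m i.
  elim: n => // n IH; rewrite ltnS leq_eqVlt /= nth_rcons sl => /predU1P[->|iin].
    by rewrite ltnn eqxx.
  by rewrite iin IH.
have big n : outer_gt c (S (l n)).
  elim: n => [|n IH]; last exact: hv.
  rewrite (_ : S (l 0%N) = [set pr z | z in [set z | exists s, H z s]])//.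
  apply/seteqP; split => t; first by move=> [z [s [Hz _ <-]]]; exists z => //; exists s.
  by move=> [z [s Hz] <-]; exists z, s.
exists m.
set D := [set z | _].
have cprB : compact (pr @` B) by apply: continuous_compact => //; exact: continuous_subspaceT.
have clB : closed (pr @` B) by apply: compact_closed => //; exact: Rhausdorff.
(* The sets [S (l n)] need not be measurable, but their closures are; they decrease and have measure
   at least c. A point of all closures is approached by projections of pairs that obey more and more
   of the bounds m, so by [baire_ultra] it is itself the projection of a point of D. *)
pose Q n := closure (S (l n)).
have QB n : Q n `<=` pr @` B.
  rewrite [X in _ `<=` X]((closure_id _).1 clB); apply: closure_subset.
  by move=> _ [z [s [Hz _ <-]]]; exists z => //; exact: HB Hz.
have mQ n : measurable (Q n) by apply: closed_measurable; exact: closed_closure.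
have cQ n : (c%:E <= mu (Q n))%E.
  rewrite leNgt; apply/negP => /ltW h; apply: (big n); exists (Q n); split => //.
  exact: subset_closure.
have ndQ : nonincreasing_seq Q.
  move=> a b ab; apply/subsetPset; apply: closure_subset => t [z [s [Hz sz prz]]].
  exists z, s; split => // i; rewrite sl => ia; have ib := leq_trans ia ab.
  by have := sz i; rewrite sl !lm// => /(_ ib).
have Q0 : (mu (Q 0%N) < +oo)%E.
  apply: le_lt_trans (compact_finite_measure cprB).
  by apply: le_mu => //; exact: compact_measurable.
have mQQ : measurable (\bigcap_n Q n) by exact: bigcapT_measurable.
have QD : \bigcap_n Q n `<=` pr @` D.
  move=> t Qt.
  have /choice[zs hzs] : forall n, exists zs : Z * (nat -> nat),
      [/\ H zs.1 zs.2, (forall i, (i < n)%N -> (zs.2 i <= m i)%N) & `|t - pr zs.1| < n.+1%:R^-1].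
    move=> n; have n0 : 0 < n.+1%:R^-1 :> R by rewrite invr_gt0.
    have [w [[z [s [Hz sz prz]]] wt]] := Qt n I _ (nbhsx_ballx t _ n0).
    exists (z, s); split => //=.
      by move=> i iin; have := sz i; rewrite sl lm// => /(_ iin).
    by rewrite prz; move: wt; rewrite -ball_normE.
  have [F [FU oF]] := @ultraFilterLemma nat (nbhs \oo) _.
  have PF : ProperFilter F by exact: ultra_proper.
  have [] := @baire_ultra nat F Z H B m (fun n => (zs n).1) (fun n => (zs n).2) FU cH cB.
  - by apply: filterE => n; have [/HB] := hzs n.
  - by apply: filterE => n; have [] := hzs n.
  - move=> i; apply: oF; exists i.+1 => // n /= iin; have [_ + _] := hzs n.
    exact.
  move=> z [s [Hz sm]] zz'; exists z; first by exists s.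
  apply/eqP; rewrite eq_sym -subr_eq0 -normr_le0; apply/ler_addgt0Pr => e e0; rewrite add0r.
  have e2 : 0 < e / 2 by rewrite divr_gt0.
  have V : nbhs z [set y | `|pr z - pr y| < e / 2].
    by move/cvgrPdist_lt : (cpr z) => /(_ _ e2).
  have Fe : F [set n | n.+1%:R^-1 < e / 2].
    apply: oF; have := near_infty_natSinv_lt (PosNum e2); exact.
  have [n [/= h1 h2]] := filter_ex (filterI (zz' _ V) Fe).
  have [_ _ h3] := hzs n.
  have -> : t - pr z = (t - pr (zs n).1) - (pr z - pr (zs n).1) by rewrite opprB addrA subrK.
  apply: le_trans (ler_normB _ _) _; have := ltrD (lt_trans h3 h2) h1.
  by rewrite -splitr => /ltW.
have cD : compact (pr @` D).
  apply: continuous_compact; first exact: continuous_subspaceT.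
  exact: (baire_bounded_compact cH cB HB).
apply: (@le_trans _ _ (mu (\bigcap_n Q n))); last first.
  by apply: le_mu => //; exact: compact_measurable.
have cvQ := @nonincreasing_cvg_mu _ _ _ (@lebesgue_measure R) Q Q0 mQ mQQ ndQ.
have <- : limn (mu \o Q) = mu (\bigcap_n Q n) by exact: cvg_lim cvQ.
apply: lime_ge; first by apply/cvg_ex; eexists; exact: cvQ.
exact: nearW.
Qed.

(* p t is the lexicographic minimum of the section of D at t. *)
Lemma compact_selection (R : realType) k (D : set (R^o * 'cV[R]_k)%type) :
  compact D -> exists p : R -> 'cV[R]_k,
  let C := [set t | exists v, D (t, v)] in
  [/\ compact C, measurable_fun C (p : R -> borel 'cV[R]_k) &
      forall t, C t -> D (t, p t)].
Proof.
move=> cD.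
have cfst : continuous (fst : (R^o * 'cV[R]_k)%type -> R^o) by move=> z; exact: cvg_fst.
have csnd : continuous (snd : (R^o * 'cV[R]_k)%type -> 'cV[R]_k) by move=> z; exact: cvg_snd.
(* Measurability of a compact-valued map is expressed by the times at which it hits a closed set.
   This property survives the minimisation of one coordinate after another. *)
pose good (E : R -> set 'cV[R]_k) := (forall t, compact (E t)) /\
  (forall F, closed F -> measurable [set t | exists2 v, F v & E t v]).
have good0 : good (fun t => [set v | D (t, v)]).
  split=> [t|F cF].
    have -> : [set v | D (t, v)] = snd @` (D `&` fst @^-1` [set t]).
      apply/seteqP; split => v; first by move=> Dv; exists (t, v).
      by move=> [[t' v'] [/= Dv <-] <-].
    apply: continuous_compact; first exact: continuous_subspaceT.
    apply: compact_closedI => //; apply: closed_comp => [z _|]; first exact: cfst.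
    exact: closed_eq.
  apply: compact_measurable.
  have -> : [set t | exists2 v, F v & D (t, v)] = fst @` (D `&` snd @^-1` F).
    apply/seteqP; split => t; first by move=> [v Fv Dv]; exists (t, v).
    by move=> [[t' v'] [/= Dv Fv] <-]; exists v'.
  apply: continuous_compact; first exact: continuous_subspaceT.
  apply: compact_closedI => //; apply: closed_comp => // z _; exact: csnd.
pose nxt (i : 'I_k) (E : R -> set 'cV[R]_k) (t : R) : set 'cV[R]_k :=
  [set v | E t v /\ forall w, E t w -> v i 0 <= w i 0].
have ccoord (i : 'I_k) : continuous (fun v : 'cV[R]_k => v i 0) by exact: coord_continuous.
have clle (i : 'I_k) (r : R) : closed [set v : 'cV[R]_k | v i 0 <= r].
  apply: (@closed_comp _ _ (fun v : 'cV[R]_k => v i 0) [set x | x <= r]) => [z _|].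
    exact: (ccoord i).
  exact: closed_le.
have minex (E : set 'cV[R]_k) i : compact E -> E !=set0 ->
    exists2 v, E v & forall w, E w -> v i 0 <= w i 0.
  move=> cE E0.
  have cw : {within E, continuous (fun v : 'cV[R]_k => v i 0)} by apply: continuous_subspaceT; exact: (ccoord i).
  have [v /set_mem Ev vmin] := compact_EVT_min E0 cE cw.
  by exists v => // w Ew; apply: vmin; exact: mem_set.
have goodS i E : good E -> good (nxt i E).
  move=> [cE mE]; split=> [t|F cF].
    have [[v [Ev vmin]]|h] := pselect (exists v, nxt i E t v); last first.
      rewrite (_ : nxt i E t = set0); first exact: compact0.
      by apply/seteqP; split => v // nv; apply: h; exists v.
    rewrite (_ : nxt i E t = E t `&` [set w | w i 0 <= v i 0]).
      exact: (compact_closedI (cE t) (clle i (v i 0))).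
    apply/seteqP; split => w [Ew wv]; split => //; first exact: wv.
    by move=> w' Ew'; rewrite (le_trans wv)// vmin.
  pose T q := [set t | exists2 v, [set v : 'cV[R]_k | v i 0 <= ratr q] v & E t v].
  pose TF q := [set t | exists2 v, (F `&` [set v : 'cV[R]_k | v i 0 <= ratr q]) v & E t v].
  (* The minimum of coordinate i over E t is attained in F exactly when, for every rational level q,
     F meets E t at or below q as soon as E t has a point there. This leaves only countably many
     conditions. *)
  have -> : [set t | exists2 v, F v & nxt i E t v] =
      [set t | exists2 v, F v & E t v] `&` \bigcap_(q : rat) (~` T q `|` TF q).
    apply/seteqP; split => t.
      move=> [v Fv [Ev vmin]]; split; first by exists v.
      move=> q _; have [[w wq Ew]|h] := pselect (T q t); last by left.
      by right; exists v => //; split => //=; rewrite (le_trans (vmin _ Ew)).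
    move=> [[v0 Fv0 Ev0] hq].
    have [] := @minex (F `&` E t) i.
    - by rewrite setIC; exact: compact_closedI.
    - by exists v0.
    move=> v [Fv Ev] vmin; exists v => //; split => // w Ew.
    rewrite leNgt; apply/negP => wv.
    have [q] := rat_in_itvoo wv; rewrite in_itv/= => /andP[wq qv].
    have [h|[v' [Fv' v'q] Ev']] := hq q I.
      by apply: h; exists w => //=; exact: ltW.
    have := vmin v' (conj Fv' Ev'); rewrite leNgt (le_lt_trans v'q)//.
  apply: measurableI; first exact: mE.
  rewrite -[X in measurable X]setCK setC_bigcap; apply: measurableC.
  apply: countable_bigcupT_measurable => [|q]; first exact: countableP.
  apply/measurableC/measurableU; last first.
    exact: (mE (F `&` [set v : 'cV[R]_k | v i 0 <= ratr q]) (closedI cF (clle i (ratr q)))).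
  apply: measurableC.
  exact: (mE [set v : 'cV[R]_k | v i 0 <= ratr q] (clle i (ratr q))).
have nxt_ne i E t : good E -> E t !=set0 -> nxt i E t !=set0.
  by move=> [cE _] /(minex (E t) i (cE t))[v Ev vmin]; exists v.
pose Es := foldr nxt (fun t => [set v | D (t, v)]).
have goodE l : good (Es l) by elim: l => //= i l IH; exact: goodS.
have subE l t : Es l t `<=` [set v | D (t, v)].
  by elim: l => //= i l IH v [/IH].
have neE l t : [set v | D (t, v)] !=set0 -> Es l t !=set0.
  by elim: l => //= i l IH h; apply: nxt_ne => //; exact: IH.
have eqE l t v w : Es l t v -> Es l t w -> forall i, i \in l -> v i 0 = w i 0.
  elim: l => //= i l IH [Ev vmin] [Ew wmin] j; rewrite inE => /predU1P[->|jl].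
    by apply: le_anti; rewrite vmin//= wmin.
  exact: IH.
(* Once all coordinates are minimised, two points of a section agree in every entry: a nonempty
   section is a singleton, and p falls in an open V exactly when the section misses the closed
   complement. *)
pose En := Es (enum 'I_k).
have /choice[p hp] : forall t, exists v, [set v | D (t, v)] !=set0 -> En t v.
  move=> t; have [h|h] := pselect ([set v | D (t, v)] !=set0); last by exists 0 => /h.
  by have [v Ev] := neE (enum 'I_k) t h; exists v.
exists p => C.
have cC : compact C.
  have -> : C = fst @` D.
    apply/seteqP; split => t; first by move=> [v Dv]; exists (t, v).
    by move=> [[t' v] Dv <-]; exists v.
  by apply: continuous_compact => //; exact: continuous_subspaceT.
have mC : measurable C by exact: compact_measurable.
split => //; last first.
  by move=> t [v Dv]; apply: (subE (enum 'I_k)); apply: hp; exists v.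
apply: (@measurability _ _ _ (borel 'cV[R]_k) C p (@open 'cV[R]_k)) => //.
move=> _ [V oV <-].
have -> : C `&` p @^-1` V = C `\` [set t | exists2 v, (~` V) v & En t v].
  apply/seteqP; split => t [Ct].
    move=> pV; split => // -[v nVv Ev]; apply: nVv.
    have Ep : En t (p t) by apply: hp; case: Ct => v' Dv'; exists v'.
    suff -> : v = p t by [].
    by apply/colP => i; apply: (eqE _ _ _ _ Ev Ep); rewrite mem_enum.
  move=> h; split => //; apply: contrapT => nV; apply: h; exists (p t) => //.
  by apply: hp; case: Ct => v Dv; exists v.
apply: measurableD => //; have [_] := goodE (enum 'I_k); apply.
exact: open_closedC.
Qed.

(** Truncation to a compact box keeps the projection non-negligible for some N and supplies the
    ambient compact set of the capacity argument. The selection lives on a set of positive measure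
    only, which is all that a needle needs. *)
Lemma measurable_selection (R : realType) k (G : set (R^o * 'cV[R]_k)%type) :
  measurable (G : set (borel (R^o * 'cV[R]_k)%type)) ->
  ~ (@lebesgue_measure R).-negligible [set t | exists v, G (t, v)] ->
  exists (C : set R) (p : R -> 'cV[R]_k) (N : nat),
  [/\ measurable C, (0%E < mu C)%E, measurable_fun C (p : R -> borel 'cV[R]_k),
     (forall t, C t -> G (t, p t)) & forall t, C t -> `|t| <= N%:R /\ `|p t| <= N%:R].
Proof.
move=> mG nG.
pose B (N : nat) : set (R^o * 'cV[R]_k)%type := `[- N%:R, N%:R]%classic `*` [set v | `|v| <= N%:R].
have cB N : compact (B N).
  by apply: compact_setX; [exact: segment_compact|exact: compact_col_ball].
have [N hN] : exists N, ~ (@lebesgue_measure R).-negligible [set t | exists v, (G `&` B N) (t, v)].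
  apply: contrapT => /forallNP h; apply: nG.
  have -> : [set t | exists v, G (t, v)] = \bigcup_N [set t | exists v, (G `&` B N) (t, v)].
    apply/seteqP; split => t.
      move=> [v Gv]; exists (Num.trunc (Num.max `|t| `|v|)).+1 => //; exists v; split => //.
      have := truncnS_gt (Num.max `|t| `|v|); rewrite gt_max => /andP[h1 h2].
      by split => /=; [rewrite in_itv/= -ler_norml; exact: ltW|exact: ltW].
    by move=> [N _ [v [Gv _]]]; exists v.
  by apply: negligible_bigcup => N; apply: contrapT; exact: h.
have mGB : measurable ((G `&` B N) : set (borel (R^o * 'cV[R]_k)%type)).
  apply: measurableI => //.
  have cl : closed (B N).
    apply: compact_closed => //; exact: norm_hausdorff.
  rewrite -[B N]setCK; apply: measurableC; apply: sub_gen_smallest.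
  exact: closed_openC.
have [H cH GE] := souslin_borel mGB.
have [c c0 hc] := outer_gt_exists hN.
have HB z s : H z s -> B N z.
  move=> Hz; have : (G `&` B N) z by rewrite GE; exists s.
  by case.
have cfst : continuous (fst : (R^o * 'cV[R]_k)%type -> R^o) by move=> z; exact: cvg_fst.
have [] := @souslin_capacity R _ H (B N) fst c cH (cB N) HB cfst.
  rewrite (_ : [set _ | _ in _] = [set t | exists v, (G `&` B N) (t, v)])//.
  rewrite GE; apply/seteqP; split => t.
    by move=> [[t' v] [s Hs] <-]; exists v; exists s.
  by move=> [v [s Hs]]; exists (t, v) => //; exists s.
move=> m; set D := [set z | _] => hD.
have cD : compact D by exact: baire_bounded_compact cH (cB N) HB.
have [p [cC mp hp]] := compact_selection cD.
have DG z : D z -> (G `&` B N) z by move=> [s [Hs _]]; rewrite GE; exists s.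
exists [set t | exists v, D (t, v)], p, N; split => //.
- exact: compact_measurable.
- apply: lt_le_trans (_ : (c%:E <= _)%E); first by rewrite lte_fin.
  rewrite (_ : [set t | _] = [set fst z | z in D])//.
  apply/seteqP; split => t; first by move=> [v Dv]; exists (t, v).
  by move=> [[t' v] Dv <-]; exists v.
- by move=> t /hp/DG[].
- by move=> t /hp/DG[_ [/= h1 h2]]; split => //; move: h1; rewrite in_itv/= -ler_norml.
Qed.

(** * Multipliers *)

Lemma limn_esup_le (R : realType) (v : nat -> \bar R) (e : R) :
  limn_esup v = 0%E -> 0 < e -> exists N, forall n, (N <= n)%N -> (v n <= e%:E)%E.
Proof.
move=> v0 e0; have : (limn_esup v < e%:E)%E by rewrite v0 lte_fin.
rewrite /limn_esup /limf_esup => /ereal_inf_lt[_ [V [N _ NV] <-] /ltW h].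
exists N => n Nn; apply: le_trans h; apply: ereal_sup_ubound; exists n => //.
exact: NV.
Qed.

Lemma tau_optimal_le (R : realType) m k
    (f : dynamics R m k)
    (g : running R m k) (U : R -> set 'cV[R]_k)
    (xinit : 'cV[R]_m) (tau : nat -> R) (u0 : R -> 'cV[R]_k) (x0 : R -> 'cV[R]_m) (e : R) :
  tau_optimal f g U xinit tau u0 x0 -> 0 < e ->
  exists N, forall n, (N <= n)%N -> forall u x, admissible U u -> trajectory f xinit u x ->
    payoff g u x (tau n) - payoff g u0 x0 (tau n) <= e.
Proof.
move=> /limn_esup_le h e0; have [N hN] := h e e0; exists N => n Nn u x hu hx.
rewrite -lee_fin; apply: le_trans (hN n Nn); apply: ereal_sup_ubound.
by exists (u, x).
Qed.

Lemma joint_near (R : realType) m (P : nat -> 'cV[R]_m -> Prop) :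
  (\forall p \near @joint_filter R m, P p.1 p.2) ->
  exists N, exists2 r, 0 < r & forall n xi, (N <= n)%N -> 0 < `|xi| < r -> P n xi.
Proof.
move=> [[Q1 Q2] /= [[N _ NQ] Q2n] sub].
have /nbhs_ballP[r /= r0 hr] : nbhs (0 : 'cV[R]_m) [set xi | xi != 0 -> Q2 xi] by exact: Q2n.
exists N, r => // n xi Nn /andP[xi0 xir]; apply: (sub (n, xi)); split => /=; first exact: NQ.
apply: hr; last by rewrite -normr_gt0.
by rewrite -ball_normE/= sub0r normrN.
Qed.

Lemma small_vector (R : realType) m (r : R) : (0 < m)%N -> 0 < r ->
  exists xi : 'cV[R]_m, 0 < `|xi| < r.
Proof.
move=> m0 r0; exists (const_mx (r / 2)).
have r2 : 0 < r / 2 by rewrite divr_gt0.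
apply/andP; split.
  rewrite normr_gt0; apply/eqP => /colP/(_ (Ordinal m0)).
  by rewrite !mxE; lra.
apply: (@le_lt_trans _ _ (r / 2)); last lra.
apply: mx_norm_le => [|i j]; first exact: ltW.
by rewrite mxE ger0_norm// ltW.
Qed.

Lemma norm2Z (R : realType) m n (c : R) (A : 'M[R]_(m, n)) : norm2 (c *: A) = `|c| * norm2 A.
Proof.
rewrite /norm2 -sqrtr_sqr -sqrtrM ?sqr_ge0//; congr (Num.sqrt _).
rewrite mulr_sumr; apply: eq_bigr => i _; rewrite mulr_sumr; apply: eq_bigr => j _.
by rewrite mxE exprMn.
Qed.

Lemma norm20 (R : realType) m n : norm2 (0 : 'M[R]_(m, n)) = 0.
Proof. by have := norm2Z 0 (0 : 'M[R]_(m, n)); rewrite scale0r normr0 mul0r. Qed.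

Lemma continuous_norm2 (R : realType) m n : continuous (@norm2 R m n).
Proof.
move=> A; apply: (@continuous_comp _ _ _ (fun A : 'M[R]_(m, n) => \sum_i \sum_j A i j ^+ 2) Num.sqrt).
  have add_c : continuous (fun x : R * R => x.1 + x.2) by exact: add_continuous.
  move: A; apply: (continuous_big add_c) => i _.
  apply: (continuous_big add_c) => j _ A.
  apply: (@continuous_comp _ _ _ (fun B : 'M[R]_(m, n) => B i j) (fun x : R => x ^+ 2)).
    exact: coord_continuous.
  exact: exprn_continuous.
exact: sqrt_continuous.
Qed.

Lemma hamiltonian_xE (R : realType) m k
    (f : dynamics R m k)
    (g : running R m k) (x : 'cV[R]_m) t u lam psi :
  regularity_conditions f g -> 0 <= t ->
  hamiltonian_x f g x t u lam psi =
  psi *m jac (fun y => f t y u) x + lam *: grad (fun y => g t y u) x.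
Proof.
move=> [df _ _ _ _] t0; have [dft dgt] := df t x u t0.
apply/rowP => j; rewrite /hamiltonian_x !mxE.
pose F i : 'cV[R]_m -> R^o := fun y => f t y u i 0.
have dF i : differentiable (F i) x /\ forall v, 'd (F i) x v = ('d (fun y => f t y u) x v) i 0.
  exact: coord_diff.
pose h : 'cV[R]_m -> R^o := (\sum_i psi 0 i *: F i) + lam *: (fun y => g t y u : R^o).
have -> : (fun y => hamiltonian f g y t u lam psi) = h.
  apply/funext => y; rewrite /hamiltonian /h mxE.
  rewrite -[RHS]/((\sum_i psi 0 i *: F i) y + lam * g t y u); congr (_ + _).
  by rewrite fct_sumE; apply: eq_bigr.
have dsum : differentiable (\sum_i psi 0 i *: F i) x.
  by apply: differentiable_sum => i; apply: differentiableZ; case: (dF i).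
have dh : differentiable h x.
  by apply: differentiableD => //; exact: differentiableZ.
have eh v : 'd h x v = \sum_i psi 0 i * 'd (F i) x v + lam * 'd ((fun y => g t y u) : 'cV[R]_m -> R^o) x v.
  rewrite -deriveE// /h deriveD; last 2 first.
  - exact: diff_derivable.
  - by apply/diff_derivable/differentiableZ.
  rewrite derive_sum; last by move=> i; apply/diff_derivable/differentiableZ; case: (dF i).
  rewrite deriveZ; last exact: diff_derivable.
  congr (_ + _); last by rewrite deriveE.
  apply: eq_bigr => i _; rewrite deriveZ; last by apply: diff_derivable; case: (dF i).
  by rewrite deriveE//; case: (dF i).
rewrite eh; congr (_ + _).
by apply: eq_bigr => i _; rewrite mxE; have [_ ->] := dF i.
Qed.

(** The inverse of A is never differentiated: on each [0, b] the solution given by [adjoint_exists]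
    with value p at time 0 must equal the formula, by [adjoint_formula] and invertibility. *)
Lemma adjoint_global (R : realType) m k
    (f : dynamics R m k)
    (g : running R m k) (U : R -> set 'cV[R]_k) (xinit : 'cV[R]_m)
    (u0 : R -> 'cV[R]_k) (x0 : R -> 'cV[R]_m) (A : R -> 'M[R]_m) (lam : R) (p : 'rV[R]_m) (b : R) :
  regularity_conditions f g -> admissible U u0 -> trajectory f xinit u0 x0 ->
  fundamental_matrix f u0 x0 A ->
  let psi T := (p - lam *: sensitivity g u0 x0 A T) *m invmx (A T) in
  0 <= b ->
  solves_on b psi (fun t => - (psi t *m df_dx f u0 x0 t
                               + lam *: dg_dx g u0 x0 t)).
Proof.
move=> fg adm [sx _] [sA A0] psi b0.
have sx0 := solves_solves_on b0 sx.
have [c c0 bu] := admissible_bdd_meas adm b0.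
have [r r0 hr] := abs_cont_bounded sx0.1.
have bx := solves_on_bdd_meas sx0 hr.
have [l hl] := reg_boundsP r c fg.
have b00 : 0 <= (0:R) <= b by rewrite lexx b0.
have [q [hq q0 _]] := adjoint_exists lam p fg hl b00 bx bu.
have hA := solves_solves_on b0 sA.
have E t : 0 <= t <= b -> q t = psi t.
  move=> tb; have := adjoint_formula fg hl bx bu hA A0 hq tb.
  rewrite q0 /psi => <-; rewrite mulmxK//.
  exact: (fundamental_unit hl bx bu hA A0).
apply: solves_on_eq hq => //.
by apply: aeW => t /andP[t0 tb]; rewrite E// !ltW.
Qed.

Lemma sensitivity0 (R : realType) m k (g : running R m k)
    (u : R -> 'cV[R]_k) (x : R -> 'cV[R]_m) (A : R -> 'M[R]_m) : sensitivity g u x A 0 = 0.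
Proof. by apply/rowP => i; rewrite !mxE Rintegral_itv0. Qed.

(** Cut C by a grid of intervals of length d; if all slices were null, so would be C. It makes
    needles of arbitrarily small size available inside the selected set. *)
Lemma small_measurable_subset (R : realType) (C : set R) (N : nat) (d : R) :
  measurable C -> (forall t, C t -> `|t| <= N%:R) -> (0%E < mu C)%E -> 0 < d ->
  exists E : set R, [/\ measurable E, E `<=` C, (0%E < mu E)%E & (mu E <= d%:E)%E].
Proof.
move=> mC CN C0 d0; apply: contrapT => h.
pose J (i : int) := `[i%:~R * d, (i + 1)%:~R * d[%classic : set R.
have mJ i : measurable (J i) by exact: measurable_itv.
have mCJ i : measurable (C `&` J i) by exact: measurableI.
have CJ i : mu (C `&` J i) = 0%E.
  apply/eqP; rewrite eq_le measure_ge0 andbT leNgt; apply/negP => p; apply: h.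
  exists (C `&` J i); split => //.
  apply: (@le_trans _ _ (mu (J i))).
    by apply: le_mu => //; exact: subIsetr.
  rewrite lebesgue_measure_itv/=; case: ifP => _; last by rewrite lee_fin ltW.
  by rewrite -EFinD lee_fin intrD mulrDl mulr1z mul1r addrAC subrr add0r.
have : (mu C <= 0)%E.
  have -> : C = \bigcup_(i : int) (C `&` J i).
    apply/seteqP; split => [t Ct|t [i _ []]//].
    exists (Num.floor (t / d)) => //; split => //; rewrite /J/= in_itv/=.
    by have := floor_itv (t / d); rewrite ler_pdivlMr// ltr_pdivrMr.
  have [A [mA A0 sA]] : mu.-negligible (\bigcup_(i : int) (C `&` J i)).
    have -> : \bigcup_(i : int) (C `&` J i) =
        \bigcup_n (if @unpickle int n is Some i then C `&` J i else set0).
      apply/seteqP; split => t.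
        by move=> [i _ ?]; exists (pickle i) => //; rewrite pickleK.
      by move=> [n _]; case: unpickle => // i ?; exists i.
    apply: negligible_bigcup => n; case: unpickle => [i|]; last exact: negligible_set0.
    by exists (C `&` J i); split; [exact: mCJ|exact: CJ|].
  apply: (@le_trans _ _ (mu A)); last by rewrite le_eqVlt; apply/orP; left; apply/eqP.
  by apply: le_mu => //; apply: countable_bigcupT_measurable => //; exact: countableP.
by rewrite leNgt C0.
Qed.

Lemma integral_indic_itv (R : realType) (b : R) (E : set R) : measurable E -> E `<=` `[0, b] ->
  \int[mu]_(t in `[0, b]) \1_E t = fine (mu E).
Proof. by move=> mE Eb; rewrite /Rintegral integral_indic// setIidl. Qed.

Lemma not_negligible_bigcup (R : realType) (F : nat -> set R) :
  ~ (@lebesgue_measure R).-negligible (\bigcup_n F n) ->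
  exists n, ~ (@lebesgue_measure R).-negligible (F n).
Proof.
move=> h; apply: contrapT => /forallNP h'; apply: h; apply: negligible_bigcup => n.
apply: contrapT; exact: h'.
Qed.

(* The hypothesis excludes first-order improvements by needle variations of
   small size [eps]: there [d] is the gain on [0, b] and [xi] the equivalent
   perturbation of the initial state. *)
Lemma maximum_condition (R : realType) m k
    (f : dynamics R m k)
    (g : running R m k) (U : R -> set 'cV[R]_k) (xinit : 'cV[R]_m)
    (u0 : R -> 'cV[R]_k) (x0 : R -> 'cV[R]_m)
    (X : 'cV[R]_m -> R -> 'cV[R]_m) (lam : R) (psi : R -> 'rV[R]_m) :
  borel_graph U -> regularity_conditions f g -> admissible U u0 -> trajectory f xinit u0 x0 ->
  (forall xi : 'cV[R]_m, trajectory f (xinit + xi) u0 (X xi)) ->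
  0 <= lam ->
  (forall b : R, 0 <= b ->
    solves_on b psi (fun t => - (psi t *m df_dx f u0 x0 t
                               + lam *: dg_dx g u0 x0 t))) ->
  (forall b K eta : R, 0 <= b -> 0 <= K -> 0 < eta -> exists2 del, 0 < del &
    forall eps u x xi d, 0 < eps <= del ->
    [/\ admissible U u, trajectory f xinit u x,
     `|xi| <= K * eps /\ `|d| <= K * eps,
     (forall T, b <= T -> payoff g u x T - payoff g u0 (X xi) T = d) &
     eta * eps - K * eps ^+ 2 <= lam * d + (psi 0 *m xi) 0 0] -> False) ->
  {ae (@lebesgue_measure R), forall t, 0 <= t ->
     ereal_sup [set (hamiltonian f g (x0 t) t p lam (psi t))%:E | p in U t]
     = (hamiltonian f g (x0 t) t (u0 t) lam (psi t))%:E}.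
Proof.
move=> Ugraph fg adm hx0 hX lam0 hpsi noimp.
pose Del t p := hamiltonian f g (x0 t) t p lam (psi t) - hamiltonian f g (x0 t) t (u0 t) lam (psi t).
pose bad := [set t : R | 0 <= t /\ exists p, U t p /\ 0 < Del t p].
suff [N [mN N0 bN]] : (@lebesgue_measure R).-negligible bad.
  exists N; split => // t /=; apply: contra_notP => Nt t0.
  have Uu0 : U t (u0 t) by case: adm => _ _; exact.
  apply/eqP; rewrite eq_le; apply/andP; split.
    apply: ge_ereal_sup => _ [p Up <-]; rewrite lee_fin leNgt; apply/negP => h.
    apply: Nt; apply: bN; split => //; exists p; split => //.
    by rewrite /Del subr_gt0.
  by apply: ereal_sup_ubound; exists (u0 t).
apply: contrapT => nbad.
(* Countable exhaustion turns a positive gain into one bounded below, with bounded times and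
   controls; one level must be non-negligible. *)
pose bad1 n := [set t : R | 0 <= t <= n%:R /\ exists p, [/\ U t p, `|p| <= n%:R & n.+1%:R^-1 <= Del t p]].
have [n hn] : exists n, ~ (@lebesgue_measure R).-negligible (bad1 n).
  apply: not_negligible_bigcup; apply: contra_not nbad; apply: negligibleS => t [t0 [p [Up Dp]]].
  exists (Num.trunc (Num.max (Num.max `|t| `|p|) (Del t p)^-1)).+1 => //.
  have := truncnS_gt (Num.max (Num.max `|t| `|p|) (Del t p)^-1).
  set q := (Num.trunc _).+1; rewrite !gt_max => /andP[/andP[h1 h2] h3]; split.
    by rewrite t0 (le_trans (ler_norm t))// ltW.
  exists p; split => //; first exact: ltW.
  rewrite -[leRHS]invrK lef_pV2 ?posrE ?invr_gt0//.
  by rewrite (le_trans (ltW h3))// ler_nat.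
pose b : R := n%:R.
have b0 : 0 <= b by [].
have [cu cu0 [mu0 bu0]] := admissible_bdd_meas adm b0.
pose c := Num.max n%:R cu.
have bu : bdd_meas b c u0.
  by split => // t tb; rewrite (le_trans (bu0 t tb))// le_max lexx orbT.
have [l il hneedle] := needle_variation fg adm hx0 hX b0 bu.
have [l' il' ll'] := il.
have [Nl [mNl Nl0 hNl]] := ae_negl ll'.
have ml' : measurable_fun `[0, b] l' by case/integrableP : il' => /measurable_EFinP.
have [_ [[cf _] [cg _]] _ _ _] := fg.
have [Nf [mNf Nf0 mf cnf]] := regular_coord cf.
have [mg /ae_negl[Ng [mNg Ng0 cng]]] := cg.
(* Outside this null set l agrees with its measurable version and f, g are continuous in state and
   control. *)
pose Z := Nl `|` Nf `|` Ng.
have mZ : measurable Z by do 2?apply: measurableU.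
have nZ : (@lebesgue_measure R).-negligible Z.
  exists Z; split => //; rewrite /Z !measureU0//; exact: measurableU.
pose bad2 M := [set t | [/\ bad1 n t, ~ Z t & l' t <= M%:R]].
have [M hM] : exists M, ~ (@lebesgue_measure R).-negligible (bad2 M).
  apply: not_negligible_bigcup; apply: contra_not hn => hb.
  apply: negligibleS (negligibleU nZ hb) => t bt.
  have [Zt|Zt] := pselect (Z t); [by left|right].
  exists (Num.trunc (l' t)).+1 => //; split => //.
  exact/ltW/truncnS_gt.
pose S1 := `[0, b]%classic `&` ~` Z `&` (`[0, b]%classic `&` l' @^-1` `]-oo, M%:R]%classic).
have mS1 : measurable S1.
  apply: measurableI; first by apply: measurableI => //; exact: measurableC.
  exact: ml'.
pose T := borel (R^o * 'cV[R]_k)%type.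
have mfst : measurable_fun setT (fst : T -> R).
  by apply: generated_measurable => V; apply: open_comp => z _; exact: cvg_fst.
pose D : set T := fst @^-1` S1.
have mD : measurable D by rewrite -[D]setTI; exact: mfst.
have DS z : D z -> [/\ 0 <= z.1 <= b, ~ Z z.1 & l' z.1 <= M%:R].
  by move=> [[/= + nz] [_]]; rewrite !in_itv/=.
have fstD (h : R -> R) : measurable_fun `[0, b] h -> measurable_fun D (fun z : T => h z.1).
  move=> mh; apply: (@measurable_comp _ _ _ _ _ _ `[0, b]%classic h D fst) => //.
    by move=> _ [z /DS[zb _ _] <-]; rewrite /= in_itv.
  exact: measurable_funTS.
have mx0 i : measurable_fun D (fun z : T => x0 z.1 i 0).
  apply: (fstD (fun t => x0 t i 0)); apply: abs_cont_measurable.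
  apply: (abs_cont_mxP _ _).1; by case: hx0 => -[+ _] _; apply.
have mu0' i : measurable_fun D (fun z : T => u0 z.1 i 0) by exact: (fstD (fun t => u0 t i 0)).
have msnd i : measurable_fun D (fun z : T => z.2 i 0).
  apply: measurable_funTS; apply: generated_measurable => V; apply: open_comp => z _.
  apply: (@continuous_comp _ _ _ snd (fun v : 'cV[R]_k => v i 0)); first exact: cvg_snd.
  exact: coord_continuous.
have mpsi j : measurable_fun D (fun z : T => psi z.1 0 j).
  apply: (fstD (fun t => psi t 0 j)); apply: abs_cont_measurable.
  by apply: (abs_cont_mxP _ _).1; case: (hpsi b b0).
have mH (w : T -> 'cV[R]_k) : (forall i, measurable_fun D (fun z => w z i 0)) ->
    measurable_fun D (fun z : T => hamiltonian f g (x0 z.1) z.1 (w z) lam (psi z.1)).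
  move=> mw; apply: measurable_funD.
    apply: (eq_measurable_fun (fun z : T => \sum_j psi z.1 0 j * f z.1 (x0 z.1) (w z) j 0)).
      by move=> z _; rewrite mxE.
    apply: measurable_sum => j; apply: measurable_funM => //.
    apply: (@caratheodory_measurable _ T R m k (fun t x u => f t x u j 0) D fst (fun z => x0 z.1) w) => //.
    - by move=> z /DS[/andP[]].
    - by move=> z /DS[/andP[z0 _] nz _]; apply: cnf => // Nz; apply: nz; left; right.
    - exact: measurable_funTS.
  apply: measurable_funM; first exact: measurable_cst.
  apply: (@caratheodory_measurable _ T R m k g D fst (fun z => x0 z.1) w) => //.
  - move=> x u; have mc := @continuous_borel_measurable R R^o idfun (fun x => cvg_id).
    exact: (measurableT_comp mc (mg x u)).
  - by move=> z /DS[/andP[]].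
  - by move=> z /DS[/andP[z0 _] nz _]; apply: cng => // Nz; apply: nz; right.
  - exact: measurable_funTS.
have mDel : measurable_fun D (fun z : T => Del z.1 z.2).
  by apply: measurable_funB; [exact: mH|exact: (mH (fun z => u0 z.1))].
(* The improving pairs over the times of [bad2 M]. Restriction to D makes the gain a Borel function
   of the pair, so that G is Borel and selection applies. *)
pose G : set T := (D `&` [set tp | 0 <= tp.1 /\ U tp.1 tp.2]) `&` [set z | `|z.2| <= n%:R]
  `&` (D `&` (fun z : T => Del z.1 z.2) @^-1` `[n.+1%:R^-1, +oo[%classic).
have mG : measurable G.
  apply: measurableI; last exact: mDel.
  apply: measurableI; first exact: measurableI.
  have cl : closed [set z : (R^o * 'cV[R]_k)%type | `|z.2| <= n%:R].
    apply: (@closed_comp _ _ (fun z : (R^o * 'cV[R]_k)%type => `|z.2|) [set r | r <= n%:R]); last exact: closed_le.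
    move=> z _; apply: (@continuous_comp _ _ _ snd (fun v : 'cV[R]_k => `|v|)); first exact: cvg_snd.
    exact: norm_continuous.
  rewrite -[X in measurable X]setCK; apply: measurableC; apply: sub_gen_smallest.
  exact: closed_openC.
have nG : ~ (@lebesgue_measure R).-negligible [set t | exists v, G (t, v)].
  apply: contra_not hM; apply: negligibleS => t [[tb [p [Up pn Dp]]] nz lM].
  have Dt : D (t, p) by rewrite /D/= /S1/= in_itv/= in_itv/=.
  exists p; split; last by split => //=; rewrite in_itv/= Dp.
  by split => //; split => //; split => //=; case/andP: tb.
have [C [p [N [mC C0 mp CG CN]]]] := measurable_selection mG nG.
(* K depends on M and n but not on the needle, so [del] can be fixed before the set E is cut down to
   it. *)
have [K K0 hK] := hneedle lam psi lam0 (hpsi b b0) M%:R n.+1%:R^-1 (ler0n _ _).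
have [|del del0 hdel] := noimp b K n.+1%:R^-1 b0 K0 _; first by [].
have [E [mE EC E0 Ed]] := small_measurable_subset mC (fun t Ct => (CN t Ct).1) C0 del0.
have Eb : E `<=` `[0, b].
  by move=> t /EC/CG[[[/DS[tb _ _] _] _] _]; rewrite /= in_itv.
have hE t : E t -> [/\ U t (p t), `|p t| <= c, l t <= M%:R &
     n.+1%:R^-1 <= hamiltonian f g (x0 t) t (p t) lam (psi t)
            - hamiltonian f g (x0 t) t (u0 t) lam (psi t)].
  move=> /EC/CG[[[/DS[/= tb nz lM] [_ Up]] pn] [_ +]]; rewrite /= in_itv/= andbT => Dp.
  split => //; first by rewrite (le_trans pn)// le_max lexx.
  by rewrite hNl// => Nt; apply: nz; left; left.
have [u [x [xi [d H]]]] := hK E p mE Eb (measurable_funS mC EC mp) hE.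
apply: (hdel _ u x xi d _ H).
rewrite integral_indic_itv//.
have Efin : mu E \is a fin_num.
  by rewrite ge0_fin_numE ?measure_ge0// (le_lt_trans Ed)// ltry.
by rewrite -lte_fin -lee_fin fineK// E0.
Qed.

(** * Uniqueness, passage from joint limits to xi = 0, and construction of the multiplier *)

Lemma trajectory_unique (R : realType) m k
    (f : dynamics R m k)
    (g : running R m k) (U : R -> set 'cV[R]_k) (xinit : 'cV[R]_m)
    (u : R -> 'cV[R]_k) (x y : R -> 'cV[R]_m) :
  regularity_conditions f g -> admissible U u ->
  trajectory f xinit u x -> trajectory f xinit u y ->
  forall t : R, 0 <= t -> x t = y t.
Proof.
move=> fg adm [sx x0] [sy y0] t t0.
have [c c0 bu] := admissible_bdd_meas adm t0.
have t00 : 0 <= (0 : R) <= t by rewrite lexx t0.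
apply: (traj_unique fg t00 bu (solves_solves_on t0 sx) (solves_solves_on t0 sy)).
  by rewrite x0 y0.
by rewrite lexx t0.
Qed.

Lemma fundamental_matrix_eq (R : realType) m k
    (f : dynamics R m k)
    (u : R -> 'cV[R]_k) (x y : R -> 'cV[R]_m) (A : R -> 'M[R]_m) :
  (forall t : R, 0 <= t -> x t = y t) -> fundamental_matrix f u x A -> fundamental_matrix f u y A.
Proof.
move=> xy [sA A0]; split; last exact: A0.
apply: solves_on_solves => b b0.
apply: solves_on_eq (solves_solves_on b0 sA); first by [].
by apply: aeW => t /andP[/ltW t0 _]; rewrite xy.
Qed.

Lemma row_integral_eq (R : realType) m (b : R) (h h' : R -> 'rV[R]_m) :
  (forall t : R, 0 <= t -> h t = h' t) -> row_integral b h = row_integral b h'.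
Proof.
move=> hh; apply/rowP => j; rewrite !mxE; apply: eq_Rintegral => t.
by rewrite inE/= in_itv/= => /andP[t0 _]; rewrite hh.
Qed.

Lemma sensitivity_eq (R : realType) m k (g : running R m k)
    (u : R -> 'cV[R]_k) (x y : R -> 'cV[R]_m) (A : R -> 'M[R]_m) b :
  (forall t : R, 0 <= t -> x t = y t) -> sensitivity g u x A b = sensitivity g u y A b.
Proof.
by move=> xy; apply: row_integral_eq => t t0; rewrite xy.
Qed.

Lemma payoff_eq (R : realType) m k (g : running R m k)
    (u : R -> 'cV[R]_k) (x y : R -> 'cV[R]_m) b :
  (forall t : R, 0 <= t -> x t = y t) -> payoff g u x b = payoff g u y b.
Proof.
move=> xy; apply: eq_Rintegral => t.
by rewrite inE/= in_itv/= => /andP[t0 _]; rewrite xy.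
Qed.

Lemma abs_cont_halfline_continuous (R : realType) (V : normedModType R) (x : R -> V) :
  (forall b, 0 <= b -> abs_cont b x) -> {within halfline R, continuous x}.
Proof.
move=> acx; apply/subspace_continuousP => t /=; rewrite in_itv/= andbT => t0.
have t1 : 0 <= t + 1 by rewrite addr_ge0.
apply/cvgrPdist_lt => e e0; have [d d0 hd] := abs_cont_cvg (acx _ t1) e0.
have dm : 0 < Num.min d 1 by rewrite lt_min d0 ltr01.
rewrite near_withinE; near=> s => s0.
have : `|t - s| < Num.min d 1.
  by near: s; apply: (@nbhsx_ballx _ R^o) => //.
rewrite lt_min => /andP[sd s1].
move: s0; rewrite /= in_itv/= andbT => s0.
apply: hd => //; last by rewrite t0/= lerDl.
rewrite s0/=; move: s1; rewrite distrC ltr_norml => /andP[_]; lra.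
Unshelve. all: by end_near. Qed.

(** The joint filter excludes xi = 0. Continuity in xi carries a closed condition over to xi = 0,
    and 0 < m guarantees nonzero xi arbitrarily close to it. *)
Lemma joint_closed (R : realType) m (V : topologicalType) (h : nat -> 'cV[R]_m -> V) (C : set V) :
  (0 < m)%N -> (\forall n \near \oo, {for 0, continuous (h n)}) -> closed C ->
  (\forall p \near @joint_filter R m, C (h p.1 p.2)) -> \forall n \near \oo, C (h n 0).
Proof.
move=> m0 hc cC /(@joint_near R m (fun n xi => C (h n xi))) [N [r r0 hN]].
near=> n; apply: cC => B hB.
have /nbhs_ballP[d /= d0 hd] : nbhs (0 : 'cV[R]_m) (h n @^-1` B).
  by have /(_ B hB) : {for 0, continuous (h n)} by near: n.
have rd : 0 < Num.min r d by rewrite lt_min r0 d0.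
have [xi /andP[xi0]] := small_vector m0 rd; rewrite lt_min => /andP[xir xid].
exists (h n xi); split.
  by apply: hN; [near: n; exists N | rewrite xi0].
by apply: hd; rewrite -ball_normE/= sub0r normrN.
Unshelve. all: by end_near. Qed.

Lemma joint_cvg (R : realType) m (V : normedModType R) (h : nat -> 'cV[R]_m -> V) (l : V) :
  (0 < m)%N -> (\forall n \near \oo, {for 0, continuous (h n)}) ->
  h p.1 p.2 @[p --> @joint_filter R m] --> l -> h n 0 @[n --> \oo] --> l.
Proof.
move=> m0 hc hl; apply/cvgrPdist_le => e e0.
apply: (joint_closed (C := [set y | `|l - y| <= e]) m0 hc).
  apply: (@closed_comp _ _ (fun y : V => `|l - y|) [set z | z <= e]); last exact: closed_le.
  move=> y _; apply: (@continuous_comp _ _ _ (fun y => l - y) (fun z => `|z|)).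
    by apply: cvgB; [exact: cvg_cst|exact: cvg_id].
  exact: norm_continuous.
by have /cvgrPdist_le/(_ e e0) := hl.
Qed.

Lemma adjoint_hamiltonian (R : realType) m k
    (f : dynamics R m k)
    (g : running R m k) (U : R -> set 'cV[R]_k) (xinit : 'cV[R]_m)
    (u0 : R -> 'cV[R]_k) (x0 : R -> 'cV[R]_m) (A : R -> 'M[R]_m) (lam : R) (p : 'rV[R]_m) :
  regularity_conditions f g -> admissible U u0 -> trajectory f xinit u0 x0 ->
  fundamental_matrix f u0 x0 A ->
  let psi T := (p - lam *: sensitivity g u0 x0 A T) *m invmx (A T) in
  solves psi (fun t => - hamiltonian_x f g (x0 t) t (u0 t) lam (psi t)).
Proof.
move=> fg adm tx fA psi; apply: solves_on_solves => b b0.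
apply: solves_on_eq (adjoint_global lam p fg adm tx fA b0); first by [].
by apply: aeW => t /andP[/ltW t0 _]; rewrite hamiltonian_xE.
Qed.

Lemma mulmx_dist_le (R : realType) m (I p : 'rV[R]_m) (xi : 'cV[R]_m) (kap : R) :
  `|I - p| <= kap -> `|(I *m xi) 0 0 - (p *m xi) 0 0| <= m%:R * kap * `|xi|.
Proof.
move=> Ip; have -> : (I *m xi) 0 0 - (p *m xi) 0 0 = ((I - p) *m xi) 0 0.
  by rewrite mulmxBl !mxE.
apply: le_trans (le_mx_norm _ _ _) _; apply: le_trans (mx_norm_mul_le _ _) _.
by rewrite ler_wpM2r// ler_wpM2l.
Qed.

(* The two cases of the theorem are [c = 1] and [c n xi = 1 / norm2 (I_xi (tau n))]. *)
Lemma no_improvement (R : realType) m k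
    (f : dynamics R m k)
    (g : running R m k)
    (U : R -> set 'cV[R]_k) (xinit : 'cV[R]_m) (tau : nat -> R)
    (u0 : R -> 'cV[R]_k) (x0 : R -> 'cV[R]_m)
    (X : 'cV[R]_m -> R -> 'cV[R]_m) (A : 'cV[R]_m -> R -> 'M[R]_m)
    (c : nat -> 'cV[R]_m -> R) (lam : R) (p : 'rV[R]_m) :
  regularity_conditions f g -> (forall n, 0 <= tau n) -> tau @ \oo --> +oo ->
  admissible U u0 -> trajectory f xinit u0 x0 -> tau_optimal f g U xinit tau u0 x0 ->
  (forall xi : 'cV[R]_m, trajectory f (xinit + xi) u0 (X xi)) ->
  (forall xi : 'cV[R]_m, fundamental_matrix f u0 (X xi) (A xi)) ->
  (\forall q \near @joint_filter R m, 0 < c q.1 q.2) ->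
  c q.1 q.2 @[q --> @joint_filter R m] --> lam ->
  c q.1 q.2 *: sensitivity g u0 (X q.2) (A q.2) (tau q.1) @[q --> @joint_filter R m] --> p ->
  0 <= lam ->
  forall b K eta : R, 0 <= b -> 0 <= K -> 0 < eta -> exists2 del, 0 < del &
    forall eps u x xi d, 0 < eps <= del ->
    [/\ admissible U u, trajectory f xinit u x,
     `|xi| <= K * eps /\ `|d| <= K * eps,
     (forall T, b <= T -> payoff g u x T - payoff g u0 (X xi) T = d) &
     eta * eps - K * eps ^+ 2 <= lam * d + (p *m xi) 0 0] -> False.
Proof.
move=> fg tau0 tauoo adm tx opt tX fA c0 clam cI lam0 b K eta b0 K0 eta0.
have XE : forall t : R, 0 <= t -> X 0 t = x0 t.
  by apply: (trajectory_unique fg adm) tx; have := tX 0; rewrite addr0.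
(* Replacing lam by c costs at most K [kap] eps, and replacing p by c I costs m K [kap] eps;
   together these are at most eta eps / 8. *)
set kap := eta / (8 * (m%:R * K + K + 1)).
have mK : 0 <= m%:R * K by rewrite mulr_ge0.
have kap0 : 0 < kap by rewrite divr_gt0// mulr_gt0//; lra.
have kapE : (m%:R * K + K) * kap <= eta / 8.
  have -> : eta / 8 = (m%:R * K + K + 1) * kap by rewrite /kap; field; lra.
  by rewrite ler_wpM2r// ?ltW//; lra.
(* The bound 1 gives c <= lam + 1, by which the factor c is removed in the last step. *)
have H1 : \forall q \near @joint_filter R m, `|lam - c q.1 q.2| <= Num.min kap 1.
  by have /cvgrPdist_le := clam; apply; rewrite lt_min kap0 ltr01.
have H2 : \forall q \near @joint_filter R m,
    `|p - c q.1 q.2 *: sensitivity g u0 (X q.2) (A q.2) (tau q.1)| <= kap.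
  by have /cvgrPdist_le := cI; apply.
pose P n xi := [/\ 0 < c n xi, `|lam - c n xi| <= Num.min kap 1 &
   `|p - c n xi *: sensitivity g u0 (X xi) (A xi) (tau n)| <= kap].
have H3 : \forall q \near @joint_filter R m, P q.1 q.2.
  by apply: filterS3 c0 H1 H2 => q; split.
have [N [r r0 hN]] := joint_near H3.
(* The first entry puts |xi| below r and below 1, as the joint limit and the mean value theorem
   require; the second makes the quadratic error at most eta eps / 8. *)
set del := Num.min (Num.min r 1 / (2 * (K + 1))) (eta / (8 * (K + 1))).
have r1 : 0 < Num.min r 1 by rewrite lt_min r0 ltr01.
have K1 : 0 < K + 1 by lra.
have del0 : 0 < del by rewrite lt_min !divr_gt0// mulr_gt0.
exists del => // eps u x xi d /andP[eps0]; rewrite le_min => /andP[epsr epse].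
case=> admu tu [xiK dK] hd hK.
have Kr : K * eps < Num.min r 1.
  have : eps * (2 * (K + 1)) <= Num.min r 1 by rewrite -ler_pdivlMr// mulr_gt0.
  by have := mulr_ge0 K0 (ltW eps0); lra.
have /andP[xir xi1] : (`|xi| < r) && (`|xi| < 1).
  by rewrite -lt_min (le_lt_trans xiK).
have Ke : K * eps ^+ 2 <= eta / 8 * eps.
  rewrite expr2 mulrA ler_wpM2r// ?ltW//.
  have : eps * (8 * (K + 1)) <= eta by rewrite -ler_pdivlMr// mulr_gt0.
  by have := mulr_ge0 K0 (ltW eps0); lra.
(* The gain at [tau n] will be at least eta eps / (2 (lam + 1)), twice this tolerance. The tolerance
   depends on eps, so n is chosen after it. *)
have e'0 : 0 < eta * eps / (4 * (lam + 1)).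
  by rewrite divr_gt0 ?mulr_gt0//; lra.
have [N' hN'] := tau_optimal_le opt e'0.
have [n [Nn N'n bn]] : exists n, [/\ (N <= n)%N, (N' <= n)%N & b <= tau n].
  have /cvgryPge/(_ b)[N2 _ h] := tauoo.
  exists (maxn N (maxn N' N2)); rewrite leq_maxl; split => //.
    by rewrite (leq_trans (leq_maxl N' N2))// leq_maxr.
  by apply: h => /=; rewrite (leq_trans (leq_maxr N' N2))// leq_maxr.
have := hN' n N'n u x admu tu; apply/negP; rewrite -ltNge.
suff : eta / 2 * eps <= (lam + 1) * (payoff g u x (tau n) - payoff g u0 x0 (tau n)).
  rewrite ltr_pdivrMr; last by lra.
  by have := mulr_gt0 eta0 eps0; lra.
have -> : payoff g u x (tau n) - payoff g u0 x0 (tau n) =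
    d + (payoff g u0 (X xi) (tau n) - payoff g u0 (X 0) (tau n)).
  by rewrite -(hd _ bn) (payoff_eq _ _ _ XE); ring.
have ee := mulr_gt0 eta0 eps0.
(* For xi = 0 the joint limit gives no information, but then the whole gain is d, and lam d is
   already large enough. *)
have [xi0|xi0] := eqVneq xi 0.
  have px0 : (p *m xi) 0 0 = 0 by rewrite xi0 mulmx0 mxE.
  rewrite px0 addr0 in hK.
  rewrite xi0 subrr addr0.
  have ld : 0 < lam * d by lra.
  have d0 : 0 < d by move: ld; rewrite pmulr_rgt0// lt_neqAle lam0 andbT; apply/eqP => E; move: hK; rewrite -E mul0r; lra.
  lra.
have [C C0 hC] := quadratic_expansion fg adm tX fA (tau0 n).
have [s /andP[s0 s1] hs] := @mean_value_payoff R m (fun xi => payoff g u0 (X xi) (tau n))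
  (fun xi => sensitivity g u0 (X xi) (A xi) (tau n)) C xi hC xi1.
rewrite hs.
have [] := hN n (s *: xi) Nn.
  rewrite normrZ gtr0_norm// mulr_gt0 ?normr_gt0//=.
  by rewrite (le_lt_trans _ xir)// ler_piMl// ltW.
set cs := c n (s *: xi); set I := sensitivity _ _ _ _ _ => cs0.
rewrite le_min => /andP[csk cs1] csI.
set D := d + (I *m xi) 0 0.
have mp := mulmx_dist_le xi (etrans (congr1 (fun z => z <= kap) (distrC _ _)) csI).
rewrite -scalemxAl [X in `|X - _|]mxE in mp.
have csd : `|(lam - cs) * d| <= kap * (K * eps).
  by rewrite normrM ler_pM.
have xk : m%:R * kap * `|xi| <= m%:R * kap * (K * eps).
  by rewrite ler_wpM2l// mulr_ge0// ltW.
have e8 : (m%:R * K + K) * kap * eps <= eta / 8 * eps by rewrite ler_wpM2r// ltW.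
have csD : eta / 2 * eps <= cs * D.
  have mp' := le_trans mp xk.
  move: mp' csd; rewrite !ler_norml => /andP[h1 h2] /andP[h3 h4].
  rewrite /D mulrDr.
  have : (lam - cs) * d = lam * d - cs * d by rewrite mulrBl.
  have : kap * (K * eps) + m%:R * kap * (K * eps) = (m%:R * K + K) * kap * eps by ring.
  lra.
have D0 : 0 < D by rewrite -(pmulr_rgt0 _ cs0); lra.
apply: le_trans csD _; rewrite ler_wpM2r ?(ltW D0)//.
by move: cs1; rewrite ler_norml => /andP[]; lra.
Qed.

(** The factor c unifies both cases. Its limits at xi = 0 are assumed separately, because the
    punctured joint filter does not see xi = 0, while the approximating adjoint states run along
    [x0], that is xi = 0. *)
Lemma multiplier_of_limit (R : realType) m k
    (f : dynamics R m k)
    (g : running R m k)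
    (U : R -> set 'cV[R]_k) (xinit : 'cV[R]_m) (tau : nat -> R)
    (u0 : R -> 'cV[R]_k) (x0 : R -> 'cV[R]_m)
    (X : 'cV[R]_m -> R -> 'cV[R]_m) (A : 'cV[R]_m -> R -> 'M[R]_m)
    (c : nat -> 'cV[R]_m -> R) (lam : R) (p : 'rV[R]_m) :
  borel_graph U ->
  regularity_conditions f g -> (forall n, 0 <= tau n) -> tau @ \oo --> +oo ->
  admissible U u0 -> trajectory f xinit u0 x0 -> tau_optimal f g U xinit tau u0 x0 ->
  (forall xi : 'cV[R]_m, trajectory f (xinit + xi) u0 (X xi)) ->
  (forall xi : 'cV[R]_m, fundamental_matrix f u0 (X xi) (A xi)) ->
  (\forall q \near @joint_filter R m, 0 < c q.1 q.2) ->
  c q.1 q.2 @[q --> @joint_filter R m] --> lam ->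
  c q.1 q.2 *: sensitivity g u0 (X q.2) (A q.2) (tau q.1) @[q --> @joint_filter R m] --> p ->
  (forall n, 0 <= c n 0) -> c n 0 @[n --> \oo] --> lam ->
  c n 0 *: sensitivity g u0 (X 0) (A 0) (tau n) @[n --> \oo] --> p ->
  0 <= lam <= 1 -> lam = 1 \/ (lam = 0 /\ norm2 p = 1) ->
  exists psi, [/\ Lambda f g U u0 x0 lam psi, tau_vanishing f g tau u0 x0 lam psi &
    forall T, psi T = (p - lam *: sensitivity g u0 x0 (A 0) T) *m invmx (A 0 T)].
Proof.
move=> UG fg tau0 tauoo adm tx opt tX fA cgt0 clam cI c0 c0lam c0I lam01 lamp.
have XE : forall t : R, 0 <= t -> X 0 t = x0 t.
  by apply: (trajectory_unique fg adm) tx; have := tX 0; rewrite addr0.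
have fA0 := fundamental_matrix_eq XE (fA 0).
have SE n : sensitivity g u0 (X 0) (A 0) (tau n) = sensitivity g u0 x0 (A 0) (tau n).
  exact: sensitivity_eq.
pose psi T := (p - lam *: sensitivity g u0 x0 (A 0) T) *m invmx (A 0 T).
have lam0 : 0 <= lam by case/andP: lam01.
have psi0 : psi 0 = p.
  by rewrite /psi sensitivity0 scaler0 subr0; have [_ ->] := fA0; rewrite invmx1 mulmx1.
have spsi := adjoint_hamiltonian lam p fg adm tx fA0; rewrite -/psi in spsi.
have [stx _] := tx.
exists psi; split; last by [].
- split; last by rewrite psi0.
  split => //.
  + split => // -[l0 pz]; case: lamp => [l1|[_]].
      by move: l0; rewrite l1; apply/eqP; rewrite oner_eq0.
    by rewrite -psi0 pz// norm20 => /eqP; rewrite eq_sym oner_eq0.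
  + by apply: abs_cont_halfline_continuous; case: spsi.
  + apply: (maximum_condition UG fg adm tx tX lam0 (fun b b0 => adjoint_global lam p fg adm tx fA0 b0)).
    have -> : (p - lam *: sensitivity g u0 x0 (A 0) 0) *m invmx (A 0 0) = p by exact: psi0.
    exact: (no_improvement fg tau0 tauoo adm tx opt tX fA cgt0 clam cI lam0).
- pose q n := c n 0 *: sensitivity g u0 (X 0) (A 0) (tau n).
  (* Each state has multiplier c n 0 and initial value q n, chosen so that it vanishes at [tau n].
     Convergence holds along the whole sequence, hence the identity as subsequence. *)
  exists id, (fun n T => (q n - c n 0 *: sensitivity g u0 x0 (A 0) T) *m invmx (A 0 T)),
    (fun=> x0), (fun n => fun=> c n 0); split.
  + by [].
  + move=> n; split; [by [] | exact: (adjoint_hamiltonian _ _ fg adm tx fA0) | exact: stx |].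
    by apply: solves_on_solves => b b0; exact: solves_on_cst.
  + move=> t t0; split; [| exact: cvg_cst | exact: c0lam].
    apply/cvgrPdist_lt => e e0.
    set S := sensitivity g u0 x0 (A 0) t; set V := invmx (A 0 t).
    have h : (q n - c n 0 *: S) @[n --> \oo] --> p - lam *: S.
      by apply: cvgB => //; apply: cvgZr_tmp.
    have e1 : 0 < e / (m%:R * `|V| + 1) by rewrite divr_gt0// ltr_wpDl// mulr_ge0.
    have /cvgrPdist_lt/(_ _ e1) := h; apply: filterS => n hn.
    rewrite -mulmxBl (le_lt_trans (mx_norm_mul_le _ _))//.
    rewrite mulrAC.
    have V1 : 0 < m%:R * `|V| + 1 by rewrite ltr_wpDl// mulr_ge0.
    move: hn; rewrite ltr_pdivlMr// mulrDr mulr1 mulrC; apply: le_lt_trans.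
    by rewrite lerDl.
  + by move=> n; rewrite /q SE subrr mul0mx.
Qed.

Lemma sensitivity_continuous (R : realType) m k
    (f : dynamics R m k)
    (g : running R m k) (U : R -> set 'cV[R]_k) (xinit : 'cV[R]_m)
    (u0 : R -> 'cV[R]_k)
    (X : 'cV[R]_m -> R -> 'cV[R]_m) (A : 'cV[R]_m -> R -> 'M[R]_m) (b : R) :
  regularity_conditions f g -> admissible U u0 ->
  (forall xi : 'cV[R]_m, trajectory f (xinit + xi) u0 (X xi)) ->
  (forall xi : 'cV[R]_m, fundamental_matrix f u0 (X xi) (A xi)) ->
  0 <= b -> {for 0, continuous (fun xi => sensitivity g u0 (X xi) (A xi) b)}.
Proof.
move=> fg adm tX fA b0; have [C C0 hC] := quadratic_expansion fg adm tX fA b0.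
have h := @gradient_continuous R m (fun xi => payoff g u0 (X xi) b)
  (fun xi => sensitivity g u0 (X xi) (A xi) b) C C0 hC.
apply/(@cvgrPdist_lt _ _ _ (nbhs (0 : 'cV[R]_m))) => e e0.
have C1 : 0 < 6 * C + 2 by lra.
have em : 0 < Num.min e 1 by rewrite lt_min e0 ltr01.
have em0 : 0 < Num.min e 1 / (6 * C + 2) by rewrite divr_gt0.
near=> xi.
have : `|xi| < Num.min e 1 / (6 * C + 2).
  rewrite -[`|xi|]normrN -sub0r; near: xi.
  by have := @nbhsx_ballx _ _ (0 : 'cV[R]_m) _ em0; rewrite -ball_normE.
rewrite ltr_pdivlMr// => hxi.
have := normr_ge0 xi; have Cx := mulr_ge0 C0 (normr_ge0 xi) => x0.
have m1 : Num.min e 1 <= 1 by rewrite ge_min lexx orbT.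
have me : Num.min e 1 <= e by rewrite ge_min lexx.
rewrite distrC; apply: le_lt_trans (h xi _) _; first lra.
have [->|xi0] := eqVneq xi 0; first by rewrite normr0 mulr0.
by have : 0 < `|xi| by [rewrite normr_gt0]; lra.
Unshelve. all: by end_near. Qed.

Theorem theorem3 (R : realType) (m k : nat) (m_gt0 : (0 < m)%N)
  (f : R -> 'cV[R]_m -> 'cV[R]_k -> 'cV[R]_m)
  (g : R -> 'cV[R]_m -> 'cV[R]_k -> R)
  (U : R -> set 'cV[R]_k) (xinit : 'cV[R]_m) (tau : nat -> R)
  (u0 : R -> 'cV[R]_k) (x0 : R -> 'cV[R]_m)
  (X : 'cV[R]_m -> R -> 'cV[R]_m) (A : 'cV[R]_m -> R -> 'M[R]_m)
  (U_closed : closed_valued U) (U_graph : borel_graph U)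
  (fg_regular : regularity_conditions f g)
  (tau_ge0 : forall n, 0 <= tau n) (tau_nondecr : nondecreasing_seq tau)
  (tau_oo : tau @ \oo --> +oo)
  (u0_adm : admissible U u0) (x0_traj : trajectory f xinit u0 x0)
  (u0_opt : tau_optimal f g U xinit tau u0 x0)
  (X_traj : forall xi : 'cV[R]_m, trajectory f (xinit + xi) u0 (X xi))
  (A_fund : forall xi : 'cV[R]_m, fundamental_matrix f u0 (X xi) (A xi)) :
  let I (xi : 'cV[R]_m) (b : R) : 'rV[R]_m :=
    sensitivity g u0 (X xi) (A xi) b in
  (forall Istar : 'rV[R]_m,
     I p.2 (tau p.1) @[p --> @joint_filter R m] --> Istar ->
     exists (lam0 : R) (psi0 : R -> 'rV[R]_m),
       [/\ Lambda f g U u0 x0 lam0 psi0,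
           tau_vanishing f g tau u0 x0 lam0 psi0,
           lam0 = 1
         & forall T : R, 0 <= T ->
             psi0 T = (Istar - sensitivity g u0 x0 (A 0) T) *m invmx (A 0 T)])
  /\
  (forall iotastar : 'rV[R]_m,
     (norm2 (I p.2 (tau p.1)))^-1 *: I p.2 (tau p.1)
       @[p --> @joint_filter R m] --> iotastar ->
     norm2 (I p.2 (tau p.1)) @[p --> @joint_filter R m] --> +oo ->
     exists (lam0 : R) (psi0 : R -> 'rV[R]_m),
       [/\ Lambda f g U u0 x0 lam0 psi0,
           tau_vanishing f g tau u0 x0 lam0 psi0,
           lam0 = 0
         & forall T : R, 0 <= T -> psi0 T = iotastar *m invmx (A 0 T)]).
Proof.
move=> I.
have Ic n : {for 0, continuous (fun xi => I xi (tau n))}.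
  exact: (sensitivity_continuous fg_regular u0_adm X_traj A_fund (tau_ge0 n)).
split=> [Istar HI|iota Hiota Hnorm].
  have I0 : I 0 (tau n) @[n --> \oo] --> Istar.
    by apply: (joint_cvg (h := fun n xi => I xi (tau n)) m_gt0 _ HI); exact: nearW.
  have [psi [hL hv hpsi]] : exists psi, [/\ Lambda f g U u0 x0 1 psi,
      tau_vanishing f g tau u0 x0 1 psi &
      forall T, psi T = (Istar - 1 *: sensitivity g u0 x0 (A 0) T) *m invmx (A 0 T)].
    apply: (multiplier_of_limit (c := fun _ _ => 1) U_graph fg_regular tau_ge0 tau_oo
      u0_adm x0_traj u0_opt X_traj A_fund).
    - exact: nearW.
    - exact: cvg_cst.
    - by under eq_fun do rewrite scale1r.
    - by [].
    - exact: cvg_cst.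
    - by under eq_fun do rewrite scale1r.
    - by rewrite ler01 lexx.
    - by left.
  by exists 1, psi; split => // T T0; rewrite hpsi scale1r.
(* A lower bound by 1 keeps the norm away from 0, so that its inverse is positive and continuous;
   being a closed condition, it extends to xi = 0. *)
have N1 : \forall q \near @joint_filter R m, 1 <= norm2 (I q.2 (tau q.1)).
  by have /cvgryPge/(_ 1) := Hnorm.
have Nc n : {for 0, continuous (fun xi => norm2 (I xi (tau n)))}.
  apply: (@continuous_comp _ _ _ (fun xi => I xi (tau n)) (@norm2 R 1 m)) => //.
  exact: continuous_norm2.
have N1' : \forall n \near \oo, 1 <= norm2 (I 0 (tau n)).
  apply: (joint_closed (h := fun n xi => norm2 (I xi (tau n))) (C := [set y : R | 1 <= y]) m_gt0 _ _ N1).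
    exact: nearW.
  exact: closed_ge.
have Vc : \forall n \near \oo, {for 0, continuous (fun xi => (norm2 (I xi (tau n)))^-1)}.
  apply: filterS N1' => n hn; apply: (@cvgV _ _ (nbhs (0 : 'cV[R]_m))); last exact: Nc.
  by rewrite gt_eqF// (lt_le_trans ltr01).
have V0 : (norm2 (I q.2 (tau q.1)))^-1 @[q --> @joint_filter R m] --> 0.
  apply/gtr0_cvgV0 => //.
  by apply: filterS N1 => q; apply: lt_le_trans.
have Hi0 : (norm2 (I 0 (tau n)))^-1 *: I 0 (tau n) @[n --> \oo] --> iota.
  apply: (joint_cvg (h := fun n xi => (norm2 (I xi (tau n)))^-1 *: I xi (tau n)) m_gt0 _ Hiota).
  by apply: filterS Vc => n hn; apply: (@cvgZ _ _ _ (nbhs (0 : 'cV[R]_m))); [exact: hn|exact: Ic].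
(* At xi = 0 the normalised rows eventually have Euclidean norm 1, and continuity passes this to the
   limit: this is the normalisation of psi(0) in [Lambda] for lambda = 0. *)
have iota1 : norm2 iota = 1.
  have h1 : norm2 ((norm2 (I 0 (tau n)))^-1 *: I 0 (tau n)) @[n --> \oo] --> norm2 iota.
    by apply: continuous_cvg Hi0; exact: continuous_norm2.
  have h2 : norm2 ((norm2 (I 0 (tau n)))^-1 *: I 0 (tau n)) @[n --> \oo] --> (1 : R).
    apply: cvg_near_cst.
    apply: filterS N1' => n hn; have n0 := lt_le_trans ltr01 hn.
    by rewrite norm2Z normfV ger0_norm ?ltW// mulVf// gt_eqF.
  exact: (cvg_unique (@norm_hausdorff _ R^o) h1 h2).
have [psi [hL hv hpsi]] : exists psi, [/\ Lambda f g U u0 x0 0 psi,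
    tau_vanishing f g tau u0 x0 0 psi &
    forall T, psi T = (iota - 0 *: sensitivity g u0 x0 (A 0) T) *m invmx (A 0 T)].
  apply: (multiplier_of_limit (c := fun n xi => (norm2 (I xi (tau n)))^-1) U_graph fg_regular
    tau_ge0 tau_oo u0_adm x0_traj u0_opt X_traj A_fund).
  - by apply: filterS N1 => q hq; rewrite invr_gt0 (lt_le_trans ltr01).
  - exact: V0.
  - exact: Hiota.
  (* For small n the norm may be 0, with inverse 0 by convention; the system (S) asks only for a
     nonnegative multiplier. *)
  - by move=> n; rewrite invr_ge0 sqrtr_ge0.
  - exact: (joint_cvg (h := fun n xi => (norm2 (I xi (tau n)))^-1) m_gt0 Vc V0).
  - exact: Hi0.
  - by rewrite lexx ler01.
  - by right.
by exists 0, psi; split => // T T0; rewrite hpsi scale0r subr0.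
Qed.
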